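(* Let $n\ge2$, let $\Omega\subseteq\mathbb{R}^n$ be an open set, let $w\in A_n$, and let $f\in RBV^{n}(\Omega,w)\cap L^n(\Omega,w)$. Then $f\in W^{1,n}(\Omega,w)$ and $$\|\nabla f\|_{L^n(\Omega,w)}\le C\,V_n(f;\Omega,w),$$ where the constant $C>0$ does not depend on $f$. Moreover, $f$ is differentiable almost everywhere.
   Context: A weight is a non-negative, locally integrable function $w$ on $\mathbb{R}^n$, and $w(E)=\int_E w(x)\,dx$. For $1<p<\infty$, $w\in A_p$ means $$[w]_{A_p}=\sup_Q \Big(\frac1{|Q|}\int_Q w\,dx\Big)\Big(\frac1{|Q|}\int_Q w^{1/(1-p)}\,dx\Big)^{p-1}<\infty,$$ the supremum being over all cubes $Q\subset\mathbb{R}^n$ with sides parallel to the axes; $A_n$ is this class with $p=n$, the dimension. $L^n(\Omega,w)$ is the space of measurable $f$ with $\|f\|_{L^n(\Omega,w)}=\big(\int_\Omega|f|^n w\,dx\big)^{1/n}<\infty$. $W^{1,n}(\Omega,w)$ is the space of $f\in L^n(\Omega,w)$ whose first-order weak derivatives $D_jf$ exist and belong to $L^n(\Omega,w)$, $1\le j\le n$; $\nabla f=(D_1f,\dots,D_nf)$. For $f:\Omega\to\mathbb{R}$ and $E\subset\Omega$, $\operatorname{osc}_E(f)=\sup_{x,y\in E}|f(x)-f(y)|$. The weighted Riesz $n$-variation of a measurable $f:\Omega\to\mathbb{R}$ is $$V_n(f;\Omega,w)=\sup\Big[\sum_{B_k\in\mathcal{D}}\Big(\frac{\operatorname{osc}_{B_k}(f)}{r_k}\Big)^n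 w(B_k)\Big]^{1/n},$$ where the supremum is over all countable collections $\mathcal{D}=\{B_k\}$ of pairwise disjoint open balls $B_k$ of radius $r_k$ contained in $\Omega$. $RBV^n(\Omega,w)$ is the set of measurable $f:\Omega\to\mathbb{R}$ with $V_n(f;\Omega,w)<\infty$. ''Almost everywhere'' is with respect to Lebesgue measure on $\Omega$. *)

(* Defs.v *)
From HB Require Import structures.
From mathcomp Require Import all_boot all_order all_algebra.
From mathcomp Require Import all_classical all_reals all_analysis.
Import Order.TTheory GRing.Theory Num.Theory.
Import numFieldNormedType.Exports.

Set Implicit Arguments.
Unset Strict Implicit.
Unset Printing Implicit Defensive.

Local Open Scope classical_set_scope.
Local Open Scope ring_scope.

(* R^n is 'rV[R]_n. Its library topology (the one of the sup norm) is the
   Euclidean topology, so `open`, `compact`, `continuous`, `derivable` and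
   `differentiable` are used as they are; Euclidean lengths need `enorm`. *)

Section lebesgue_measure_on_Rn.
Context {R : realType} {n : nat}.
Local Open Scope ereal_scope.
Implicit Types (F : set ('rV[R]_n * 'rV[R]_n)) (A : set 'rV[R]_n).

Definition box (ab : 'rV[R]_n * 'rV[R]_n) : set 'rV[R]_n :=
  [set x | forall i, (ab.1 0 i < x 0 i <= ab.2 0 i)%R].

Definition box_volume (ab : 'rV[R]_n * 'rV[R]_n) : \bar R :=
  (\prod_(i < n) Num.max 0 (ab.2 0 i - ab.1 0 i))%:E.

Definition box_cover A F := countable F /\ A `<=` \bigcup_(ab in F) box ab.

Definition lebesgue_outer A : \bar R :=
  ereal_inf [set \esum_(ab in F) box_volume ab | F in box_cover A].

Lemma box_volume_ge0 ab : 0 <= box_volume ab.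
Proof.
by rewrite lee_fin; apply: prodr_ge0 => i _; rewrite le_max lexx.
Qed.

Lemma lebesgue_outer_ge0 A : 0 <= lebesgue_outer A.
Proof.
apply: le_ereal_inf_tmp => _ [F _ <-].
by apply: esum_ge0 => ab _; exact: box_volume_ge0.
Qed.

Lemma lebesgue_outer0 : lebesgue_outer set0 = 0.
Proof.
apply/eqP; rewrite eq_le lebesgue_outer_ge0 andbT.
apply: ereal_inf_lbound; exists set0; last by rewrite esum_set0.
by split => //; exact: countable0.
Qed.

Lemma le_lebesgue_outer :
  {homo lebesgue_outer : A B / A `<=` B >-> A <= B}.
Proof.
move=> A B AB; apply: ereal_inf_le_tmp => _ [F [cF BF] <-].
by exists F => //; split => //; exact: subset_trans BF.
Qed.

Lemma lebesgue_outer_sigma_subadditive : sigma_subadditive lebesgue_outer.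
Proof.
move=> A; have [[i ioo]|] := pselect (exists i, lebesgue_outer (A i) = +oo).
  rewrite (eseries_pinfty _ _ ioo) ?leey// => k _.
  by rewrite -ltNye (lt_le_trans _ (lebesgue_outer_ge0 _)).
rewrite -forallNE => Aoo.
apply/lee_addgt0Pr => e e0.
rewrite (le_trans _ (epsilon_trick _ _ (ltW e0)))//; last first.
  by move=> k; exact: lebesgue_outer_ge0.
pose P k F := box_cover (A k) F /\
  \esum_(ab in F) box_volume ab
    <= lebesgue_outer (A k) + (e / (2 ^ k.+1)%:R)%:E.
have [G PG] : {G : nat -> set ('rV[R]_n * 'rV[R]_n) & forall k, P k (G k)}.
  apply: (@choice _ _ P) => k.
  have ek : (0 < e / (2 ^ k.+1)%:R)%R by rewrite divr_gt0// ltr0n expn_gt0.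
  have fA : lebesgue_outer (A k) \is a fin_num.
    by rewrite ge0_fin_numE ?lebesgue_outer_ge0// ltey; exact/eqP/Aoo.
  have [_ [F AF <-] lF] := lb_ereal_inf_adherent ek fA.
  by exists F; split => //; exact: ltW.
apply: (@le_trans _ _ (\esum_(ab in \bigcup_k G k) box_volume ab)).
  apply: ereal_inf_lbound; exists (\bigcup_k G k) => //; split.
    by apply: bigcup_countable => // k _; exact: (PG k).1.1.
  move=> x [k _ Akx]; have [ab Gab abx] := (PG k).1.2 x Akx.
  by exists ab => //; exists k.
rewrite seqDU_bigcup_eq nneseries_sum_bigcup; last 2 first.
- exact: trivIset_seqDU.
- exact: box_volume_ge0.
apply: lee_nneseries => [k _ _|k _].
  by apply: esum_ge0 => ab _; exact: box_volume_ge0.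
apply: le_trans (PG k).2.
rewrite esum_mkcond [leRHS]esum_mkcond; apply: le_esum => ab _.
case: ifPn => [|_]; last by case: ifPn => // _; exact: box_volume_ge0.
by rewrite inE => -[Gab _]; rewrite mem_set.
Qed.

HB.instance Definition _ := isOuterMeasure.Build R 'rV[R]_n lebesgue_outer
  lebesgue_outer0 lebesgue_outer_ge0 le_lebesgue_outer
  lebesgue_outer_sigma_subadditive.

End lebesgue_measure_on_Rn.

Section lebesgue_space.
Context (R : realType) (n : nat).

(* R^n with the complete sigma-algebra of Lebesgue (i.e., Caratheodory)
   measurable sets, which is strictly larger than the Borel one. *)
Definition lebesgue_space : Type := caratheodory_type (@lebesgue_outer R n).
HB.instance Definition _ := Measurable.on lebesgue_space.

Definition lebesgue : set lebesgue_space -> \bar R := @lebesgue_outer R n.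
Let lebesgue0 : lebesgue set0 = 0%E.
Proof. exact: caratheodory_measure0. Qed.

Let lebesgue_ge0 A : (0 <= lebesgue A)%E.
Proof. exact: caratheodory_measure_ge0. Qed.

Let lebesgue_sigma_additive : semi_sigma_additive lebesgue.
Proof. exact: caratheodory_measure_sigma_additive. Qed.

HB.instance Definition _ := isMeasure.Build _ lebesgue_space R lebesgue
  lebesgue0 lebesgue_ge0 lebesgue_sigma_additive.

End lebesgue_space.

Section euclidean.
Context {R : realType} {n : nat}.
Implicit Types (x c : 'rV[R]_n) (r l : R).

Definition enorm x : R := Num.sqrt (\sum_(i < n) x 0 i ^+ 2).

Definition eball c r : set 'rV[R]_n := [set x | enorm (x - c) < r].

(* The cube with sides parallel to the axes, lowest corner c and side l. *)
Definition cube c l : set 'rV[R]_n :=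
  [set x | forall i, c 0 i <= x 0 i <= c 0 i + l].

End euclidean.

Section integrability.
Context {R : realType} {n : nat}.
Implicit Types (D : set 'rV[R]_n) (f : 'rV[R]_n -> R).
Local Open Scope ereal_scope.

Definition lmeasurable_fun D f :=
  measurable_fun (D : set (lebesgue_space R n)) (f : lebesgue_space R n -> R).

Definition locally_integrable_on D f := lmeasurable_fun D f /\
  forall K, K `<=` D -> compact K -> \int[@lebesgue R n]_(x in K) `|f x|%:E < +oo.

Definition average D (g : 'rV[R]_n -> \bar R) : \bar R :=
  (fine (lebesgue D))^-1%:E * \int[@lebesgue R n]_(x in D) g x.

End integrability.

Section weights.
Context {R : realType} {n : nat}.
Implicit Types (w : 'rV[R]_n -> R) (p : R).
Local Open Scope ereal_scope.

Definition weight w :=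
  (forall x, (0 <= w x)%R) /\ locally_integrable_on [set: 'rV[R]_n] w.

Definition wmeasure w (E : set 'rV[R]_n) : \bar R :=
  \int[@lebesgue R n]_(x in E) (w x)%:E.

(* a `^ r for a >= 0, except that 0 `^ r = +oo when r < 0
   (the library's powR has value 0 there). *)
Definition powRy (a r : R) : \bar R :=
  if (a == 0%R) && (r < 0)%R then +oo else (a `^ r)%:E.

Definition Ap_constant p w : \bar R :=
  ereal_sup [set average (cube c l) (fun x => (w x)%:E) *
       poweR (average (cube c l) (fun x => powRy (w x) (1 - p)^-1)) (p - 1)
     | c in [set: 'rV[R]_n] & l in [set l : R | (0 < l)%R]].

(* If w = 0 on a set of positive measure but not almost everywhere, then
   Ap_constant p w = +oo, as for the usual definition. If w = 0 almost
   everywhere, then Ap_constant p w = 0 only because 0 * +oo = 0 in \bar R;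
   the second clause rules out this degenerate case. *)
Definition Ap p w := [/\ weight w,
  ~ {ae @lebesgue R n, forall x, w x = 0%R} & Ap_constant p w < +oo].

End weights.

(* Functions on an open set Omega are represented by total functions on R^n;
   the definitions below only depend on their values on Omega. The exponent of
   all these spaces is the dimension n. *)

Section weighted_spaces.
Context {R : realType} {n : nat}.
Implicit Types (Omega : set 'rV[R]_n) (w f g phi : 'rV[R]_n -> R).
Local Open Scope ereal_scope.

Definition Ln_norm Omega w f : \bar R :=
  poweR (\int[@lebesgue R n]_(x in Omega) (`|f x| ^+ n * w x)%:E) n%:R^-1.

Definition Ln Omega w f := lmeasurable_fun Omega f /\ Ln_norm Omega w f < +oo.

Definition partial (j : 'I_n) f : 'rV[R]_n -> R :=
  fun x => 'D_(delta_mx ord0 j) f x.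

Definition iter_partial (s : seq 'I_n) f := foldr partial f s.

Definition smooth f := forall s : seq 'I_n, continuous (iter_partial s f) /\
  forall j x, derivable (iter_partial s f) x (delta_mx ord0 j).

Definition supp f : set 'rV[R]_n := closure [set x | f x != 0%R].

Definition test_function Omega phi :=
  [/\ smooth phi, compact (supp phi) & supp phi `<=` Omega].

Definition weak_derivative Omega (j : 'I_n) f g :=
  [/\ locally_integrable_on Omega f, locally_integrable_on Omega g &
    forall phi, test_function Omega phi ->
      \int[@lebesgue R n]_(x in Omega) (f x * partial j phi x)%:E =
      - \int[@lebesgue R n]_(x in Omega) (g x * phi x)%:E].

(* Df = (D_1 f, ..., D_n f); it is unique up to a negligible set. *)
Definition weak_gradient Omega f (Df : 'rV[R]_n -> 'rV[R]_n) :=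
  forall j, weak_derivative Omega j f (fun x => Df x ord0 j).

Definition W1n Omega w f := Ln Omega w f /\
  forall j, exists2 g, weak_derivative Omega j f g & Ln Omega w g.

Definition osc (E : set 'rV[R]_n) f : \bar R :=
  ereal_sup [set `|f x - f y|%:E | x in E & y in E].

(* Countable families of pairwise disjoint balls contained in Omega; a ball is
   represented by its center b.1 and its radius b.2. *)
Definition ball_family Omega (B : set ('rV[R]_n * R)) :=
  [/\ countable B, trivIset B (fun b => eball b.1 b.2) &
    forall b, B b -> (0 < b.2)%R /\ eball b.1 b.2 `<=` Omega].

Definition riesz_variation Omega w f : \bar R :=
  ereal_sup [set poweR
      (\esum_(b in B) ((osc (eball b.1 b.2) f * b.2^-1%:E) ^+ n *
                       wmeasure w (eball b.1 b.2))) n%:R^-1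
    | B in ball_family Omega].

Definition RBVn Omega w f :=
  lmeasurable_fun Omega f /\ riesz_variation Omega w f < +oo.

End weighted_spaces.

(* Main.v *)
Require Import Defs.
From HB Require Import structures.
From mathcomp Require Import all_boot all_order all_algebra.
From mathcomp Require Import all_classical all_reals all_analysis.
From mathcomp Require Import measurable_realfun.
From mathcomp Require Import lra ring.
Import Order.TTheory GRing.Theory Num.Theory.
Import numFieldNormedType.Exports.

Set Implicit Arguments.
Unset Strict Implicit.
Unset Printing Implicit Defensive.

Local Open Scope classical_set_scope.
Local Open Scope ring_scope.

(** The A_n condition enters only through two of its consequences: w > 0 almost
    everywhere, and the dual weight w^(1/(1-n)) is locally integrable
    ([Ap_dual_weight]). By Young's inequality
      |a| <= d |a|^n w + d^(1/(1-n)) w^(1/(1-n)),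
    a family of functions with bounded norm in L^n(w) is then uniformly
    integrable on bounded sets, and sets of small w-measure have small Lebesgue
    measure ([integral_young_le]).

    The variation is used twice. Space is divided into cells of side h, each one
    lying with its translate in a ball of radius comparable to h, so that the
    cells fall into finitely many classes with disjoint balls. This bounds the
    difference quotients of f by a multiple of the variation V in L^n(w), for
    all steps h and all directions of the axes
    ([integral_difference_quotient_le]). Moreover, the points where f is not
    pointwise Lipschitz are covered by arbitrarily small balls of radius r on
    which osc(f) > M r, for M arbitrarily large. Disjoint balls of this kind
    have total w-measure at most (V / M)^n, so by Vitali's lemma f is pointwise
    Lipschitz almost everywhere ([ae_pointwise_lipschitz]).

    The difference quotients along the j-th axis are uniformly integrable.
    Along an ultrafilter their indefinite integrals converge to a charge, which
    has a density g_j by Radon-Nikodym's theorem ([ultralimit_density]). The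
    integral of f over a small cube therefore varies with the position of the
    cube at a rate given by integrals of the g_j
    ([Rintegral_ball_increment_le]). Let x be a Lebesgue point of all g_j and a
    density point of the set of the points at which f satisfies a Lipschitz
    condition with a fixed constant. The means of f over small cubes near x are
    then close to an affine function. As most points near x satisfy the
    Lipschitz condition, the values of f are close to its means, and f is
    differentiable at x ([differentiable_good_point]). Almost every point of
    Omega is of this kind ([ae_differentiable]).

    Consequently the difference quotients converge almost everywhere. Fatou's
    lemma bounds the limits in L^n(w) by a multiple of V
    ([integral_normX_partial_limit_le]), and Young's inequality together with
    dominated convergence gives convergence in L^1 on compact sets
    ([difference_quotient_L1_cvg]). By translation invariance of the integral, a
    difference quotient moves from f to a test function; in the limit, the
    classical partial derivatives are the weak ones
    ([weak_derivative_partial_limit]). Weak derivatives are unique almost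
    everywhere, as smooth bumps detect the value of a function at its Lebesgue
    points ([weak_derivative_unique]), so the bound holds for every weak
    gradient, with the constant 18 n^4 ([Ln_norm_weak_gradient_le]).

    The facts on Lebesgue measure that this requires (volume of boxes,
    translation invariance, measurability of open sets, outer regularity,
    Vitali's lemma, Lebesgue points) are derived from its definition as an outer
    measure. On R^n, [ball] refers to the sup norm, so it denotes an open cube,
    whereas [eball] is a Euclidean ball. *)

(** * Volume of boxes *)

Section box_volume.
Context {R : realType} {n : nat}.
Local Open Scope ereal_scope.
Implicit Types (ab : 'rV[R]_n * 'rV[R]_n) (x : 'I_n -> R).

Let side ab (i : 'I_n) : set R := [set t | (ab.1 0 i < t <= ab.2 0 i)%R].

Let side_itv ab i : side ab i = `]ab.1 0%R i, ab.2 0%R i]%classic.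
Proof. by apply/seteqP; split=> t /=; rewrite in_itv. Qed.

(** Interpolates between the indicator of a box (k = 0) and its volume (k = n):
    integration in the k-th coordinate raises k by one. *)
Let partial_volume k ab x : R :=
  (\prod_(i < n) if (i < k)%N then Num.max 0 (ab.2 0 i - ab.1 0 i)
                 else \1_(side ab i) (x i))%R.

Let partial_volume_ge0 k ab x : (0 <= partial_volume k ab x)%R.
Proof.
by apply: prodr_ge0 => i _; case: ifP => // _; rewrite le_max lexx.
Qed.

Let partial_volumeS k (kn : (k < n)%N) ab x :
  \int[lebesgue_measure]_t
    (partial_volume k ab (fun i => if i == k :> nat then t else x i))%:E
  = (partial_volume k.+1 ab x)%:E.
Proof.
pose i0 := Ordinal kn.
pose C := (\prod_(i < n | i != i0) if (i < k)%N
   then Num.max 0 (ab.2 0 i - ab.1 0 i) else \1_(side ab i) (x i))%R.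
have C0 : (0 <= C)%R.
  by apply: prodr_ge0 => i _; case: ifP => // _; rewrite le_max lexx.
transitivity (\int[lebesgue_measure]_t (C%:E * (\1_(side ab i0) t)%:E)).
  apply: eq_integral => t _; rewrite /partial_volume (bigD1 i0)//= ltnn eqxx.
  rewrite mulrC EFinM; congr (_%:E * _).
  apply: eq_bigr => i ii0; case: ifP => // _.
  by rewrite ifN// -[k]/(nat_of_ord i0) (inj_eq val_inj).
rewrite ge0_integralZl_EFin//; last first.
  apply/measurable_EFinP; apply: measurable_indic.
  by rewrite side_itv; exact: measurable_itv.
rewrite integral_indic ?setIT//; last by rewrite side_itv; exact: measurable_itv.
rewrite side_itv /= lebesgue_measure_itv/= /partial_volume (bigD1 i0)//= ltnS leqnn.
rewrite muleC EFinM; congr (_ * _%:E).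
  case: ifPn; rewrite lte_fin => h.
    by rewrite -EFinD max_r// subr_ge0 ltW.
  by rewrite max_l// subr_le0 leNgt.
apply: eq_bigr => i ii0; suff -> : (i < k.+1)%N = (i < k)%N by [].
by rewrite ltnS leq_eqVlt -[X in _ == X]/(nat_of_ord i0) (inj_eq val_inj) (negbTE ii0).
Qed.

Let measurable_partial_volume k ab x :
  measurable_fun [set: R] (fun t : R =>
    partial_volume k ab (fun i => if i == k :> nat then t else x i)).
Proof.
rewrite /partial_volume; apply: measurable_prod => /= i _; case: (i < k)%N => //.
case: (i == k :> nat) => //; apply: measurable_indic.
by rewrite side_itv; exact: measurable_itv.
Qed.

(** The sequence c selects the indices in use: the enumeration of a countable
    family may be finite or have gaps. *)
Let partial_volume_cover k (kn : (k <= n)%N) ab0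
    (ab : nat -> 'rV[R]_n * 'rV[R]_n) (c : nat -> bool) :
  (forall x, (partial_volume 0 ab0 x)%:E <=
     \sum_(m <oo) ((c m)%:R * partial_volume 0 (ab m) x)%:E) ->
  forall x, (partial_volume k ab0 x)%:E <=
     \sum_(m <oo) ((c m)%:R * partial_volume k (ab m) x)%:E.
Proof.
have mpv j ab' x : measurable_fun [set: R] (fun t : R =>
    (partial_volume j ab' (fun i => if i == j :> nat then t else x i))%:E).
  by apply/measurable_EFinP; exact: measurable_partial_volume.
have mcpv j m x : measurable_fun [set: R] (fun t : R => (c m)%:R%:E *
    (partial_volume j (ab m) (fun i => if i == j :> nat then t else x i))%:E).
  by apply: measurable_funeM; exact: mpv.
have c0 m j x : 0 <= ((c m)%:R * partial_volume j (ab m) x)%:E.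
  by rewrite lee_fin mulr_ge0.
move=> h0; elim: k kn => // k ih kn x.
rewrite -partial_volumeS//.
have -> : \sum_(m <oo) ((c m)%:R * partial_volume k.+1 (ab m) x)%:E =
    \sum_(m <oo) \int[lebesgue_measure]_t ((c m)%:R%:E * (partial_volume k (ab m)
      (fun i => if i == k :> nat then t else x i))%:E).
  apply: eq_eseriesr => m _.
  rewrite ge0_integralZl_EFin//; [by rewrite partial_volumeS| |exact: mpv].
  by move=> t _; rewrite lee_fin.
rewrite -integral_nneseries; [|exact: measurableT|by move=> m; exact: mcpv|]; last first.
  by move=> m t _; exact: c0.
apply: ge0_le_integral => //.
- by move=> t _; rewrite lee_fin.
- exact: mpv.
- apply: (@ge0_emeasurable_sum _ _ _ _ _ predT) => [m t _ _|m _].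
    exact: c0.
  exact: mcpv.
by move=> t _; exact: ih (ltnW kn) _.
Qed.

Let partial_volume0 ab x : partial_volume 0 ab x = \1_(box ab) (\row_i x i).
Proof.
rewrite /partial_volume/= indicE; case: (boolP (_ \in _)) => [|].
  rewrite inE => h; rewrite big1// => i _; rewrite indicE mem_set//.
  by have := h i; rewrite mxE.
rewrite notin_setE => /existsNP[i h]; rewrite (bigD1 i)//= indicE memNset ?mul0r//.
by move: h; rewrite mxE.
Qed.

(** The indicator of the box is at most the sum of the indicators of the boxes
    that cover it. Integrating this inequality in one coordinate after another,
    against Lebesgue measure on the line, turns the indicators into volumes. *)
Lemma box_volume_cover ab0 (F : set ('rV[R]_n * 'rV[R]_n)) :
  countable F -> box ab0 `<=` \bigcup_(ab in F) box ab ->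
  box_volume ab0 <= \esum_(ab in F) box_volume ab.
Proof.
move=> /countable_bijP[D /card_esym/card_set_bijP[ab bijab]] cover0.
rewrite (reindex_esum D F ab)//.
pose c m := m \in D.
have -> : \esum_(m in D) box_volume (ab m) =
    \sum_(m <oo) ((c m)%:R%:E * box_volume (ab m)).
  rewrite esum_mkcond -nneseries_esumT.
    apply: eq_eseriesr => m _; rewrite /c; case: ifPn => _.
      by rewrite mul1e.
    by rewrite mul0e.
  by move=> m; case: ifPn => // _; exact: box_volume_ge0.
pose o : 'I_n -> R := fun=> 0%R.
have volE ab' : box_volume ab' = (partial_volume n ab' o)%:E.
  by congr EFin; apply: eq_bigr => i _; rewrite ltn_ord.
rewrite volE; under eq_eseriesr do rewrite volE -EFinM.
apply: partial_volume_cover => // x.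
under eq_eseriesr do rewrite partial_volume0.
rewrite partial_volume0 indicE.
case: (boolP (_ \in _)) => [|_]; last first.
  by apply: nneseries_ge0 => m _ _; rewrite lee_fin mulr_ge0// indicE.
rewrite inE => /cover0[ab' Fab' xab'].
have [m Dm mab'] : exists2 m, D m & ab m = ab'.
  have [_ _ surj] := bijab; have [m Dm <-] := surj _ Fab'.
  by exists m.
rewrite (@nneseriesD1 _ _ m)//=.
rewrite indicE mab' mem_set// /c mem_set// mulr1 leeDl//.
by apply: nneseries_ge0 => k _ _; rewrite lee_fin mulr_ge0.
Qed.

Lemma lebesgue_outer_box ab : lebesgue_outer (box ab) = box_volume ab.
Proof.
apply/eqP; rewrite eq_le; apply/andP; split; last first.
  by apply: le_ereal_inf_tmp => _ [F [cF abF] <-]; exact: box_volume_cover.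
apply: ereal_inf_lbound; exists [set ab]; last first.
  by rewrite esum_set1//; exact: box_volume_ge0.
by split; [exact: countable1|move=> x abx; exists ab].
Qed.

End box_volume.

(** * Measurable sets and outer regularity *)

Notation lmeasurable A := (measurable (A : set (lebesgue_space _ _))).

Section lebesgue_outer_theory.
Context {R : realType} {n : nat}.
Local Open Scope ereal_scope.
Implicit Types (A : set 'rV[R]_n) (x : 'rV[R]_n).

Lemma lebesgue_outer_cover (I : pointedType) (F : set I)
    (b : I -> 'rV[R]_n * 'rV[R]_n) A :
  countable F -> A `<=` \bigcup_(i in F) box (b i) ->
  lebesgue_outer A <= \esum_(i in F) box_volume (b i).
Proof.
move=> /countable_bijP[D /card_esym/card_set_bijP[e bije]] AF.
rewrite (reindex_esum D F e)// esum_mkcond -nneseries_esumT; last first.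
  by move=> m; case: ifPn => // _; exact: box_volume_ge0.
pose G m := if m \in D then box (b (e m)) else set0.
apply: (@le_trans _ _ (lebesgue_outer (\bigcup_m G m))).
  apply: le_lebesgue_outer => x /AF[i Fi bix].
  have [_ _ surj] := bije; have [m Dm em] := surj _ Fi.
  by exists m => //; rewrite /G mem_set// em.
apply: (le_trans (lebesgue_outer_sigma_subadditive G)).
apply: lee_nneseries => [m _ _|m _]; first exact: lebesgue_outer_ge0.
rewrite /G; case: ifPn => _; last by rewrite lebesgue_outer0.
by rewrite lebesgue_outer_box.
Qed.

(** Translating the boxes of a cover gives one inequality, and the other one is
    the same inequality for the opposite translation. *)
Lemma lebesgue_outer_shift A (a : 'rV[R]_n) :
  lebesgue_outer ((fun x => x + a)%R @^-1` A) = lebesgue_outer A.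
Proof.
suff le_shift B b : lebesgue_outer ((fun x => x + b)%R @^-1` B) <= lebesgue_outer B.
  apply/eqP; rewrite eq_le le_shift/=.
  have := le_shift ((fun x => x + a)%R @^-1` A) (- a)%R.
  rewrite (_ : _ @^-1` (_ @^-1` A) = A)//.
  by apply/seteqP; split=> x /=; rewrite subrK.
apply: le_ereal_inf_tmp => _ [F [cF BF] <-].
pose s (ab : 'rV[R]_n * 'rV[R]_n) := (ab.1 - b, ab.2 - b)%R.
have -> : \esum_(ab in F) box_volume ab = \esum_(ab in F) box_volume (s ab).
  apply: eq_esum => ab _; congr EFin; apply: eq_bigr => i _ /=.
  by rewrite !mxE; congr Num.max; lra.
apply: lebesgue_outer_cover => // x /BF[ab Fab xab]; exists ab => // i.
by have := xab i; rewrite /= !mxE; lra.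
Qed.

(** A hyperplane orthogonal to an axis cuts every box of a cover into two boxes
    whose volumes add up; this is Caratheodory's condition. *)
Lemma measurable_halfspace (i : 'I_n) (t : R) :
  lmeasurable [set x : 'rV[R]_n | (x 0 i <= t)%R].
Proof.
apply: le_caratheodory_measurable => A /=.
rewrite [leRHS]/lebesgue_outer.
apply: le_ereal_inf_tmp => _ [F [cF AF] <-].
pose lo (ab : 'rV[R]_n * 'rV[R]_n) : 'rV[R]_n * 'rV[R]_n :=
  (ab.1, \row_j if j == i then Num.min (ab.2 0 j) t else ab.2 0 j)%R.
pose up (ab : 'rV[R]_n * 'rV[R]_n) : 'rV[R]_n * 'rV[R]_n :=
  (\row_j if j == i then Num.max (ab.1 0 j) t else ab.1 0 j, ab.2)%R.
have -> : \esum_(ab in F) box_volume ab =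
    \esum_(ab in F) box_volume (lo ab) + \esum_(ab in F) box_volume (up ab).
  rewrite -esumD; [|by move=> *; exact: box_volume_ge0..].
  pose vol (ab : 'rV[R]_n * 'rV[R]_n) := (\prod_(j < n | j != i) Num.max 0 (ab.2 0 j - ab.1 0 j))%R : R.
  have volE ab : box_volume ab = (Num.max 0 (ab.2 0 i - ab.1 0 i) * vol ab)%:E.
    by rewrite /box_volume (bigD1 i).
  apply: eq_esum => ab _; rewrite 3!volE -EFinD; congr EFin.
  have -> : vol (lo ab) = vol ab.
    by apply: eq_bigr => j /negbTE ji; rewrite mxE ji.
  have -> : vol (up ab) = vol ab.
    by apply: eq_bigr => j /negbTE ji; rewrite mxE ji.
  rewrite !mxE eqxx.
  rewrite -mulrDl; congr (_ * _)%R.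
  rewrite /Num.max/Num.min; do ! case: ifPn; lra.
apply: leeD; apply: lebesgue_outer_cover => // x [/AF[ab Fab xab] xt];
  exists ab => // j; have := xab j; rewrite /= !mxE; case: eqP => // ->.
- by case/andP=> -> /= xb; rewrite le_min xb.
- by case/andP=> xa ->; rewrite andbT gt_max xa/= ltNge; exact/negP.
Qed.

Lemma measurable_coord (i : 'I_n) : lmeasurable_fun [set: 'rV[R]_n] (fun x => x 0%R i).
Proof.
apply: (measurability _ (RGenCInfty.measurableE R)) => //= _ [_ [t ->] <-].
rewrite setTI [X in measurable X](_ : _ = \bigcap_k ~` [set x : 'rV[R]_n | (x 0 i <= t - k.+1%:R^-1)%R]).
  apply: bigcap_measurable => [|k _]; first by exists 0%N.
  exact/measurableC/measurable_halfspace.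
apply/seteqP; split=> [x /= + k _|x /= xt].
  rewrite in_itv/= andbT => tx; apply/negP; rewrite -ltNge.
  by rewrite (lt_le_trans _ tx)// ltrBlDr ltrDl invr_gt0.
rewrite in_itv/= andbT leNgt; apply/negP => xt'.
have [k kxt] : exists k, (k.+1%:R^-1 < t - x 0 i :> R)%R.
  have /ltr_add_invr[k] : (x 0 i < t)%R by [].
  by exists k; rewrite ltrBrDl.
by have /= xtk := xt k Logic.I; apply: xtk; rewrite lerBrDr -lerBrDl ltW.
Qed.

End lebesgue_outer_theory.

Section open_sets.
Context {R : realType} {n : nat}.
Implicit Types (x : 'rV[R]_n) (r : R).

Lemma lmeasurable_ball x r : lmeasurable (ball x r).
Proof.
have [r0|r0] := leP r 0.
  by rewrite (_ : ball x r = set0)// -subset0 => y [r0']; rewrite ltNge r0 in r0'.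
rewrite [X in measurable X](_ : _ = \bigcap_(i in [set: 'I_n])
    (fun y : lebesgue_space R n => (y : 'rV[R]_n) 0 i) @^-1` (ball (x 0 i) r)).
  apply: fin_bigcap_measurable => // i _; rewrite -[X in measurable X]setTI.
  by apply: measurable_coord => //; exact: measurable_ball.
apply/seteqP; split=> y; first by move=> [_ xy] i _; exact: xy.
by move=> xy; split => // i j; rewrite (ord1 i); exact: xy.
Qed.

Let rational_ball (q : 'rV[rat]_n * rat) : set 'rV[R]_n :=
  ball (\row_j (ratr (q.1 0 j) : R)) (ratr q.2 : R).

Let rational_ball_basis (U : set 'rV[R]_n) x : open U -> U x ->
  exists2 q, rational_ball q x & rational_ball q `<=` U.
Proof.
move=> oU Ux.
have /nbhs_ballP[r /= r0 xrU] : nbhs x U by exact: open_nbhs_nbhs.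
have [s /andP[s1 s2]] : exists s : rat, r / 4 < (ratr s : R) < r / 2.
  have r42 : r / 4 < r / 2 by lra.
  by have [s] := rat_in_itvoo r42; rewrite in_itv/= => ?; exists s.
have [y yx] : exists y : 'I_n -> rat, forall j, `|x 0 j - ratr (y j)| < ratr s.
  suff [y yP] : {y : 'I_n -> rat & forall j, `|x 0 j - ratr (y j)| < ratr s}.
    by exists y.
  apply: (@choice _ _ (fun j q => `|x 0 j - ratr q| < ratr s)) => j.
  have xs : x 0 j < x 0 j + ratr s by lra.
  have [q] := rat_in_itvoo xs; rewrite in_itv/= => /andP[q1 q2]; exists q.
  by rewrite ltr_norml; apply/andP; split; lra.
have s0 : 0 < ratr s :> R by lra.
have xq : rational_ball (\row_j y j, s) x.
  split => // j k; rewrite (ord1 j) !mxE /ball/= distrC; exact: yx.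
exists (\row_j y j, s) => // z yz; apply: xrU.
apply: (@le_ball _ _ _ (ratr s + ratr s)); first lra.
by apply: ball_triangle yz; exact: ball_sym.
Qed.

Lemma open_lmeasurable (U : set 'rV[R]_n) : open U -> lmeasurable U.
Proof.
move=> oU.
rewrite [X in measurable X](_ : U =
    \bigcup_q if `[< rational_ball q `<=` U >] then rational_ball q else set0).
  apply: countable_bigcupT_measurable => [|q]; first exact: countableP.
  by case: ifPn => // _; exact: lmeasurable_ball.
apply/seteqP; split=> [x Ux|x [q _]]; last by case: asboolP => // qU /qU.
have [q qx qU] := rational_ball_basis oU Ux.
by exists q => //; case: asboolP.
Qed.

(** Lindelof's property: every rational ball contained in some member of the
    family selects one such member. The sequence takes the value [None] at the
    rational balls that select nothing. *)
Lemma lindelof (I : Type) (D : set I) (U : I -> set 'rV[R]_n) :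
  (forall i, D i -> open (U i)) ->
  exists2 c : nat -> option I, (forall m i, c m = Some i -> D i) &
    \bigcup_(i in D) U i `<=` \bigcup_m oapp U set0 (c m).
Proof.
move=> oU.
have [c cP] : {c : 'rV[rat]_n * rat -> option I & forall q,
    (forall i, c q = Some i -> D i) /\
    forall i, D i -> rational_ball q `<=` U i -> rational_ball q `<=` oapp U set0 (c q)}.
  apply: (@choice _ _ (fun q ci => (forall i, ci = Some i -> D i) /\
    forall i, D i -> rational_ball q `<=` U i -> rational_ball q `<=` oapp U set0 ci)) => q.
  have [[i Di qi]|nQ] := pselect (exists2 i, D i & rational_ball q `<=` U i).
    by exists (Some i); split => // j [<-].
  by exists None; split => // i Di qi; exfalso; apply: nQ; exists i.
exists (fun m => obind c (unpickle m)) => [m i|x [i Di Uix]].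
  by case: (unpickle m) => //= q; exact: (cP q).1.
have [q qx qU] := rational_ball_basis (oU _ Di) Uix.
exists (pickle q) => //; rewrite pickleK/=.
exact: (cP q).2 Di qU _ qx.
Qed.

Lemma closed_lmeasurable (K : set 'rV[R]_n) : closed K -> lmeasurable K.
Proof.
by move=> /closed_openC/open_lmeasurable/measurableC; rewrite setCK.
Qed.

Lemma continuous_lmeasurable_fun (f : 'rV[R]_n -> R) :
  continuous f -> lmeasurable_fun setT f.
Proof.
move=> /continuousP cf; apply: (measurability _ (RGenOpens.measurableE R)) => //.
by move=> _ [_ [a [b ->] <-]]; rewrite setTI; exact/open_lmeasurable/cf/interval_open.
Qed.

Local Open Scope ereal_scope.

Lemma lebesgue_ball_le x r : (0 <= r)%R -> lebesgue (ball x r) <= ((2 * r) ^+ n)%:E.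
Proof.
move=> r0; pose ab := (\row_i (x 0%R i - r), \row_i (x 0%R i + r))%R : 'rV[R]_n * 'rV[R]_n.
apply: (@le_trans _ _ (lebesgue_outer (box ab))).
  apply: le_lebesgue_outer => y [_ xy] i; rewrite !mxE.
  by have := xy 0%R i; rewrite /ball/= ltr_distlC => /andP[-> /ltW].
rewrite lebesgue_outer_box lee_fin (eq_bigr (fun=> 2 * r)%R).
  by rewrite prodr_const card_ord.
by move=> i _; rewrite !mxE max_r; lra.
Qed.

Lemma lebesgue_ball_ge x r : (0 < r)%R -> (r ^+ n)%:E <= lebesgue (ball x r).
Proof.
move=> r0; pose ab := (\row_i (x 0%R i - r / 2), \row_i (x 0%R i + r / 2))%R
  : 'rV[R]_n * 'rV[R]_n.
apply: (@le_trans _ _ (lebesgue_outer (box ab))); last first.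
  apply: le_lebesgue_outer => y yab; split=> // j i; rewrite (ord1 j).
  by have := yab i; rewrite !mxE /ball/= ltr_distlC; lra.
rewrite lebesgue_outer_box lee_fin (eq_bigr (fun=> r)%R).
  by rewrite prodr_const card_ord.
by move=> i _; rewrite !mxE max_r; lra.
Qed.

Let continuous_cvg_max0 (T : Type) (F : set_system T) (FF : Filter F) (f : T -> R) (l : R) :
  f x @[x --> F] --> l -> Num.max 0%R (f x) @[x --> F] --> Num.max 0%R l.
Proof.
have maxE (t : R) : Num.max 0%R t = ((t + `|t|) / 2)%R.
  by have [t0|t0] := leP 0%R t; [rewrite ger0_norm|rewrite ltr0_norm]; lra.
move=> fl; under eq_fun do rewrite maxE.
by rewrite maxE; apply: cvgMl; apply: cvgD => //; exact: cvg_norm.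
Qed.

(** The boxes of a nearly optimal cover become open when their upper faces are
    pushed outwards, and a small push changes the total volume by little. *)
Lemma lebesgue_outer_regular (A : set 'rV[R]_n) (e : R) : (0 < e)%R ->
  lebesgue_outer A < +oo ->
  exists U, [/\ open U, A `<=` U & lebesgue_outer U <= lebesgue_outer A + e%:E].
Proof.
move=> e0 Aoo.
have Afin : lebesgue_outer A \is a fin_num.
  by rewrite ge0_fin_numE// lebesgue_outer_ge0.
have e20 : (0 < e / 2)%R by lra.
have [_ [F [cF AF] <-] FA] := lb_ereal_inf_adherent e20 Afin.
have /countable_bijP[D /card_esym/card_set_bijP[ab bijab]] := cF.
pose enlarge h (b : 'rV[R]_n * 'rV[R]_n) : 'rV[R]_n * 'rV[R]_n :=
  (b.1, \row_i (b.2 0 i + h))%R.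
have small b m : exists2 h, (0 < h)%R &
    box_volume (enlarge h b) <= box_volume b + ((e / 2) / (2 ^ m.+1)%:R)%:E.
  have d0 : (0 < (e / 2) / (2 ^ m.+1)%:R)%R by rewrite divr_gt0// ltr0n expn_gt0.
  pose v (h : R) := (\prod_(i < n) Num.max 0 (b.2 0 i + h - b.1 0 i))%R.
  have cv : v h @[h --> 0%R] --> v 0%R.
    apply: cvg_big => [x'|i _]; first exact: mul_continuous.
    apply: continuous_cvg_max0.
    by apply: cvgB; [apply: cvgD; [exact: cvg_cst|exact: cvg_id]|exact: cvg_cst].
  have /cvgrPdist_lt/(_ _ d0) := cv.
  move=> /nbhs_ballP[h /= h0 hv]; exists (h / 2)%R; first lra.
  have /hv : ball (0%R : R) h (h / 2)%R.
    by rewrite /ball/= sub0r normrN gtr0_norm; lra.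
  rewrite /= distrC => /(le_lt_trans (ler_norm _)) vh.
  rewrite -EFinD lee_fin (_ : \prod_(i < n) _ = v (h / 2))%R; last first.
    by apply: eq_bigr => i _; rewrite mxE.
  rewrite (_ : \prod_(i < n) _ = v 0)%R; first by move: vh; lra.
  by apply: eq_bigr => i _; rewrite addr0.
have [h hP] : {h : nat -> R & forall m, (0 < h m)%R /\
    box_volume (enlarge (h m) (ab m)) <=
    box_volume (ab m) + ((e / 2) / (2 ^ m.+1)%:R)%:E}.
  apply: (@choice _ _ (fun m h => (0 < h)%R /\ box_volume (enlarge h (ab m)) <=
    box_volume (ab m) + ((e / 2) / (2 ^ m.+1)%:R)%:E)) => m.
  by have [h h0 hm] := small (ab m) m; exists h.
pose V m : set 'rV[R]_n :=
  [set x | forall i, ((ab m).1 0 i < x 0 i < (ab m).2 0 i + h m)%R].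
exists (\bigcup_(m in D) V m); split.
- apply: bigcup_open => m _; rewrite openE => x Vx.
  pose G i : set 'rV[R]_n := [set y | ((ab m).1 0 i < y 0 i < (ab m).2 0 i + h m)%R].
  refine (@filter_forall 'rV[R]_n 'I_n G (nbhs x) (nbhs_filter x) _) => i.
  suff oG : open (G i) by exact: (open_nbhs_nbhs (conj oG (Vx i))).
  rewrite (_ : G i = (fun M : 'rV[R]_n => M 0%R i) @^-1`
    `](ab m).1 0%R i, ((ab m).2 0%R i + h m)%R[%classic); last first.
    by apply/seteqP; split=> y; rewrite /G /= in_itv.
  by apply: open_comp => [y _|]; [exact: coord_continuous|exact: interval_open].
- move=> x /AF[b Fb xb]; have [_ _ surj] := bijab.
  have [m Dm mb] := surj _ Fb; exists m => // i.
  have := xb i; rewrite -mb => /andP[-> /= /le_lt_trans]; apply.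
  by rewrite ltrDl; case: (hP m).
apply: (@le_trans _ _ (\esum_(m in D) box_volume (enlarge (h m) (ab m)))).
  apply: lebesgue_outer_cover => [|x [m Dm Vx]]; first exact: countableP.
  exists m => // i.
  by have := Vx i; rewrite !mxE => /andP[-> /ltW].
apply: (@le_trans _ _ (\esum_(m in D) (box_volume (ab m) + ((e / 2) / (2 ^ m.+1)%:R)%:E))).
  by apply: le_esum => m _; case: (hP m).
have DE : [set m | m \in D] = D by exact: set_mem_set.
rewrite -DE -(nneseries_esum (P := fun m => m \in D)); last first.
  move=> m _; rewrite adde_ge0 ?box_volume_ge0// lee_fin.
  by rewrite divr_ge0// ltW.
apply: (le_trans (epsilon_trick _ _ _)); [by move=> m; exact: box_volume_ge0|exact: ltW|].
rewrite nneseries_esum ?DE; last by move=> m _; exact: box_volume_ge0.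
rewrite [in leRHS](_ : e = e / 2 + e / 2)%R; last lra.
rewrite EFinD addeA leeD2r//; move: FA.
by rewrite (reindex_esum D F ab)// => /ltW.
Qed.

End open_sets.

(** * Translation invariance of the integral *)

Section translation.
Context {R : realType} {n : nat}.
Local Open Scope ereal_scope.
Implicit Types (A D : set 'rV[R]_n) (a : 'rV[R]_n).

Lemma lmeasurable_shift A a : lmeasurable A -> lmeasurable ((fun x => x + a)%R @^-1` A).
Proof.
move=> mA; rewrite /measurable/= /caratheodory_measurable => X.
pose X' := (fun x : 'rV[R]_n => x - a)%R @^-1` X.
have XE : X = (fun x => x + a)%R @^-1` X'.
  by apply/seteqP; split=> x; rewrite /X'/= addrK.
have sub B : lebesgue_outer (X' `&` B) = lebesgue_outer (X `&` (fun x => x + a)%R @^-1` B).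
  by rewrite -(lebesgue_outer_shift (X' `&` B) a) preimage_setI -XE.
rewrite {1}XE lebesgue_outer_shift (mA X'); congr (_ + _); exact: sub.
Qed.

Let shift a : lebesgue_space R n -> lebesgue_space R n := fun x : 'rV[R]_n => (x + a)%R.

Let measurable_shift a : measurable_fun setT (shift a).
Proof. by move=> _ Y mY; rewrite setTI; exact: lmeasurable_shift. Qed.

Lemma lmeasurable_fun_shift D (f : 'rV[R]_n -> R) a :
  lmeasurable D -> lmeasurable_fun D f ->
  lmeasurable_fun ((fun x => x + a)%R @^-1` D) (fun x => f (x + a)%R).
Proof.
move=> mD mf _ Y mY.
rewrite (_ : _ `&` _ = (fun x => x + a)%R @^-1` (D `&` f @^-1` Y))//.
exact/lmeasurable_shift/mf.
Qed.

Lemma ge0_integral_shift D (f : 'rV[R]_n -> \bar R) a : lmeasurable D ->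
  measurable_fun (D : set (lebesgue_space R n)) f -> (forall x, D x -> 0 <= f x) ->
  \int[@lebesgue R n]_(x in (fun x => x + a)%R @^-1` D) f (x + a)%R =
  \int[@lebesgue R n]_(x in D) f x.
Proof.
move=> mD mf f0.
rewrite -(ge0_integral_pushforward (measurable_shift a) (@lebesgue R n) (D := D) (f := f))//; last first.
  by move=> x; rewrite inE; exact: f0.
apply: eq_measure_integral => A mA _.
exact: lebesgue_outer_shift.
Qed.

Lemma integral_shift D (f : 'rV[R]_n -> \bar R) a : lmeasurable D ->
  measurable_fun (D : set (lebesgue_space R n)) f ->
  \int[@lebesgue R n]_(x in (fun x => x + a)%R @^-1` D) f (x + a)%R =
  \int[@lebesgue R n]_(x in D) f x.
Proof.
move=> mD mf; rewrite [LHS]integralE [RHS]integralE; congr (_ - _).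
  rewrite -(ge0_integral_shift a mD (measurable_funepos mf) (fun x _ => funepos_ge0 f x)).
  by apply: eq_integral => x _; rewrite !funeposE.
rewrite -(ge0_integral_shift a mD (measurable_funeneg mf) (fun x _ => funeneg_ge0 f x)).
by apply: eq_integral => x _; rewrite !funenegE.
Qed.

End translation.

Section sigma_finite.
Context (R : realType) (n : nat).
Local Open Scope ereal_scope.

Let bigcup_balls : \bigcup_k ball (0%R : 'rV[R]_n) k.+1%:R = setT.
Proof.
apply/seteqP; split=> // x _.
exists (Num.bound `|x|) => //; rewrite -ball_normE/= sub0r normrN.
rewrite (lt_trans (archi_boundP (normr_ge0 x)))// ltr_nat//.
Qed.

Lemma lebesgue_sigma_finite : sigma_finite setT (@lebesgue R n).
Proof.
exists (fun k => ball (0%R : 'rV[R]_n) k.+1%:R); first by rewrite bigcup_balls.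
move=> k; split; first exact: lmeasurable_ball.
by rewrite (le_lt_trans (lebesgue_ball_le _ _))// ltry.
Qed.

HB.instance Definition _ := @Measure_isSigmaFinite.Build _ (lebesgue_space R n) R
  (@lebesgue R n) lebesgue_sigma_finite.

End sigma_finite.

(** * Vitali's covering lemma *)

Section vitali.
Context {R : realType} {n : nat}.
Implicit Types (b c : 'rV[R]_n * R).

(** Greedy choice: keep a ball of largest radius and discard the balls that meet
    it. They lie in the ball with the same centre and three times its radius. *)
Lemma vitali_finite (s : seq ('rV[R]_n * R)) :
  exists t : seq ('rV[R]_n * R), [/\ uniq t, {subset t <= s},
    trivIset [set` t] (fun b => ball b.1 b.2) &
    forall b x, b \in s -> ball b.1 b.2 x ->
      exists2 c, c \in t & ball c.1 (3 * c.2) x].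
Proof.
have [m] := ubnP (size s); elim: m s => // m ih s sm.
have [[b0 b0s b0r]|s0] := pselect (exists2 b, b \in s & 0 < b.2); last first.
  exists [::]; split => // b x bs bx; exfalso; apply: s0; exists b => //.
  by case: bx.
have [b bs bmax] : exists2 b, b \in s & forall c, c \in s -> c.2 <= b.2.
  have sgt0 : (0 < size s)%N by case: s b0s {sm}.
  exists (nth b0 s [arg max_(i > Ordinal sgt0) (nth b0 s i).2]%O).
    by rewrite mem_nth.
  case: arg_maxP => //= i _ imax c cs.
  have := imax (Ordinal (etrans (index_mem c s) cs)) isT.
  by rewrite /= nth_index.
have b2 : 0 < b.2 by rewrite (lt_le_trans b0r)// bmax.
pose d c := `[< ball c.1 c.2 `&` ball b.1 b.2 = set0 >].
have bd : d b = false.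
  apply/asboolP => /eqP; apply/negP/set0P; exists b.1; rewrite setIid.
  exact: ballxx.
have [|t [ut ts tt tcov]] := ih [seq c <- s | d c].
  rewrite size_filter -(count_predC d s) in sm *.
  rewrite -ltnS (leq_trans _ sm)// ltnS -[X in (X < _)%N]addn0 ltn_add2l -has_count.
  by apply/hasP; exists b => //=; rewrite bd.
exists (b :: t); split.
- rewrite /= ut andbT; apply/negP => /ts.
  by rewrite mem_filter bd.
- move=> c; rewrite inE => /orP[/eqP->//|/ts].
  by rewrite mem_filter => /andP[].
- have td c : c \in t -> ball c.1 c.2 `&` ball b.1 b.2 = set0.
    by move=> /ts; rewrite mem_filter => /andP[/asboolP].
  move=> c c' /=; rewrite !inE => /orP[/eqP->|ct] /orP[/eqP->//|c't] cc'.
  + by case: cc' => y; rewrite setIC td.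
  + by case: cc' => y; rewrite td.
  + exact: tt.
move=> c x cs cx; have [dc|/asboolPn/eqP/set0P[y [cy bY]]] := boolP (d c).
  have [|c' c't c'x] := tcov c x _ cx; first by rewrite mem_filter dc.
  by exists c' => //; rewrite inE c't orbT.
exists b; first by rewrite inE eqxx.
apply: (@le_ball _ _ _ (b.2 + (c.2 + c.2))).
  by have := bmax _ cs; lra.
apply: ball_triangle bY _; apply: ball_triangle cx; exact: ball_sym.
Qed.

Local Open Scope ereal_scope.

(** By Lindelof's property countably many of the balls cover E. The finite lemma
    applies to the first N of them, with a bound that does not depend on N. *)
Lemma vitali_outer (P : set ('rV[R]_n * R)) (E : set 'rV[R]_n) (S : R) :
  (forall b, P b -> (0 < b.2)%R) ->
  (forall x, E x -> exists2 b, P b & ball b.1 b.2 x) ->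
  (forall t : seq ('rV[R]_n * R), uniq t -> (forall b, b \in t -> P b) ->
     trivIset [set` t] (fun b => ball b.1 b.2) ->
     (\sum_(b <- t) b.2 ^+ n <= S)%R) ->
  lebesgue_outer E <= (6 ^+ n * S)%:E.
Proof.
move=> P0 EP PS.
have [c cP cover_c] := @lindelof R n _ P (fun b => ball b.1 b.2)
  (fun b _ => ball_open b.1 b.2).
pose B (o : option ('rV[R]_n * R)) : set (lebesgue_space R n) :=
  oapp (fun b => ball b.1 b.2) set0 o.
have mB o : measurable (B o) by case: o => [b|]; [exact: lmeasurable_ball|exact: measurable0].
pose V N : set (lebesgue_space R n) := \bigcup_(m < N) B (c m).
have mV N : measurable (V N) by apply: bigcup_measurable => m _; exact: mB.
have ndV : {homo V : N M / (N <= M)%N >-> (N <= M)%O}.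
  move=> N M NM; apply/subsetPset => x [m /= mN Bx]; exists m => //=.
  exact: leq_trans NM.
have VE : \bigcup_N V N = \bigcup_m B (c m).
  apply/seteqP; split=> [x [N _ [m _ Bx]]|x [m _ Bx]]; first by exists m.
  by exists m.+1 => //; exists m => //=.
have VS N : lebesgue (V N) <= (6 ^+ n * S)%:E.
  have [t [ut ts tt tcov]] := vitali_finite (pmap c (iota 0 N)).
  have tP b : b \in t -> P b.
    move=> /ts; rewrite mem_pmap => /mapP[m _ /esym]; exact: cP.
  apply: (@le_trans _ _ (lebesgue (\big[setU/set0]_(b <- t) ball b.1 (3 * b.2)%R))).
    apply: le_outer_measure => x [m /= mN].
    case cm : (c m) => [b|//] bx.
    have [|b' b't b'x] := tcov b x _ bx.
      by rewrite mem_pmap -cm; apply/mapP; exists m => //; rewrite mem_iota.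
    by rewrite -bigcup_seq; exists b'.
  apply: (@le_trans _ _ (\sum_(b <- t) lebesgue (ball b.1 (3 * b.2)%R))).
    elim: (t) => [|b s ih]; first by rewrite !big_nil measure0.
    rewrite !big_cons; apply: (le_trans (outer_measureU2 _ _ _)).
    by rewrite leeD2l.
  apply: (@le_trans _ _ (\sum_(b <- t) (6 ^+ n * b.2 ^+ n)%:E)).
    rewrite big_seq [leRHS]big_seq; apply: lee_sum => b bt.
    have b0 : (0 <= b.2)%R by rewrite ltW//; exact/P0/tP.
    rewrite (le_trans (lebesgue_ball_le _ _)) ?mulr_ge0//.
    by rewrite -exprMn (_ : 2 * (3 * b.2) = 6 * b.2)%R; last ring.
  rewrite sumEFin lee_fin -mulr_sumr ler_wpM2l ?exprn_ge0//; exact: PS.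
have /cvg_lim limV := nondecreasing_cvg_mu (mu := @lebesgue R n) mV
  (bigcup_measurable (fun m _ => mV m)) ndV.
apply: (@le_trans _ _ (lebesgue (\bigcup_N V N))).
  apply: le_lebesgue_outer => x /EP[b Pb bx]; rewrite VE.
  by apply: cover_c; exists b.
rewrite -limV//; apply: lime_le; last by near=> N; exact: VS.
apply: ereal_nondecreasing_is_cvgn => N M NM.
exact/le_lebesgue_outer/subsetPset/ndV.
Unshelve. all: by end_near. Qed.

End vitali.

(** * Differentiation of integrals *)

Section differentiation.
Context {R : realType} {n : nat}.
Local Open Scope ereal_scope.
Implicit Types (x : 'rV[R]_n) (A : set 'rV[R]_n).

Notation mu := (@lebesgue R n).

Lemma ge0_le_lebesgue_integral (D : set 'rV[R]_n) (f g : 'rV[R]_n -> R) :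
  lmeasurable D -> lmeasurable_fun D f -> lmeasurable_fun D g ->
  (forall x, D x -> (0 <= f x)%R) -> (forall x, D x -> (f x <= g x)%R) ->
  \int[mu]_(x in D) (f x)%:E <= \int[mu]_(x in D) (g x)%:E.
Proof.
move=> mD mf mg f0 fg; apply: ge0_le_integral.
- exact: mD.
- by move=> x Dx; rewrite lee_fin; exact: f0.
- exact/measurable_EFinP.
- exact/measurable_EFinP.
- by move=> x Dx; rewrite lee_fin; exact: fg.
Qed.

Lemma ge0_lebesgue_integralD (D : set 'rV[R]_n) (f g : 'rV[R]_n -> R) :
  lmeasurable D -> lmeasurable_fun D f -> lmeasurable_fun D g ->
  (forall x, D x -> (0 <= f x)%R) -> (forall x, D x -> (0 <= g x)%R) ->
  \int[mu]_(x in D) (f x + g x)%:E =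
  \int[mu]_(x in D) (f x)%:E + \int[mu]_(x in D) (g x)%:E.
Proof.
move=> mD mf mg f0 g0; rewrite -ge0_integralD.
- by apply: eq_integral => x _; rewrite EFinD.
- exact: mD.
- by move=> x Dx; rewrite lee_fin; exact: f0.
- exact/measurable_EFinP.
- by move=> x Dx; rewrite lee_fin; exact: g0.
- exact/measurable_EFinP.
Qed.

Lemma ge0_lebesgue_integralZl (D : set 'rV[R]_n) (f : 'rV[R]_n -> R) (c : R) :
  lmeasurable D -> lmeasurable_fun D f -> (forall x, D x -> (0 <= f x)%R) -> (0 <= c)%R ->
  \int[mu]_(x in D) (c * f x)%:E = c%:E * \int[mu]_(x in D) (f x)%:E.
Proof.
move=> mD mf f0 c0; rewrite -ge0_integralZl_EFin.
- by apply: eq_integral => x _; rewrite EFinM.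
- exact: mD.
- by move=> x Dx; rewrite lee_fin; exact: f0.
- exact/measurable_EFinP.
- exact: c0.
Qed.

Lemma ge0_subset_lebesgue_integral (D E : set 'rV[R]_n) (f : 'rV[R]_n -> R) :
  lmeasurable D -> lmeasurable E -> lmeasurable_fun E f ->
  (forall x, E x -> (0 <= f x)%R) -> D `<=` E ->
  \int[mu]_(x in D) (f x)%:E <= \int[mu]_(x in E) (f x)%:E.
Proof.
move=> mD mE mf f0 DE; apply: ge0_subset_integral.
- exact: mD.
- exact: mE.
- exact/measurable_EFinP.
- by move=> x Dx; rewrite lee_fin; exact: f0.
- exact: DE.
Qed.

Lemma lebesgue_ball_lty x r : mu (ball x r) < +oo.
Proof.
have [r0|r0] := leP 0%R r.
  by rewrite (le_lt_trans (lebesgue_ball_le _ r0))// ltry.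
rewrite (_ : ball _ _ = set0) ?measure0 ?ltry//.
by rewrite -subset0 => y [+ _]; rewrite ltNge ltW.
Qed.

Lemma lebesgue_integral_cst (D : set 'rV[R]_n) (c : R) : lmeasurable D ->
  \int[mu]_(x in D) c%:E = c%:E * mu D.
Proof. by move=> mD; rewrite integral_cst. Qed.

Lemma lebesgue_outer_negligible A : lebesgue_outer A = 0 -> mu.-negligible A.
Proof.
move=> A0; exists A; split => //; apply: le_caratheodory_measurable => X /=.
rewrite [X in X + _](_ : _ = 0) ?add0e.
  by apply: le_lebesgue_outer; exact: subIsetl.
apply/eqP; rewrite eq_le lebesgue_outer_ge0 andbT -A0.
by apply: le_lebesgue_outer; exact: subIsetr.
Qed.

Lemma ae_notin_negligible (N : set 'rV[R]_n) (P : 'rV[R]_n -> Prop) :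
  mu.-negligible N -> (forall x, ~ P x -> N x) -> {ae mu, forall x, P x}.
Proof. by move=> N0 PN; exact: (negligibleS _ N0). Qed.

Lemma ae_imply (P Q : 'rV[R]_n -> Prop) : (forall x, P x -> Q x) ->
  {ae mu, forall x, P x} -> {ae mu, forall x, Q x}.
Proof.
move=> PQ [N [mN N0 PN]]; exists N; split => // x /= nQ.
by apply: PN => /= Px; exact/nQ/PQ.
Qed.

Lemma ge0_sum_integral_le (I : choiceType) (B : I -> set 'rV[R]_n) (t : seq I)
    (h : 'rV[R]_n -> R) (U : set 'rV[R]_n) :
  (forall b, lmeasurable (B b)) ->
  lmeasurable U -> lmeasurable_fun U h -> (forall x, (0 <= h x)%R) ->
  uniq t -> trivIset [set` t] B -> (forall b, b \in t -> B b `<=` U) ->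
  \sum_(b <- t) \int[mu]_(y in B b) (h y)%:E <= \int[mu]_(y in U) (h y)%:E.
Proof.
move=> mB mU mh h0 ut tt tU.
have sub : \big[setU/set0]_(b <- t) (B b : set (lebesgue_space R n)) `<=` U.
  by rewrite -bigcup_seq => x [b bt]; exact: tU.
have mtB : lmeasurable (\big[setU/set0]_(b <- t) B b).
  by apply: bigsetU_measurable => b _; exact: mB.
have mEh : measurable_fun (U : set (lebesgue_space R n)) (EFin \o h).
  exact/measurable_EFinP.
rewrite -(ge0_integral_bigsetU mu (F := B) (f := fun y => (h y)%:E))//.
- apply: ge0_subset_integral => // x _; by rewrite lee_fin.
- exact: measurable_funS mEh.
- by move=> x _; rewrite lee_fin.
Qed.

(** Differentiation of h dx at the points of A, where h vanishes: an open set
    that approximates A has small h dx-measure, so by Vitali's lemma the points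
    where h has large averages at arbitrarily small scales form a null set. *)
Lemma ae_vanishing_average (h : 'rV[R]_n -> R) A :
  lmeasurable A -> lmeasurable_fun setT h -> (forall x, (0 <= h x)%R) ->
  (forall r, \int[mu]_(y in ball (0%R : 'rV[R]_n) r) (h y)%:E < +oo) ->
  (forall x, A x -> h x = 0%R) ->
  {ae mu, forall x, A x -> forall e : R, (0 < e)%R -> exists2 d : R, (0 < d)%R &
    forall r : R, (0 < r < d)%R ->
      \int[mu]_(y in ball x r) (h y)%:E <= (e * r ^+ n)%:E}.
Proof.
move=> mA mh h0 hoo hA.
have mEh (D : set (lebesgue_space R n)) : measurable_fun D (EFin \o h).
  by apply/measurable_EFinP; exact: measurable_funS mh.
pose bad k N := [set x : 'rV[R]_n | [/\ A x, ball (0%R : 'rV[R]_n) N%:R x &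
  forall d, (0 < d)%R -> exists2 r, (0 < r < d)%R &
    ((k.+1%:R^-1 * r ^+ n)%:E < \int[mu]_(y in ball x r) (h y)%:E)]].
suff bad0 k N : lebesgue_outer (bad k N) = 0.
  apply: (@ae_notin_negligible (\bigcup_k \bigcup_N bad k N)).
    apply: negligible_bigcup => k; apply: negligible_bigcup => N.
    exact: lebesgue_outer_negligible.
  move=> x /= /not_implyP[Ax] /existsNP[e] /not_implyP[e0 xe].
  have [k ke] : exists k, (k.+1%:R^-1 < e)%R.
    by have := ltr_add_invr e0 => -[k]; rewrite add0r; exists k.
  exists k => //; exists (Num.bound `|x|) => //; split => //.
    by rewrite -ball_normE/= sub0r normrN archi_boundP.
  move=> d d0; apply: contrapT => nr; apply: xe; exists d => // r rd.
  rewrite leNgt; apply/negP => er; apply: nr; exists r => //.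
  apply: le_lt_trans er; rewrite lee_fin ler_wpM2r ?exprn_ge0 ?ltW//.
  by case/andP: rd.
apply/eqP; rewrite eq_le lebesgue_outer_ge0 andbT.
apply/lee_addgt0Pr => e e0; rewrite add0e.
pose ball0 : set (lebesgue_space R n) := ball (0%R : 'rV[R]_n) N%:R.
have mball0 : measurable ball0 by exact: lmeasurable_ball.
have ih : mu.-integrable setT (EFin \o (h \_ ball0)).
  have ih0 : mu.-integrable ball0 (EFin \o h).
    apply/integrableP; split; first exact: mEh.
    apply: le_lt_trans (hoo N%:R); rewrite le_eqVlt; apply/orP; left; apply/eqP.
    by apply: eq_integral => y _; rewrite /= ger0_norm.
  have := iffLR (integrable_mkcond _ mball0) ih0.
  by rewrite restrict_EFin.
(* vitali_outer loses the factor 6^n, and the averages exceed 1 / (k + 1) *)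
pose eta : R := (e / (6 ^+ n * k.+1%:R))%R.
have eta0 : (0 < eta)%R by rewrite divr_gt0// mulr_gt0// exprn_gt0.
have [d [d0 hd]] := integral_normr_continuous ih eta0.
pose A' := A `&` ball0.
have mA' : lmeasurable A' by exact: measurableI.
have A'oo : lebesgue_outer A' < +oo.
  apply: (@le_lt_trans _ _ (mu ball0)); first by apply: le_lebesgue_outer; exact: subIsetr.
  by rewrite (le_lt_trans (lebesgue_ball_le _ _))// ltry.
have [U0 [oU0 AU0 U0A]] := lebesgue_outer_regular (e := d / 2) ltac:(lra) A'oo.
pose U := U0 `&` ball0.
have oU : open U by apply: openI => //; exact: ball_open.
have mU : lmeasurable U by exact: open_lmeasurable.
have A'U : A' `<=` U by move=> x A'x; split; [exact: AU0|exact: A'x.2].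
have muUA : mu (U `\` A') < d%:E.
  have A'fin : mu A' \is a fin_num.
    by rewrite ge0_fin_numE//; exact: lebesgue_outer_ge0.
  have : mu U = mu A' + mu (U `\` A').
    rewrite -[X in mu X = _](setUIDK U A') measureU//; first by rewrite (setIidr A'U).
    - exact: measurableI.
    - exact: measurableD.
    - by rewrite setDE setIACA setICr setI0.
  have : mu U <= mu A' + (d / 2)%:E.
    by apply: le_trans U0A; by apply: le_lebesgue_outer; exact: subIsetl.
  move=> + UE; rewrite UE leeD2lE// => /le_lt_trans; apply.
  by rewrite lte_fin; lra.
have intU : \int[mu]_(y in U) (h y)%:E < eta%:E.
  have -> : \int[mu]_(y in U) (h y)%:E = \int[mu]_(y in U `\` A') (h y)%:E.
    have UE : U = A' `|` (U `\` A').
      apply/seteqP; split=> [y Uy|y [/A'U//|[]//]].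
      by have [?|?] := pselect (A' y); [left|right].
    rewrite {1}UE ge0_integral_setU//.
    - rewrite [X in X + _](_ : _ = 0) ?add0e//.
      apply: integral0_eq => y [Ay _]; by rewrite hA.
    - exact: measurableD.
    - by move=> y _; rewrite lee_fin.
    - by apply/disj_set2P; rewrite -subset0 => y [A'y [_]]; exact.
  have := hd _ (measurableD mU mA') muUA.
  rewrite /Rintegral -lte_fin fineK.
    apply: le_lt_trans; rewrite le_eqVlt; apply/orP; left; apply/eqP.
    apply: eq_integral => y; rewrite inE => -[[_ by0] _].
    by rewrite /patch mem_set//= ger0_norm.
  apply: integrable_fin_num; first exact: measurableD.
  exact: (integrableS measurableT (measurableD mU mA') (@subsetT _ _)
    (integrable_abse ih)).
pose P := [set b : 'rV[R]_n * R | [/\ (0 < b.2)%R, ball b.1 b.2 `<=` U &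
   (k.+1%:R^-1 * b.2 ^+ n)%:E < \int[mu]_(y in ball b.1 b.2) (h y)%:E]].
apply: (@le_trans _ _ (6 ^+ n * (k.+1%:R * eta))%:E); last first.
  by rewrite lee_fin mulrA /eta mulrC divfK// gt_eqF// mulr_gt0// exprn_gt0.
apply: (@vitali_outer R n P) => [b []//|x [Ax xN xbad]|t ut tP tt].
  have /nbhs_ballP[d' /= d'0 xd'U] : nbhs x U.
    by apply: open_nbhs_nbhs; split => //; apply: A'U.
  have [r /andP[r0 rd'] rbad] := xbad _ d'0.
  exists (x, r); last exact: ballxx.
  split => //; apply: subset_trans xd'U; exact/le_ball/ltW.
have : \sum_(b <- t) (k.+1%:R^-1 * b.2 ^+ n)%:E <= eta%:E.
  apply: le_trans (ltW intU).
  apply: le_trans (ge0_sum_integral_le _ mU _ h0 ut tt _); last 3 first.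
  - by move=> b; exact: lmeasurable_ball.
  - exact: measurable_funS mh.
  - by move=> b /tP[].
  by rewrite big_seq [leRHS]big_seq; apply: lee_sum => b /tP[_ _ /ltW].
by rewrite sumEFin lee_fin -mulr_sumr mulrC ler_pdivrMr// mulrC.
Qed.

(** Vanishing averages suffice: for q rational and k a number, |g - q| is set to
    0 on the set A where it is smaller than 1 / (k + 1), and the averages of the
    function so obtained vanish almost everywhere on A. Almost every x can use
    all these countably many facts, with q close to g x. *)
Lemma ae_lebesgue_point (g : 'rV[R]_n -> R) : lmeasurable_fun setT g ->
  (forall r, \int[mu]_(y in ball (0%R : 'rV[R]_n) r) `|g y|%:E < +oo) ->
  {ae mu, forall x, forall e : R, (0 < e)%R -> exists2 d : R, (0 < d)%R &
    forall r : R, (0 < r < d)%R ->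
      \int[mu]_(y in ball x r) (`|g y - g x|)%:E <= (e * r ^+ n)%:E}.
Proof.
move=> mg goo.
pose A (qk : rat * nat) := [set y : 'rV[R]_n | (`|g y - ratr qk.1| < qk.2.+1%:R^-1)%R].
pose h (qk : rat * nat) (y : 'rV[R]_n) : R := (`|g y - ratr qk.1| * \1_(~` A qk) y)%R.
have mgq (q : R) : lmeasurable_fun setT (fun y : 'rV[R]_n => `|g y - q|%R).
  by apply: measurableT_comp => //; apply: measurable_funB.
have mA qk : lmeasurable (A qk).
  rewrite [X in measurable X](_ : _ = setT `&` (fun y => `|g y - ratr qk.1|%R) @^-1` `]-oo, (qk.2.+1%:R^-1)%R[%classic).
    by apply: mgq => //; exact: measurable_itv.
  by rewrite setTI; apply/seteqP; split=> y; rewrite /A /= in_itv.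
have mh qk : lmeasurable_fun setT (h qk).
  apply: measurable_funM; first exact: mgq.
  by apply: measurable_indic; exact: measurableC.
have h0 qk x : (0 <= h qk x)%R by rewrite mulr_ge0.
have hoo qk r : \int[mu]_(y in ball (0%R : 'rV[R]_n) r) (h qk y)%:E < +oo.
  have mB : lmeasurable (ball (0%R : 'rV[R]_n) r) by exact: lmeasurable_ball.
  have mgB : lmeasurable_fun (ball (0%R : 'rV[R]_n) r) (fun y => `|g y|%R).
    by apply: measurableT_comp => //; exact: measurable_funS mg.
  apply: (@le_lt_trans _ _ (\int[mu]_(y in ball (0%R : 'rV[R]_n) r)
      (`|g y| + `|ratr qk.1|)%:E)).
    apply: ge0_le_lebesgue_integral.
    - exact: mB.
    - exact: measurable_funS (mh qk).
    - exact: measurable_funD.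
    - by move=> y _; exact: h0.
    - move=> y _; rewrite /h indicE.
      apply: (@le_trans _ _ (`|g y - ratr qk.1|)%R); last exact: ler_normB.
      by case: (_ \in _); rewrite ?mulr1// mulr0.
  rewrite (ge0_lebesgue_integralD (f := fun y => `|g y|%R) (g := fun=> `|ratr qk.1|%R))//;
    last exact: measurable_cst.
  rewrite (lebesgue_integral_cst _ mB) lte_add_pinfty//.
  by rewrite lte_mul_pinfty//; exact: lebesgue_ball_lty.
have hA qk x : A qk x -> h qk x = 0%R.
  by move=> Ax; rewrite /h indicE memNset ?mulr0//; exact.
have := fun m => ae_vanishing_average (mA (odflt (0%R, 0%N) (unpickle m)))
  (mh (odflt (0%R, 0%N) (unpickle m))) (h0 (odflt (0%R, 0%N) (unpickle m)))
  (hoo (odflt (0%R, 0%N) (unpickle m))) (@hA (odflt (0%R, 0%N) (unpickle m))).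
move=> /ae_foralln; apply: filterS => x xP e e0.
have [k ke] : exists k, (k.+1%:R^-1 < e / (4 * 2 ^+ n) :> R)%R.
  have e'0 : (0 < e / (4 * 2 ^+ n))%R by rewrite divr_gt0// mulr_gt0// exprn_gt0.
  by have := ltr_add_invr e'0 => -[k]; rewrite add0r; exists k.
have [q qx] : exists q : rat, A (q, k) x.
  have gk : (g x - k.+1%:R^-1 < g x :> R)%R by rewrite ltrBlDr ltrDl invr_gt0.
  have [q] := rat_in_itvoo gk; rewrite in_itv/= => /andP[q1 q2]; exists q.
  have k0 : (0 < k.+1%:R^-1 :> R)%R by rewrite invr_gt0.
  by rewrite /A/= ltr_norml; move: k0 q1 q2; set c := _^-1%R => *; apply/andP; split; lra.
have := xP (pickle (q, k)); rewrite pickleK/= => /(_ qx (e / 2)%R).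
move=> /(_ _)[|d d0 dP]; first lra.
exists d => // r rd; have /andP[r0 _] := rd.
have mB : lmeasurable (ball x r) by exact: lmeasurable_ball.
apply: (@le_trans _ _ (\int[mu]_(y in ball x r) (h (q, k) y + 2 * k.+1%:R^-1)%:E)).
  apply: ge0_le_lebesgue_integral.
  - exact: mB.
  - exact: measurable_funS (mgq (g x)).
  - by apply: measurable_funD => //; exact: measurable_funS (mh _).
  - by move=> y _.
  - move=> y _; rewrite /h indicE/=.
    have := ler_distD (ratr q) (g y) (g x).
    have k0 : (0 < k.+1%:R^-1 :> R)%R by rewrite invr_gt0.
    rewrite (distrC (ratr q)); move: qx k0; rewrite /A/=; set c := (k.+1%:R^-1)%R => qx k0.
    case: (boolP (_ \in _)) => [_|]; first by rewrite mulr1; lra.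
    rewrite notin_setE /= => /contrapT; rewrite mulr0; lra.
rewrite (ge0_lebesgue_integralD (f := h (q, k)) (g := fun=> 2 * k.+1%:R^-1)%R)//; last 2 first.
- exact: measurable_funS (mh _).
- exact: measurable_cst.
rewrite (lebesgue_integral_cst _ mB); apply: (le_trans (leeD (dP r rd) _)).
  apply: lee_wpmul2l; first by rewrite lee_fin mulr_ge0.
  exact: (lebesgue_ball_le _ (ltW r0)).
rewrite -EFinM -EFinD lee_fin exprMn.
have r'0 : (0 < r ^+ n)%R by rewrite exprn_gt0.
move: ke; rewrite ltr_pdivlMr ?mulr_gt0 ?exprn_gt0//.
set c := (k.+1%:R^-1)%R; set a := (2 ^+ n)%R; set b := (r ^+ n)%R => ke.
have : (c * (4 * a) * b <= e * b)%R by rewrite ler_pM2r ?ltW.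
by lra.
Qed.

End differentiation.

(** * The dual weight *)

Section weights.
Context {R : realType} {n : nat}.
Local Open Scope ereal_scope.
Implicit Types (w : 'rV[R]_n -> R) (x : 'rV[R]_n).

Notation mu := (@lebesgue R n).

Definition dual_weight w x : R := w x `^ (1 - n%:R)^-1.

(** Either d |a|^(n-1) w >= 1 and the first term dominates, or |a| is at most
    (d w)^(1/(1-n)), which is the second one. This form of Young's inequality
    takes the place of Hoelder's: where the integral of |a|^n w is bounded, a
    small d makes the first term small, and the second one is integrable. *)
Lemma young_dual_weight w x (a d : R) : (2 <= n)%N -> (0 < w x)%R -> (0 < d)%R ->
  (`|a| <= d * (`|a| ^+ n * w x) + d `^ (1 - n%:R)^-1 * dual_weight w x)%R.
Proof.
move=> n2 w0 d0; have a0 := normr_ge0 a.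
have n1 : (0 < n.-1)%N by case: n n2 => [|[]].
have nE : (n%:R - 1 = n.-1%:R :> R)%R by rewrite -subn1 natrB// ltnW.
have n1R : (0 < n%:R - 1 :> R)%R by rewrite nE ltr0n.
have p0 : (0 <= d `^ (1 - n%:R)^-1 * dual_weight w x)%R.
  by rewrite mulr_ge0 ?powR_ge0.
have q0 : (0 <= d * (`|a| ^+ n * w x))%R.
  by rewrite !mulr_ge0 ?exprn_ge0// ltW.
have [big|small] := leP 1%R (d * (`|a| ^+ n.-1 * w x))%R.
  rewrite -[leLHS]addr0 lerD//.
  have -> : (d * (`|a| ^+ n * w x) = `|a| * (d * (`|a| ^+ n.-1 * w x)))%R.
    by rewrite -{1}(prednK (ltnW n2)) exprS; ring.
  by rewrite ler_peMr.
rewrite -[leLHS]add0r lerD//.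
have -> : ((1 - n%:R)^-1 = - (n%:R - 1)^-1 :> R)%R by rewrite -invrN opprB.
rewrite /dual_weight.
have -> : ((1 - n%:R)^-1 = - (n%:R - 1)^-1 :> R)%R by rewrite -invrN opprB.
have [d0' w0'] := (ltW d0, ltW w0).
rewrite -powRM// powRN.
have dw0 : (0 < d * w x)%R by rewrite mulr_gt0.
have -> : (`|a| = (`|a| `^ (n%:R - 1)) `^ (n%:R - 1)^-1)%R.
  by rewrite -powRrM divff ?powRr1// gt_eqF.
rewrite -[leRHS]mul1r ler_pdivlMr ?powR_gt0// -powRM ?powR_ge0//; last exact: ltW.
have one : (1 `^ (n%:R - 1)^-1 = 1 :> R)%R by rewrite powR1.
rewrite -[leRHS]one ge0_ler_powR ?invr_ge0 ?nnegrE ?ler01//.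
- exact: ltW.
- by rewrite mulr_ge0 ?powR_ge0//; exact: ltW.
- by rewrite nE powR_mulrn// mulrCA ltW.
Qed.

Lemma lmeasurable_powR (f : 'rV[R]_n -> R) (r : R) (D : set 'rV[R]_n) :
  lmeasurable_fun D f -> lmeasurable_fun D (fun x => f x `^ r)%R.
Proof.
move=> mf; apply: (@measurableT_comp _ _ _ _ _ _ (fun t : R => t `^ r)%R) => //.
Qed.

Lemma lmeasurable_dual_weight w : lmeasurable_fun setT w ->
  lmeasurable_fun setT (dual_weight w).
Proof. exact: lmeasurable_powR. Qed.

Let cubeN (N : nat) : set 'rV[R]_n := cube (const_mx (- N.+1%:R)%R) (2 * N.+1%:R)%R.

Let ball_cube (r : R) N : (r <= N.+1%:R)%R -> ball (0%R : 'rV[R]_n) r `<=` cubeN N.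
Proof.
move=> rN x [_ xr] i; have := xr 0%R i; rewrite !mxE /ball/= sub0r normrN ltr_norml; lra.
Qed.

Let closed_cube N : closed (cubeN N).
Proof.
rewrite [X in closed X](_ : _ = \bigcap_(i in [set: 'I_n]) ((fun x : 'rV[R]_n => x 0%R i) @^-1`
    `[(- N.+1%:R)%R, (- N.+1%:R + 2 * N.+1%:R)%R]%classic)); last first.
  apply/seteqP; split=> x xN i; first by move=> _ /=; rewrite in_itv/=; have := xN i; rewrite mxE.
  by have := xN i Logic.I; rewrite /= in_itv/= mxE.
apply: closed_bigI => i _; apply: closed_comp => [x _|]; first exact: coord_continuous.
exact: interval_closed.
Qed.

Let measurable_cube N : lmeasurable (cubeN N).
Proof. by apply: closed_lmeasurable; exact: closed_cube. Qed.

Let cube_ball N : cubeN N `<=` ball (0%R : 'rV[R]_n) N.+2%:R.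
Proof.
move=> x xN; split; first by rewrite ltr0n.
move=> j i; rewrite (ord1 j) /ball/= mxE sub0r normrN ltr_norml.
have := xN i; rewrite mxE -(natr1 N.+1); lra.
Qed.

Let lebesgue_cube N : 0 < mu (cubeN N) < +oo.
Proof.
apply/andP; split.
  apply: (@lt_le_trans _ _ (mu (ball (0%R : 'rV[R]_n) N.+1%:R))).
    by rewrite (lt_le_trans _ (lebesgue_ball_ge _ _))// lte_fin exprn_gt0.
  by apply: le_lebesgue_outer; exact: ball_cube.
by apply: le_lt_trans (lebesgue_ball_lty _ _); apply: le_lebesgue_outer; exact: cube_ball.
Qed.

Let cubeU : \bigcup_N cubeN N = setT.
Proof.
apply/seteqP; split=> // x _; exists (Num.bound `|x|) => //.
apply: (@ball_cube (Num.bound `|x|).+1%:R) => //.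
rewrite -ball_normE/= sub0r normrN (lt_trans (archi_boundP (normr_ge0 x)))//.
by rewrite ltr_nat.
Qed.

Let cube_subset (N M : nat) : (N <= M)%N -> cubeN N `<=` cubeN M.
Proof.
move=> NM x xN i; have := xN i; rewrite !mxE.
have : (N.+1%:R <= M.+1%:R :> R)%R by rewrite ler_nat.
lra.
Qed.

(** The only two consequences of the A_n condition on which the proof rests.
    They come from the large cubes centred at 0: w has a positive integral over
    them, so the mean of the dual weight is finite, whereas this mean would be
    infinite if w vanished on a set of positive measure. *)
Lemma Ap_dual_weight w : (2 <= n)%N -> Ap n%:R w ->
  {ae mu, forall x, (0 < w x)%R} /\
  forall r, \int[mu]_(x in ball (0%R : 'rV[R]_n) r) (dual_weight w x)%:E < +oo.
Proof.
move=> n2 [[w0 [mw _]] wN0 Aoo].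
have n1 : (0 < n%:R - 1 :> R)%R by rewrite subr_gt0 ltr1n.
pose s x : \bar R := powRy (w x) (1 - n%:R)^-1.
have s0 x : 0 <= s x by rewrite /s /powRy; case: ifPn => // _; rewrite lee_fin powR_ge0.
have ms : measurable_fun (setT : set (lebesgue_space R n)) s.
  apply: measurable_fun_ifT.
  - apply: measurable_and => //; exact: measurable_fun_eqr.
  - exact: measurable_cst.
  - by apply/measurable_EFinP; exact: lmeasurable_powR.
have [N0 wN0'] : exists N0, 0 < \int[mu]_(x in cubeN N0) (w x)%:E.
  apply: contrapT => /forallNP h; apply: wN0.
  have : forall N, {ae mu, forall x, cubeN N x -> (w x)%:E = 0}.
    move=> N; apply/(ae_eq_integral_abs mu (measurable_cube N)).
      by apply/measurable_EFinP; exact: measurable_funS mw.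
    apply/eqP; rewrite eq_le; apply/andP; split; last first.
      by apply: integral_ge0 => x _; exact: abse_ge0.
    move: (h N) => /negP; rewrite -leNgt; apply: le_trans.
    rewrite le_eqVlt; apply/orP; left; apply/eqP; apply: eq_integral => x _.
    by rewrite gee0_abs// lee_fin.
  move=> /ae_foralln; apply: filterS => x xP.
  have : (\bigcup_N cubeN N) x by rewrite cubeU.
  by move=> [N _ xN]; have [] := xP N xN.
have soo N : (N0 <= N)%N -> \int[mu]_(x in cubeN N) s x < +oo.
  move=> N0N; have /andP[m0 moo] := lebesgue_cube N.
  have mfin : mu (cubeN N) \is a fin_num by rewrite ge0_fin_numE// ltW.
  have c0 : (0 < (fine (mu (cubeN N)))^-1)%R.
    by rewrite invr_gt0 fine_gt0// m0.
  rewrite ltNge leye_eq; apply/negP => /eqP intoo.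
  suff : Ap_constant n%:R w = +oo by move=> h; rewrite h in Aoo.
  apply/eqP; rewrite -leye_eq; apply: ereal_sup_ge.
  exists (average (cubeN N) (fun x => (w x)%:E) *
       poweR (average (cubeN N) s) (n%:R - 1)).
    exists (const_mx (- N.+1%:R)%R) => //; exists (2 * N.+1%:R)%R => //=.
  have -> : average (cubeN N) s = +oo by rewrite /average intoo gt0_muley.
  rewrite poweRyr ?gt_eqF// gt0_muley// /average mule_gt0// (lt_le_trans wN0')//.
  apply: ge0_subset_lebesgue_integral => //; last exact: cube_subset.
  exact: measurable_funS mw.
split.
  have : forall N, {ae mu, forall x, cubeN (N0 + N) x -> s x \is a fin_num}.
    move=> N; apply: (integrable_ae (measurable_cube _)).
    apply/integrableP; split; first exact: measurable_funS ms.
    apply: le_lt_trans (soo _ (leq_addr N N0)).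
    rewrite le_eqVlt; apply/orP; left; apply/eqP; apply: eq_integral => x _.
    by rewrite gee0_abs.
  move=> /ae_foralln; apply: filterS => x xP.
  have : (\bigcup_N cubeN N) x by rewrite cubeU.
  move=> [N _ xN]; have := xP N (cube_subset (leq_addl _ _) xN).
  move=> sx; rewrite lt0r w0 andbT; apply/eqP => wx; move: sx.
  by rewrite /s /powRy wx eqxx/= invr_lt0 subr_lt0 ltr1n n2.
move=> r; pose N := maxn N0 (Num.bound `|r|).
have rN : (r <= N.+1%:R)%R.
  rewrite ltW// (le_lt_trans (ler_norm r))// (lt_le_trans (archi_boundP (normr_ge0 r)))//.
  by rewrite ler_nat leqW// leq_maxr.
apply: le_lt_trans (soo N (leq_maxl _ _)).
apply: (@le_trans _ _ (\int[mu]_(x in cubeN N) (dual_weight w x)%:E)).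
  apply: ge0_subset_lebesgue_integral => //.
  - exact: lmeasurable_ball.
  - exact: measurable_funS (lmeasurable_dual_weight mw).
  - by move=> x _; exact: powR_ge0.
  - exact: ball_cube.
apply: ge0_le_integral.
- exact: measurable_cube.
- by move=> x _; rewrite lee_fin powR_ge0.
- by apply/measurable_EFinP; exact: measurable_funS (lmeasurable_dual_weight mw).
- exact: measurable_funS ms.
- move=> x _; rewrite /s /powRy; case: ifP => // _; exact: leey.
Qed.

End weights.

(** * Euclidean balls and cubes *)

Section euclidean_balls.
Context {R : realType} {n : nat}.
Implicit Types (x y c : 'rV[R]_n) (r : R).

Lemma ltr_norm_rV x r : 0 < r -> (`|x| < r) = [forall i, `|x 0 i| < r].
Proof.
move=> r0; apply/idP/forallP => [|xr].
  have -> : (`|x| < r) = (`|0 - x| < r) by rewrite sub0r normrN.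
  move=> x_r; have : ball (0 : 'rV[R]_n) r x by rewrite -ball_normE.
  by move=> [_ xr] i; have := xr 0 i; rewrite /ball/= mxE sub0r normrN.
have : ball (0 : 'rV[R]_n) r x.
  by split=> // i j; rewrite (ord1 i) /ball/= mxE sub0r normrN.
by rewrite -ball_normE/= sub0r normrN.
Qed.

Lemma ler_coord_norm x i : `|x 0 i| <= `|x|.
Proof.
apply/ler_addgt0Pr => e e0.
have x0 : 0 < `|x| + e by rewrite ltr_wpDl.
have : `|x| < `|x| + e by rewrite ltrDl.
by rewrite ltr_norm_rV// => /forallP/(_ i)/ltW.
Qed.

Lemma ler_enorm_norm x : `|x| <= enorm x.
Proof.
apply/ler_addgt0Pr => e e0; apply/ltW.
have x0 : 0 < enorm x + e by rewrite ltr_wpDl// sqrtr_ge0.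
rewrite ltr_norm_rV//; apply/forallP => i.
rewrite (@le_lt_trans _ _ (enorm x)) ?ltrDl//.
rewrite -sqrtr_sqr ler_sqrt ?sumr_ge0// => [|j _]; last exact: sqr_ge0.
by rewrite (bigD1 i)//= lerDl sumr_ge0// => j _; exact: sqr_ge0.
Qed.

Lemma ler_norm_enorm x : enorm x <= n%:R * `|x|.
Proof.
rewrite /enorm -[leRHS]ger0_norm ?mulr_ge0// -sqrtr_sqr ler_sqrt ?sqr_ge0//.
apply: (@le_trans _ _ (\sum_(i < n) `|x| ^+ 2)).
  by apply: ler_sum => i _; rewrite -real_normK ?num_real// lerXn2r ?nnegrE// ler_coord_norm.
rewrite sumr_const card_ord -[leLHS]mulr_natl exprMn ler_wpM2r ?sqr_ge0//.
by rewrite -natrX ler_nat; case: n => // m; rewrite leq_pmulr.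
Qed.

Lemma eball_center c r : 0 < r -> eball c r c.
Proof.
move=> r0; rewrite /eball/= subrr (le_lt_trans (ler_norm_enorm _))//.
by rewrite normr0 mulr0.
Qed.

Lemma eball_sub_ball c r : eball c r `<=` ball c r.
Proof.
by move=> y; rewrite /eball -ball_normE/= distrC; apply: le_lt_trans; exact: ler_enorm_norm.
Qed.

Lemma ball_sub_eball c r s : n%:R * s <= r -> (0 < n)%N -> ball c s `<=` eball c r.
Proof.
move=> sr n0 y; rewrite -ball_normE/= => ys; rewrite /eball/=.
apply: le_lt_trans (ler_norm_enorm _) _; apply: lt_le_trans sr.
by rewrite ltr_pM2l ?ltr0n// distrC.
Qed.

Lemma enorm_continuous : continuous (@enorm R n).
Proof.
move=> x; apply: (@continuous_comp _ _ _
  (fun x : 'rV[R]_n => \sum_(i < n) x 0 i ^+ 2) (@Num.sqrt R)); last exact: sqrt_continuous.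
have FF : Filter (nbhs x) by exact: nbhs_filter.
apply: cvg_big => [y|i _]; first exact: add_continuous.
by rewrite expr2; under eq_fun do rewrite expr2; apply: cvgM; exact: coord_continuous.
Qed.

Lemma eball_open c r : open (eball c r).
Proof.
rewrite (_ : eball c r = (fun x => enorm (x - c)) @^-1` `]-oo, r[%classic); last first.
  by apply/seteqP; split=> x; rewrite /eball/= in_itv.
apply: open_comp => [x _|]; last exact: interval_open.
apply: (@continuous_comp _ _ _ (fun x : 'rV[R]_n => x - c)); last exact: enorm_continuous.
exact: (@continuousB _ _ _ id (cst c) x (fun A HA => HA) (@cst_continuous _ _ c x)).
Qed.

Lemma lmeasurable_eball c r : lmeasurable (eball c r).
Proof. by apply: open_lmeasurable; exact: eball_open. Qed.

End euclidean_balls.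

Lemma expeyy {R : realType} (m : nat) : (0 < m)%N -> ((+oo : \bar R) ^+ m = +oo)%E.
Proof. by case: m => // m _; elim: m => // m ih; rewrite expeS ih mulyy. Qed.

Section integral_cover.
Context {R : realType} {n : nat}.
Local Open Scope ereal_scope.

Lemma lmeasurable_norm (D : set 'rV[R]_n) (f : 'rV[R]_n -> R) :
  lmeasurable_fun D f -> lmeasurable_fun D (fun x => `|f x|%R).
Proof.
move=> mf; apply: (@measurableT_comp _ _ _ _ _ _ (fun t : R => `|t|%R)) => //.
Qed.

Lemma lmeasurable_normX (D : set 'rV[R]_n) (f : 'rV[R]_n -> R) k :
  lmeasurable_fun D f -> lmeasurable_fun D (fun x => `|f x| ^+ k)%R.
Proof. by move=> mf; apply: measurable_funX; exact: lmeasurable_norm. Qed.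

Notation mu := (@lebesgue R n).

Lemma ge0_integral_cover_le (I : countType) (M : set I) (G : I -> set 'rV[R]_n)
    (K : set 'rV[R]_n) (F : 'rV[R]_n -> R) (a : I -> \bar R) :
  lmeasurable K -> lmeasurable_fun K F -> (forall x, K x -> (0 <= F x)%R) ->
  (forall i, lmeasurable (G i)) -> K `<=` \bigcup_(i in M) G i ->
  (forall i, M i -> \int[mu]_(x in K `&` G i) (F x)%:E <= a i) ->
  \int[mu]_(x in K) (F x)%:E <= \esum_(i in M) a i.
Proof.
move=> mK mF F0 mG KG Fa.
have a0 i : M i -> 0 <= a i.
  move=> Mi; apply: le_trans (Fa i Mi); apply: integral_ge0 => x [Kx _].
  by rewrite lee_fin F0.
pose H k : set (lebesgue_space R n) :=
  if @pickle_inv I k is Some i then if i \in M then K `&` G i else set0 else set0.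
have mH k : measurable (H k).
  rewrite /H; case: (@pickle_inv I _) => [i|]; last exact: measurable0.
  by case: ifPn => _; [exact: measurableI|exact: measurable0].
have KH : K = \bigcup_k H k.
  apply/seteqP; split=> [x Kx|x [k _]].
    have [i Mi Gx] := KG x Kx; exists (pickle i) => //.
    by rewrite /H pickleK_inv mem_set.
  by rewrite /H; case: (@pickle_inv I _) => // i; case: ifP => // _ [].
have HK k : H k `<=` K by rewrite KH; exact: bigcup_sup.
have mDU k : measurable (seqDU H k).
  apply: measurableD; first exact: mH.
  by apply: bigsetU_measurable => j _; exact: mH.
pose b k := if @pickle_inv I k is Some i then if i \in M then a i else 0 else 0.
have b0 k : 0 <= b k.
  rewrite /b; case: (@pickle_inv I _) => // i; case: ifPn => //; rewrite inE; exact: a0.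
apply: (@le_trans _ _ (\sum_(k <oo) b k)).
  rewrite {1}KH seqDU_bigcup_eq ge0_integral_bigcup//.
  - apply: lee_nneseries => k _.
      by move=> _; apply: integral_ge0 => x Hx; rewrite lee_fin; exact/F0/(HK k)/(@subset_seqDU _ H k).
    apply: (@le_trans _ _ (\int[mu]_(x in H k) (F x)%:E)).
      apply: ge0_subset_lebesgue_integral.
      + exact: mDU.
      + exact: mH.
      + exact: measurable_funS mF.
      + by move=> x /HK; exact: F0.
      + exact: subset_seqDU.
    rewrite /H /b; case: (@pickle_inv I _) => [i|]; last by rewrite integral_set0.
    case: ifPn; last by rewrite integral_set0.
    by rewrite inE => Mi; exact: Fa.
  - by rewrite -seqDU_bigcup_eq -KH; exact/measurable_EFinP.
  - by move=> x; rewrite -seqDU_bigcup_eq -KH => Kx; rewrite lee_fin F0.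
rewrite nneseries_esumT//.
have -> : \esum_(i in M) a i = \esum_(i in M) b (pickle i).
  by apply: eq_esum => i Mi; rewrite /b pickleK_inv mem_set.
rewrite -(@reindex_esum _ _ _ M (pickle @` M) pickle b); last first.
  split=> [i Mi|i j _ _ /(pcan_inj (@pickleK I))//|_ [i Mi <-]]; last by exists i.
  by exists i.
rewrite [leRHS]esum_mkcond; apply: le_esum => k _.
case: ifPn => // /negP kM; rewrite /b; case E : (@pickle_inv I k) => [i|//].
case: ifPn => // /set_mem Mi; exfalso; apply: kM; apply/mem_set; exists i => //.
by have := @pickle_invK I k; rewrite E.
Qed.

End integral_cover.

(** * Families of balls and the Riesz variation *)

Section variation.
Context {R : realType} {n : nat}.
Local Open Scope ereal_scope.
Variables (Omega : set 'rV[R]_n) (w f : 'rV[R]_n -> R) (v : R).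
Hypothesis n2 : (2 <= n)%N.
Hypothesis w0 : forall x, (0 <= w x)%R.
Hypothesis mw : lmeasurable_fun setT w.
Hypothesis wpos : {ae @lebesgue R n, forall x, (0 < w x)%R}.
Hypothesis fv : riesz_variation Omega w f <= v%:E.
Notation mu := (@lebesgue R n).

Lemma wmeasure_ge0 E : 0 <= wmeasure w E.
Proof. by apply: integral_ge0 => x _; rewrite lee_fin. Qed.

Lemma wmeasure_eball_gt0 c r : (0 < r)%R -> 0 < wmeasure w (eball c r).
Proof.
move=> r0; rewrite lt_neqAle wmeasure_ge0 andbT eq_sym; apply/eqP => wc.
have mB := lmeasurable_eball c r.
have : ae_eq mu (eball c r : set (lebesgue_space R n)) (EFin \o w) (cst 0).
  apply/(ae_eq_integral_abs mu mB); first exact/measurable_EFinP/(measurable_funS _ _ mw).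
  rewrite -[RHS]wc; apply: eq_integral => x _.
  by rewrite gee0_abs// lee_fin.
move=> ae0; have ae1 : {ae mu, forall x, ~ eball c r x}.
  move: ae0 wpos; apply: filterS2 => x xc wx /xc[] wx0.
  by rewrite wx0 ltxx in wx.
have : mu.-negligible (~` ~` eball c r) by exact: ae1.
rewrite setCK.
move=> /negligibleP -/(_ mB) m0.
have n0 : (0 < n)%N by exact: ltnW.
have rn0 : (0 < r / n%:R)%R by rewrite divr_gt0// ltr0n.
have : (0 : \bar R) < mu (ball c (r / n%:R)%R).
  by rewrite (lt_le_trans _ (lebesgue_ball_ge _ rn0))// lte_fin exprn_gt0.
rewrite ltNge -m0; apply/negP/negPn; apply: le_lebesgue_outer.
by apply: ball_sub_eball => //; rewrite mulrC divfK// pnatr_eq0 -lt0n.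
Qed.

Lemma osc_ge (E : set 'rV[R]_n) x y : E x -> E y -> `|f x - f y|%:E <= osc E f.
Proof. by move=> Ex Ey; apply: ereal_sup_ubound; exists x => //; exists y. Qed.

Lemma osc_eball_ge0 c r : (0 < r)%R -> 0 <= osc (eball c r) f.
Proof.
move=> r0; apply: le_trans (osc_ge (eball_center c r0) (eball_center c r0)).
by rewrite lee_fin.
Qed.

Lemma riesz_variation_ge0 : 0 <= riesz_variation Omega w f.
Proof.
apply: ereal_sup_ge; exists (poweR (\esum_(b in set0) ((osc (eball b.1 b.2) f * b.2^-1%:E) ^+ n *
                       wmeasure w (eball b.1 b.2))) n%:R^-1).
  by exists set0 => //; split => //; exact: trivIset_set0.
exact: poweR_ge0.
Qed.

Lemma esum_variation_le (B : set ('rV[R]_n * R)) : ball_family Omega B ->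
  \esum_(b in B) ((osc (eball b.1 b.2) f * b.2^-1%:E) ^+ n *
                       wmeasure w (eball b.1 b.2)) <= (v ^+ n)%:E.
Proof.
move=> hB; set S := \esum_(b in B) _.
have S0 : 0 <= S.
  apply: esum_ge0 => b Bb; have [_ _ /(_ b Bb)[b0 _]] := hB.
  rewrite mule_ge0 ?wmeasure_ge0// expe_ge0// mule_ge0 ?osc_eball_ge0//.
  by rewrite lee_fin invr_ge0 ltW.
have nN0 : n%:R != 0%R :> R by rewrite pnatr_eq0; case: n n2.
have Sv : poweR S n%:R^-1 <= v%:E.
  by apply: le_trans fv; apply: ereal_sup_ubound; exists B.
case: S S0 Sv => [s s0| _|//]; last by rewrite poweRyr ?invr_eq0// leye_eq.
rewrite poweR_EFin !lee_fin => sv.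
have -> : (s = (s `^ n%:R^-1) ^+ n)%R.
  by rewrite -powR_mulrn ?powR_ge0// -powRrM mulVf// powRr1.
by rewrite lerXn2r ?nnegrE ?powR_ge0// (le_trans (powR_ge0 _ _) sv).
Qed.

(** The family reduced to this ball would otherwise have infinite variation,
    because the ball has positive w-measure. *)
Lemma osc_eball_fin_num c r : (0 < r)%R -> eball c r `<=` Omega ->
  osc (eball c r) f \is a fin_num.
Proof.
move=> r0 cO; have osc0 := osc_eball_ge0 c r0.
rewrite ge0_fin_numE// ltNge leye_eq; apply/negP => /eqP oscoo.
have := @esum_variation_le [set (c, r)] _.
rewrite esum_set1/= oscoo; last first.
  by rewrite mule_ge0 ?wmeasure_ge0// expe_ge0// mule_ge0// lee_fin invr_ge0 ltW.
have r'0 : 0 < r^-1%:E by rewrite lte_fin invr_gt0.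
rewrite gt0_mulye//.
rewrite expeyy ?(ltnW n2)//.
rewrite gt0_mulye ?wmeasure_eball_gt0//; suff h : ball_family Omega [set (c, r)].
  by move=> /(_ h); rewrite leye_eq.
by split; [exact: countable1|exact: trivIset1|move=> b ->].
Qed.

End variation.

(** * The variation controls the difference quotients *)

Section difference_quotients.
Context {R : realType} {n : nat}.
Local Open Scope ereal_scope.
Variables (Omega : set 'rV[R]_n) (w f : 'rV[R]_n -> R) (v : R).
Hypothesis n2 : (2 <= n)%N.
Hypothesis w0 : forall x, (0 <= w x)%R.
Hypothesis mw : lmeasurable_fun setT w.
Hypothesis wpos : {ae @lebesgue R n, forall x, (0 < w x)%R}.
Hypothesis fv : riesz_variation Omega w f <= v%:E.
Notation mu := (@lebesgue R n).
Implicit Types (m : 'rV[int]_n).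

Let n_gt0 : (0 < n)%N. Proof. exact: ltnW. Qed.

Section grid.
Variable h : R.
Hypothesis h0 : (0 < h)%R.

Let corner m : 'rV[R]_n := \row_i ((m 0 i)%:~R * h)%R.
Let cell m : set 'rV[R]_n := box (corner m, \row_i (((m 0 i)%:~R + 1) * h))%R.
(** A cell and its translate by h along an axis lie within sup-distance 3 h of
    the corner; the factor n passes to the Euclidean norm. *)
Let r : R := (3 * n%:R * h)%R.
(** There are N.+1 = 6 n residues per coordinate, so the corners of two cells
    of the same colour are at least 6 n h = 2 r apart. *)
Let N : nat := (6 * n).-1.

Let r_gt0 : (0 < r)%R. Proof. by rewrite /r !mulr_gt0// ltr0n. Qed.

Let NE : (N.+1 = 6 * n)%N. Proof. by rewrite prednK// muln_gt0. Qed.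

Let n1 : (1 <= n%:R :> R)%R. Proof. by rewrite ler1n. Qed.

Let color m : {ffun 'I_n -> 'I_N.+1} :=
  [ffun i => inord `|(m 0%R i %% N.+1%:Z)%Z|%N].

Let lmeasurable_cell m : lmeasurable (cell m).
Proof.
rewrite [X in measurable X](_ : _ = \bigcap_(i in [set: 'I_n])
   (fun x : lebesgue_space R n => (x : 'rV[R]_n) 0%R i) @^-1`
     `](corner m) 0%R i, (((m 0%R i)%:~R + 1) * h)%R]%classic).
  apply: fin_bigcap_measurable => // i _; rewrite -[X in measurable X]setTI.
  by apply: measurable_coord => //; exact: measurable_itv.
apply/seteqP; split=> x xm i.
  by move=> _ /=; rewrite in_itv/=; have := xm i; rewrite /= [X in (_ <= X)%R]mxE.
by have := xm i Logic.I; rewrite /= in_itv/= [X in (_ -> _ < _ <= X)%R]mxE.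
Qed.

Let cell_cover (x : 'rV[R]_n) : exists m, cell m x.
Proof.
exists (\row_i (Num.ceil (x 0 i / h) - 1))%R => i; rewrite !mxE.
have := Num.Theory.ceil_itv (x 0%R i / h)%R.
rewrite intrD intrN => /andP[h1 h2].
by rewrite -ltr_pdivlMr// -ler_pdivrMr// subrK h2 andbT.
Qed.

Let cell_eball m x (j : 'I_n) : cell m x ->
  eball (corner m) r x /\ eball (corner m) r (x + h *: delta_mx 0%R j)%R.
Proof.
move=> xm; have rE : (r = n%:R * (3 * h))%R by rewrite /r; ring.
suff [x1 x2] : ball (corner m) (3 * h)%R x /\ ball (corner m) (3 * h)%R (x + h *: delta_mx 0%R j)%R.
  by split; apply: (@ball_sub_eball R n (corner m) r (3 * h)%R) => //; rewrite rE.
split; (split; first by rewrite mulr_gt0//) => k i; rewrite (ord1 k) /ball/=;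
  have := xm i; rewrite !mxE ltr_norml => /andP[x1 x2]; first by apply/andP; split; lra.
rewrite eqxx/=; case: (i == j) => /=; rewrite ?mulr1 ?mulr0; apply/andP; split; lra.
Qed.

Let eball_cell m x : cell m x -> eball (corner m) r `<=` ball x (4 * n%:R * h)%R.
Proof.
move=> xm y /eball_sub_ball[_ ym]; split; first by rewrite !mulr_gt0// ltr0n.
move=> k i; rewrite (ord1 k) /ball/= ltr_norml.
have := xm i; have := ym 0%R i; rewrite /ball/= ltr_norml !mxE /r => /andP[y1 y2] /andP[x1 x2].
have nh : (h <= n%:R * h)%R by rewrite ler_peMl// ltW.
by apply/andP; split; lra.
Qed.

Let disjoint_same_color m m' : color m = color m' -> m != m' ->
  eball (corner m) r `&` eball (corner m') r = set0.
Proof.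
move=> cmm' mm'; rewrite -subset0 => y [/eball_sub_ball[_ ym] /eball_sub_ball[_ ym']].
have [i mi] : exists i, m 0%R i != m' 0%R i.
  apply: contrapT => /forallNP all; move/eqP: mm'; apply.
  by apply/rowP => i; apply/eqP; have := all i; move/negP; rewrite negbK.
have Nmm : (N.+1 %| `|m 0%R i - m' 0%R i|)%N.
  have := congr1 (fun c : {ffun 'I_n -> 'I_N.+1} => nat_of_ord (c i)) cmm'.
  have modN (a : int) : (`|(a %% N.+1%:Z)%Z| < N.+1)%N.
    by rewrite -ltz_nat gez0_abs ?modz_ge0// ltz_pmod.
  rewrite !ffunE !inordK// => /(congr1 Posz).
  rewrite !gez0_abs ?modz_ge0// => /eqP.
  by rewrite eqz_mod_dvd dvdzE.
have big : (N.+1 <= `|m 0%R i - m' 0%R i|)%N.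
  by rewrite dvdn_leq// absz_gt0 subr_eq0.
have : (6 * n%:R * h <= `|(corner m) 0 i - (corner m') 0 i|)%R.
  have -> : (6 * n%:R = (N.+1%:Z)%:~R :> R)%R by rewrite NE -pmulrn natrM.
  rewrite !mxE -mulrBl normrM (gtr0_norm h0) ler_pM2r// -intrB -intr_norm.
  by rewrite ler_int -abszE lez_nat.
apply/negP; rewrite -ltNge.
have := ym 0%R i; have := ym' 0%R i; rewrite /ball/= => y1 y2.
have := ler_distD (y 0%R i) ((corner m) 0%R i) ((corner m') 0%R i).
rewrite (distrC (y 0%R i)); move: y1 y2; rewrite /r; lra.
Qed.

Let energy m : \bar R :=
  (osc (eball (corner m) r) f * r^-1%:E) ^+ n * wmeasure w (eball (corner m) r).

Let energy_ge0 m : 0 <= energy m.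
Proof.
rewrite mule_ge0 ?wmeasure_ge0// expe_ge0// mule_ge0 ?osc_eball_ge0//.
by rewrite lee_fin invr_ge0 ltW.
Qed.

Let esum_energy_color (M : set 'rV[int]_n) c :
  (forall m, M m -> eball (corner m) r `<=` Omega) ->
  \esum_(m in M) (if color m == c then energy m else 0) <= (v ^+ n)%:E.
Proof.
move=> MO; pose Mc := [set m | M m /\ color m = c].
have -> : \esum_(m in M) (if color m == c then energy m else 0) = \esum_(m in Mc) energy m.
  rewrite [LHS]esum_mkcond [RHS]esum_mkcond; apply: eq_esum => m _.
  case: ifPn => [/set_mem Mm|/negP Mm]; last first.
    by rewrite ifN//; apply/negP => /set_mem[/mem_set].
  by case: eqP => cm; [rewrite mem_set|rewrite ifN//; apply/negP => /set_mem[]].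
pose B := [set (corner m, r) | m in Mc].
have -> : \esum_(m in Mc) energy m = \esum_(b in B)
   ((osc (eball b.1 b.2) f * b.2^-1%:E) ^+ n * wmeasure w (eball b.1 b.2)).
  rewrite (@reindex_esum _ _ _ Mc B (fun m => (corner m, r)))//.
  split=> [m Mm|m m' _ _ [cmm']|_ [m Mm <-]]; [by exists m| |by exists m].
  apply/rowP => i; have := congr1 (fun x : 'rV[R]_n => x 0%R i) cmm'.
  by rewrite !mxE => /mulIf -/(_ (lt0r_neq0 h0))/intr_inj.
apply: (esum_variation_le n2 w0 fv); split.
- by apply: (sub_countable (card_image_le _ _)); exact: countableP.
- move=> _ _ [m Mm <-] [m' Mm' <-] /= mm'.
  have [->//|neq] := eqVneq m m'; move/set0P/negP: mm'; case.
  by rewrite disjoint_same_color//; case: Mm => _ ->; case: Mm' => _ ->.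
- by move=> _ [m [Mm _] <-]; split => //; exact: MO.
Qed.

Let esum_energy (M : set 'rV[int]_n) :
  (forall m, M m -> eball (corner m) r `<=` Omega) ->
  \esum_(m in M) energy m <= ((6 * n%:R) ^+ n * v ^+ n)%:E.
Proof.
move=> MO; pose e c m := if color m == c then energy m else 0.
rewrite (_ : \esum_(m in M) energy m = \esum_(m in M) \sum_(c : {ffun 'I_n -> 'I_N.+1}) e c m); last first.
  apply: eq_esum => m _; rewrite (bigD1 (color m))//= {1}/e eqxx big1 ?adde0// => c.
  by rewrite eq_sym /e => /negbTE ->.
rewrite esum_sum; last by move=> m c _ _; rewrite /e; case: ifP.
apply: (@le_trans _ _ (\sum_(c : {ffun 'I_n -> 'I_N.+1}) (v ^+ n)%:E)).
  by apply: lee_sum => c _; exact: esum_energy_color.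
rewrite sumEFin lee_fin sumr_const card_ffun !card_ord NE -[leLHS]mulr_natl natrX natrM.
by [].
Qed.

(** Space is divided into cells of side h, each one with a ball of radius
    r = 3 n h that contains the cell and its translate. On the cell the
    difference quotient is at most osc(f) / h, with the oscillation over the
    ball. The balls of the cells of one colour are disjoint and contribute at
    most v^n. There are (6 n)^n colours, and (3 n)^n is the price for replacing
    r by h in the denominator. *)
Lemma integral_difference_quotient_le (j : 'I_n) (K : set 'rV[R]_n) :
  lmeasurable K ->
  lmeasurable_fun K (fun x => f (x + h *: delta_mx 0%R j) - f x)%R ->
  (forall x, K x -> ball x (4 * n%:R * h)%R `<=` Omega) ->
  \int[mu]_(x in K) (`|h^-1 * (f (x + h *: delta_mx 0 j) - f x)| ^+ n * w x)%:E
    <= ((18 * n%:R ^+ 2) ^+ n * v ^+ n)%:E.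
Proof.
move=> mK mf KO.
pose F x : R := (`|r^-1 * (f (x + h *: delta_mx 0 j) - f x)| ^+ n * w x)%R.
have mF : lmeasurable_fun K F.
  apply: measurable_funM; last exact: measurable_funS mw.
  apply: lmeasurable_normX; apply: measurable_funM => //.
have F0 x : (0 <= F x)%R by rewrite mulr_ge0 ?exprn_ge0.
pose M := [set m | cell m `&` K !=set0].
have MO m : M m -> eball (corner m) r `<=` Omega.
  by move=> [x [xm Kx]]; apply: subset_trans (eball_cell xm) (KO x Kx).
have FM : \int[mu]_(x in K) (F x)%:E <= \esum_(m in M) energy m.
  apply: (@ge0_integral_cover_le R n _ M cell) => // [x Kx|m Mm].
    by have [m xm] := cell_cover x; exists m => //; exists x.
  have := osc_eball_fin_num n2 w0 mw wpos fv r_gt0 (MO m Mm).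
  case oE : (osc _ f) => [q| |] // _.
  have q0 : (0 <= q)%R by rewrite -lee_fin -oE; exact: osc_eball_ge0.
  have mKm : lmeasurable (K `&` cell m) by exact: measurableI.
  apply: (@le_trans _ _ (\int[mu]_(x in K `&` cell m) ((q * r^-1) ^+ n * w x)%:E)).
    apply: ge0_le_lebesgue_integral => //.
    - by apply: measurable_funS mF => //; exact: subIsetl.
    - by apply: measurable_funM => //; exact: measurable_funS mw.
    move=> x [_ xm]; rewrite /F ler_wpM2r// lerXn2r ?nnegrE// ?mulr_ge0 ?invr_ge0 ?(ltW r_gt0)//.
    rewrite normrM ger0_norm ?invr_ge0 ?(ltW r_gt0)// mulrC ler_wpM2r ?invr_ge0 ?(ltW r_gt0)//.
    have [xb1 xb2] := cell_eball j xm.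
    by rewrite -lee_fin -oE; exact: osc_ge.
  rewrite ge0_lebesgue_integralZl//; last 2 first.
  - exact: measurable_funS mw.
  - by rewrite exprn_ge0// mulr_ge0// invr_ge0 ltW.
  rewrite /energy oE -EFinM -EFin_expe; apply: lee_wpmul2l.
    by rewrite lee_fin exprn_ge0// mulr_ge0// invr_ge0 ltW.
  apply: ge0_subset_lebesgue_integral => //.
  - exact: lmeasurable_eball.
  - exact: measurable_funS mw.
  - by move=> x [_ xm]; have [] := cell_eball j xm.
have FE x : (`|h^-1 * (f (x + h *: delta_mx 0 j) - f x)| ^+ n * w x = (3 * n%:R) ^+ n * F x)%R.
  rewrite /F mulrA -exprMn; congr (_ ^+ n * _)%R.
  rewrite -[X in (_ = X * _)%R]ger0_norm ?mulr_ge0// -normrM; congr `| _ |%R.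
  by rewrite /r invfM; field; rewrite gt_eqF//= pnatr_eq0 -lt0n n_gt0.
under eq_integral do rewrite FE.
rewrite ge0_lebesgue_integralZl ?exprn_ge0 ?mulr_ge0//.
apply: (@le_trans _ _ (((3 * n%:R) ^+ n)%:E * ((6 * n%:R) ^+ n * v ^+ n)%:E)).
  apply: lee_wpmul2l; first by rewrite lee_fin exprn_ge0 ?mulr_ge0.
  exact: le_trans FM (esum_energy MO).
by rewrite -EFinM lee_fin mulrA -exprMn (_ : 3 * n%:R * (6 * n%:R) = 18 * n%:R ^+ 2)%R//; ring.
Qed.

End grid.
End difference_quotients.

(** * Pointwise Lipschitz estimates *)

Section pointwise_lipschitz.
Context {R : realType} {n : nat}.
Local Open Scope ereal_scope.
Variables (Omega : set 'rV[R]_n) (w f : 'rV[R]_n -> R) (v : R).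
Hypothesis n2 : (2 <= n)%N.
Hypothesis w0 : forall x, (0 <= w x)%R.
Hypothesis mw : lmeasurable_fun setT w.
Hypothesis wpos : {ae @lebesgue R n, forall x, (0 < w x)%R}.
Hypothesis dw_lty : forall r,
  \int[@lebesgue R n]_(x in ball (0%R : 'rV[R]_n) r) (dual_weight w x)%:E < +oo.
Hypothesis fv : riesz_variation Omega w f <= v%:E.
Notation mu := (@lebesgue R n).

Let n_gt0 : (0 < n)%N. Proof. exact: ltnW. Qed.

Lemma integral_young_le (E : set 'rV[R]_n) (u : 'rV[R]_n -> R) (d : R) :
  (0 < d)%R -> lmeasurable E -> lmeasurable_fun E u ->
  \int[mu]_(x in E) `|u x|%:E <=
    d%:E * (\int[mu]_(x in E) (`|u x| ^+ n * w x)%:E) +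
    (d `^ (1 - n%:R)^-1)%:E * \int[mu]_(x in E) (dual_weight w x)%:E.
Proof.
move=> d0 mE mu_; have mwE : lmeasurable_fun E w by exact: measurable_funS mw.
have mdw : lmeasurable_fun E (dual_weight w) by exact: lmeasurable_powR.
have muw : lmeasurable_fun E (fun x => `|u x| ^+ n * w x)%R.
  by apply: measurable_funM => //; exact: lmeasurable_normX.
rewrite -ge0_lebesgue_integralZl//; last 2 first.
- by move=> x _; rewrite mulr_ge0 ?exprn_ge0.
- exact: ltW.
rewrite -ge0_lebesgue_integralZl ?powR_ge0//; last by move=> x _; exact: powR_ge0.
rewrite -ge0_lebesgue_integralD//.
- apply: ae_ge0_le_integral => //.
  + by apply/measurable_EFinP; exact: lmeasurable_norm.
  + move=> x _; rewrite lee_fin addr_ge0 ?mulr_ge0 ?powR_ge0 ?exprn_ge0//.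
    exact: ltW.
  + apply/measurable_EFinP; apply: measurable_funD; exact: measurable_funM.
  apply: (ae_imply _ wpos) => x wx _; rewrite lee_fin; exact: young_dual_weight.
- exact: measurable_funM.
- exact: measurable_funM.
- move=> x _; rewrite mulr_ge0 ?mulr_ge0 ?exprn_ge0//; exact: ltW.
- by move=> x _; rewrite mulr_ge0 ?powR_ge0.
Qed.

(** The variation bounds the w-measure of the balls by (v / M)^n, and Young's
    inequality for the constant function 1 converts w-measure into Lebesgue
    measure. The factor n^n comes from cubes inscribed in the balls. *)
Lemma sum_radius_le (rho d M : R) (t : seq ('rV[R]_n * R)) :
  (0 < d)%R -> (0 < M)%R -> uniq t -> trivIset [set` t] (fun b => eball b.1 b.2) ->
  (forall b, b \in t -> [/\ (0 < b.2)%R, eball b.1 b.2 `<=` Omega,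
     eball b.1 b.2 `<=` ball (0%R : 'rV[R]_n) rho &
     (M * b.2)%:E <= osc (eball b.1 b.2) f]) ->
  (\sum_(b <- t) b.2 ^+ n)%:E <= (n%:R ^+ n)%:E *
    ((d * (v / M) ^+ n)%:E +
     (d `^ (1 - n%:R)^-1)%:E * \int[mu]_(x in ball (0%R : 'rV[R]_n) rho) (dual_weight w x)%:E).
Proof.
move=> d0 M0 ut tt tP.
have nn0 : (0 < n%:R ^+ n :> R)%R by rewrite exprn_gt0// ltr0n.
have wt : \sum_(b <- t) wmeasure w (eball b.1 b.2) <= ((v / M) ^+ n)%:E.
  have tfam : ball_family Omega [set` t].
    split=> [|//|b /tP[b0 bO _ _]]; last by split.
    exact/finite_set_countable.
  have := esum_variation_le n2 w0 fv tfam.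
  rewrite (esum_fset (finite_seq t)); last first.
    move=> b; rewrite inE => /tP[b0 _ _ _]; rewrite mule_ge0 ?wmeasure_ge0// expe_ge0//.
    by rewrite mule_ge0 ?osc_eball_ge0// lee_fin invr_ge0 ltW.
  rewrite -fsbig_seq// => le_v.
  have Mn : (0 < M ^+ n)%R by rewrite exprn_gt0.
  rewrite expr_div_n EFinM lee_pdivlMr// muleC.
  apply: le_trans le_v; rewrite ge0_sume_distrr; last by move=> b _; exact: wmeasure_ge0.
  rewrite big_seq [leRHS]big_seq; apply: lee_sum => b bt; have [b0 bO _ Mb] := tP b bt.
  apply: lee_wpmul2r; first exact: wmeasure_ge0.
  have := osc_eball_fin_num n2 w0 mw wpos fv b0 bO.
  case oscE : (osc _ f) => [q| |] // _; rewrite -EFinM -EFin_expe lee_fin.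
  move: Mb; rewrite oscE lee_fin => Mb.
  have Mq : (M <= q / b.2)%R by rewrite ler_pdivlMr.
  by rewrite lerXn2r ?nnegrE ?(ltW M0)// (le_trans (ltW M0)).
have -> : (\sum_(b <- t) b.2 ^+ n)%:E = (n%:R ^+ n)%:E * \sum_(b <- t) ((b.2 / n%:R) ^+ n)%:E.
  rewrite sumEFin -EFinM; congr EFin; rewrite mulr_sumr; apply: eq_bigr => b _.
  by rewrite -exprMn mulrC divfK// pnatr_eq0 -lt0n.
apply: lee_wpmul2l; first by rewrite lee_fin ltW.
apply: (@le_trans _ _ (\sum_(b <- t) (d%:E * wmeasure w (eball b.1 b.2) +
   (d `^ (1 - n%:R)^-1)%:E * \int[mu]_(x in eball b.1 b.2) (dual_weight w x)%:E))).
  rewrite big_seq [leRHS]big_seq; apply: lee_sum => b bt; have [b0 _ _ _] := tP b bt.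
  have bn0 : (0 < b.2 / n%:R)%R by rewrite divr_gt0// ltr0n.
  have mb := lmeasurable_eball b.1 b.2.
  apply: (@le_trans _ _ (mu (eball b.1 b.2))).
    apply: le_trans (lebesgue_ball_ge b.1 bn0) _; apply: le_lebesgue_outer.
    by apply: ball_sub_eball => //; rewrite mulrC divfK// pnatr_eq0 -lt0n.
  have := @integral_young_le (eball b.1 b.2) (cst 1%R) d d0 mb (measurable_cst _).
  rewrite /= normr1 integral_cst// mul1e => /le_trans; apply.
  rewrite leeD2r//; apply: lee_wpmul2l; first by rewrite lee_fin ltW.
  by rewrite /wmeasure le_eqVlt; apply/orP; left; apply/eqP; apply: eq_integral => x _;
    rewrite expr1n mul1r.
rewrite big_split/=; apply: leeD.
  rewrite -ge0_sume_distrr; last by move=> b _; exact: wmeasure_ge0.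
  by rewrite EFinM; apply: lee_wpmul2l => //; rewrite lee_fin ltW.
rewrite -ge0_sume_distrr; last first.
  by move=> b _; apply: integral_ge0 => x _; rewrite lee_fin powR_ge0.
apply: lee_wpmul2l; first by rewrite lee_fin powR_ge0.
apply: ge0_sum_integral_le => //.
- by move=> b; exact: lmeasurable_eball.
- exact: lmeasurable_ball.
- exact: lmeasurable_powR (measurable_funS _ _ mw).
- by move=> x; exact: powR_ge0.
- by move=> b /tP[].
Qed.

(** The points with infinite pointwise Lipschitz constant are covered by balls
    on which osc(f) > M r for arbitrarily large M. The w-measure of disjoint
    such balls is at most (v / M)^n, so their Lebesgue measure is small too. *)
Lemma ae_pointwise_lipschitz : open Omega ->
  {ae mu, forall x, Omega x -> exists M : nat, forall y, (`|y - x| < M.+1%:R^-1)%R ->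
    (`|f y - f x| <= M.+1%:R * `|y - x|)%R}.
Proof.
move=> oO.
pose bad N := [set x : 'rV[R]_n | [/\ Omega x, ball (0%R : 'rV[R]_n) N%:R x &
  forall M d : R, (0 < M)%R -> (0 < d)%R -> exists2 r : R, (0 < r < d)%R &
    (M * r)%:E < osc (eball x r) f]].
suff bad0 N : lebesgue_outer (bad N) = 0.
  apply: (@ae_notin_negligible _ _ (\bigcup_N bad N)).
    by apply: negligible_bigcup => N; exact: lebesgue_outer_negligible.
  move=> x /= /not_implyP[Ox] /forallNP xM.
  exists (Num.bound `|x|) => //; split => //.
    by rewrite -ball_normE/= sub0r normrN archi_boundP.
  move=> M d M0 d0; apply: contrapT => nr.
  (* If osc(f) <= M r on the balls of radius r < d around x, then M' is a
     Lipschitz constant from x on the ball of radius 1 / M'. *)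
  pose M' := (2 * n%:R * (M + d^-1))%R.
  have M'0 : (0 <= M')%R by rewrite !mulr_ge0// addr_ge0 ?invr_ge0 ?(ltW M0) ?(ltW d0).
  apply: (xM (Num.bound M')) => y yx.
  have M'b : (M' <= (Num.bound M').+1%:R)%R.
    by rewrite ltW// (lt_le_trans (archi_boundP M'0))// ler_nat.
  have [->|yx0] := eqVneq y x; first by rewrite !subrr !normr0 mulr0.
  have yx_gt0 : (0 < `|y - x|)%R by rewrite normr_gt0 subr_eq0.
  pose r := (2 * n%:R * `|y - x|)%R.
  have r0 : (0 < r)%R by rewrite !mulr_gt0// ltr0n.
  have nn : (0 < n%:R :> R)%R by rewrite ltr0n.
  have Mb0 : (0 < (Num.bound M').+1%:R :> R)%R by rewrite ltr0n.
  have rd : (r < d)%R.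
    have : (`|y - x| * (Num.bound M').+1%:R < 1)%R.
      by rewrite -ltr_pdivlMr// mul1r.
    have : (`|y - x| * M' <= `|y - x| * (Num.bound M').+1%:R)%R by rewrite ler_pM2l.
    move=> h1 h2; have h3 : (`|y - x| * M' < 1)%R by exact: le_lt_trans h2.
    have : (r * d^-1 < 1)%R.
      apply: le_lt_trans h3; rewrite /r /M' mulrDr mulrDr.
      rewrite [leRHS](_ : _ = `|y - x| * (2 * n%:R * M) + 2 * n%:R * `|y - x| * d^-1)%R; last ring.
      by rewrite lerDr !mulr_ge0// ltW.
    by rewrite ltr_pdivrMr// mul1r.
  have osc_le : osc (eball x r) f <= (M * r)%:E.
    by rewrite leNgt; apply/negP => h; apply: nr; exists r => //; rewrite r0 rd.
  rewrite -lee_fin; apply: le_trans (_ : (M * r)%:E <= _).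
    apply: le_trans osc_le; apply: osc_ge; last exact: eball_center.
    rewrite /eball/= (le_lt_trans (ler_norm_enorm _))// /r.
    by rewrite -mulrA ltr_pMl ?ltr1n// mulr_gt0.
  rewrite lee_fin (le_trans _ (ler_wpM2r (ltW yx_gt0) M'b))// /r /M'.
  rewrite (_ : M * _ = 2 * n%:R * M * `|y - x|)%R; last ring.
  by rewrite ler_pM2r// ler_pM2l ?mulr_gt0// lerDl invr_ge0 ltW.
apply/eqP; rewrite eq_le lebesgue_outer_ge0 andbT.
apply/lee_addgt0Pr => e e0; rewrite add0e.
pose S := \int[mu]_(x in ball (0%R : 'rV[R]_n) N%:R) (dual_weight w x)%:E.
have S0 : 0 <= S by apply: integral_ge0 => x _; rewrite lee_fin powR_ge0.
have Sfin : S \is a fin_num by rewrite ge0_fin_numE//; exact: dw_lty.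
have [s s0 SE] : exists2 s, (0 <= s)%R & S = s%:E.
  by exists (fine S); rewrite ?fine_ge0// fineK.
have vn0 : (0 <= v)%R by rewrite -lee_fin (le_trans _ fv)// riesz_variation_ge0.
pose c := (6 ^+ n * n%:R ^+ n : R)%R.
have c0 : (0 < c)%R by rewrite mulr_gt0// exprn_gt0// ltr0n.
pose e' := (e / (2 * c))%R.
have e'0 : (0 < e')%R by rewrite divr_gt0// mulr_gt0.
(* M makes both terms of sum_radius_le, taken with d = M, at most e'. *)
pose A := (s / e' + 1)%R.
have A0 : (0 < A)%R by rewrite ltr_wpDl// divr_ge0// ltW.
have n1R : (0 < n%:R - 1 :> R)%R by rewrite subr_gt0 ltr1n.
pose M := (1 + v ^+ n / e' + A `^ (n%:R - 1))%R.
have vne : (0 <= v ^+ n / e')%R by rewrite divr_ge0 ?exprn_ge0// ltW.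
have M1 : (1 <= M)%R by rewrite /M -addrA lerDl addr_ge0// powR_ge0.
have M0 : (0 < M)%R by exact: lt_le_trans M1.
have small1 : (M * (v / M) ^+ n <= e')%R.
  rewrite expr_div_n mulrCA.
  have -> : (M / M ^+ n = (M ^+ n.-1)^-1)%R.
    have -> : (M ^+ n = M * M ^+ n.-1)%R by rewrite -exprS prednK.
    by rewrite invfM mulrA divff ?mul1r// gt_eqF.
  rewrite ler_pdivrMr ?exprn_gt0//.
  apply: (@le_trans _ _ (e' * M)%R).
    by rewrite mulrC -ler_pdivrMr// /M addrAC lerDr addr_ge0 ?powR_ge0.
  by rewrite ler_pM2l// ler_eXnr//; case: (n) n2 => [|[]].
have small2 : (M `^ (1 - n%:R)^-1 * s <= e')%R.
  have -> : ((1 - n%:R)^-1 = - (n%:R - 1)^-1 :> R)%R by rewrite -invrN opprB.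
  rewrite powRN mulrC ler_pdivrMr ?powR_gt0//.
  apply: (@le_trans _ _ (e' * A)%R).
    by rewrite /A mulrDr mulr1 mulrC divfK ?gt_eqF// lerDl ltW.
  rewrite ler_pM2l//.
  have -> : (A = (A `^ (n%:R - 1)) `^ (n%:R - 1)^-1)%R.
    by rewrite -powRrM divff ?powRr1 ?gt_eqF// ltW.
  rewrite ge0_ler_powR ?invr_ge0 ?nnegrE ?powR_ge0//.
  - exact: ltW.
  - exact: ltW.
  - by rewrite /M lerDr addr_ge0.
apply: (@le_trans _ _ (6 ^+ n * (n%:R ^+ n * (e' + e')))%:E); last first.
  rewrite lee_fin mulrA -/c /e'.
  by rewrite (_ : c * _ = e)%R//; field; rewrite gt_eqF.
pose P := [set b : 'rV[R]_n * R | [/\ (0 < b.2)%R, eball b.1 b.2 `<=` Omega,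
     eball b.1 b.2 `<=` ball (0%R : 'rV[R]_n) N%:R &
     (M * b.2)%:E <= osc (eball b.1 b.2) f]].
apply: (@vitali_outer R n P) => [b []//|x [Ox xN xbad]|t ut tP tt].
  have /nbhs_ballP[d /= d0 xd] : nbhs x (Omega `&` ball (0%R : 'rV[R]_n) N%:R).
    by apply: open_nbhs_nbhs; split => //; apply: openI => //; exact: ball_open.
  have [r /andP[r0 rd] rosc] := xbad _ _ M0 d0.
  have xr : eball x r `<=` Omega `&` ball (0%R : 'rV[R]_n) N%:R.
    by apply: subset_trans xd => y /eball_sub_ball; apply: le_ball; exact: ltW.
  exists (x, r); last exact: ballxx.
  by split => //=; [move=> y /xr[]|move=> y /xr[]|exact: ltW].
have tte : trivIset [set` t] (fun b : 'rV[R]_n * R => eball b.1 b.2).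
  move=> b b' bt b't [y [yb yb']]; apply: tt => //.
  by exists y; split; exact: eball_sub_ball.
rewrite -lee_fin; apply: le_trans (sum_radius_le M0 M0 ut tte tP) _.
have SE' : \int[mu]_(x in ball (0%R : 'rV[R]_n) N%:R) (dual_weight w x)%:E = s%:E by exact: SE.
apply: (@le_trans _ _ ((n%:R ^+ n)%:E * (e'%:E + e'%:E))); last by rewrite -EFinD -EFinM.
apply: lee_wpmul2l; first by rewrite lee_fin ltW// exprn_gt0// ltr0n.
by apply: leeD; rewrite ?lee_fin//; rewrite SE' -EFinM lee_fin.
Qed.

End pointwise_lipschitz.

(** * Weak limits of uniformly integrable sequences *)

Section ultralimits.
Context {R : realType}.
Variable U : set_system nat.
Context {UU : UltraFilter U}.

Lemma ultra_fmap (T : Type) (a : nat -> T) : UltraFilter (a @ U).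
Proof.
have FU : ProperFilter U by exact: ultra_proper.
split; first exact: fmap_proper_filter.
move=> G GG aG; rewrite eqEsubset; split=> // A GA.
have [//|naA] := in_ultra_setVsetC (a @^-1` A) UU.
have GnA : G (~` A) by apply: aG.
have : G (A `&` ~` A) by exact: filterI.
by rewrite setICr => /filter_not_empty.
Qed.

Lemma ultra_bounded_cvg (a : nat -> R) (B : R) :
  (\forall k \near U, `|a k| <= B) -> cvg (a @ U).
Proof.
move=> aB; have := @segment_compact R (- B) B.
rewrite compact_ultra => /(_ (a @ U) (ultra_fmap a)).
have aU : (a @ U) `[- B, B]%classic.
  apply: filterS aB => k; rewrite /= in_itv/= ler_norml//.
by move=> /(_ aU)[l [_ al]]; apply/cvg_ex; exists l.
Qed.

End ultralimits.

Section ultralimit_density.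
Context {R : realType} {n : nat}.
Variable U : set_system nat.
Context {UU : UltraFilter U}.
Hypothesis Uoo : forall A : set nat, (\forall k \near \oo, A k) -> U A.
Notation mu := (@lebesgue R n).

Variables (K : set 'rV[R]_n) (u : nat -> 'rV[R]_n -> R) (B : R).
Hypothesis mK : lmeasurable K.
Hypothesis Koo : (mu K < +oo)%E.
Hypothesis mu_ : forall k, lmeasurable_fun K (u k).
Hypothesis uB : \forall k \near \oo, (\int[mu]_(x in K) `|u k x|%:E <= B%:E)%E.
Hypothesis uniform_int : forall e : R, 0 < e -> exists2 d : R, 0 < d &
  forall E, lmeasurable E -> E `<=` K -> (mu E < d%:E)%E ->
    \forall k \near \oo, (\int[mu]_(x in E) `|u k x|%:E <= e%:E)%E.

Let a (E : set 'rV[R]_n) (k : nat) : R := \int[mu]_(x in E `&` K) u k x.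

Let FU : ProperFilter U. Proof. exact: ultra_proper. Qed.

Let integrable_u : \forall k \near \oo, forall E, lmeasurable E ->
  mu.-integrable (E `&` K) (EFin \o u k).
Proof.
apply: filterS uB => k uk E mE.
apply: (@integrableS _ _ _ mu K) => //; first exact: measurableI.
apply/integrableP; split; first by apply/measurable_EFinP; exact: mu_.
by apply: le_lt_trans uk _; rewrite ltry.
Qed.

Let abs_a E (e : R) : lmeasurable E ->
  (\forall k \near \oo, (\int[mu]_(x in E `&` K) `|u k x|%:E <= e%:E)%E) ->
  \forall k \near U, `|a E k| <= e.
Proof.
move=> mE ue; apply: Uoo; apply: filterS2 ue integrable_u => k ue iu.
apply: le_trans (le_normr_Rintegral (measurableI _ _ mE mK) (iu E mE)) _.
rewrite /Rintegral -lee_fin fineK//.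
rewrite ge0_fin_numE; first exact: le_lt_trans ue (ltry _).
by apply: integral_ge0 => x _; rewrite lee_fin.
Qed.

Let cvg_a E : lmeasurable E -> cvg (a E @ U).
Proof.
move=> mE; apply: (@ultra_bounded_cvg _ _ _ _ B); apply: abs_a => //.
apply: filterS uB => k; apply: le_trans; apply: ge0_subset_lebesgue_integral => //.
- exact: measurableI.
- exact: lmeasurable_norm.
Qed.

(** An ultrafilter makes the bounded sequences a E converge for all measurable
    sets E at once. *)
Let nu0 E : R := lim (a E @ U).

Let nu0_small (e : R) : 0 < e -> exists2 d : R, 0 < d &
  forall E, lmeasurable E -> (mu (E `&` K) < d%:E)%E -> `|nu0 E| <= e.
Proof.
move=> e0; have [d d0 dP] := uniform_int e0; exists d => // E mE EK.
have cn : `|a E k| @[k --> U] --> `|nu0 E| by apply: cvg_norm; exact: cvg_a.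
rewrite -(cvg_lim _ cn)//; apply: limr_le; first by apply/cvg_ex; exists `|nu0 E|.
by apply: abs_a => //; apply: dP => //; first exact: measurableI; exact: subIsetr.
Qed.

Let nu0U E F : lmeasurable E -> lmeasurable F -> E `&` F = set0 ->
  nu0 (E `|` F) = nu0 E + nu0 F.
Proof.
move=> mE mF EF; apply: cvg_lim => //.
have h : (a E k + a F k) @[k --> U] --> nu0 E + nu0 F by apply: cvgD; exact: cvg_a.
apply: cvg_trans h; apply: near_eq_cvg; apply: Uoo; apply: filterS integrable_u => k iu.
rewrite /a setIUl Rintegral_setU//.
- exact: measurableI.
- exact: measurableI.
- by rewrite -setIUl; apply: iu; exact: measurableU.
- by apply/disj_set2P; rewrite setIACA EF set0I.
Qed.

Let nu (E : set (lebesgue_space R n)) : \bar R := (nu0 E)%:E.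

Let nu_set0 : nu set0 = 0%E.
Proof.
rewrite /nu /nu0; congr EFin; apply: cvg_lim => //.
rewrite (_ : a set0 = cst 0); first exact: cvg_cst.
by apply/funext => k; rewrite /a set0I Rintegral_set0.
Qed.

Let nu0_bigsetU (F : nat -> set (lebesgue_space R n)) N :
  (forall i, measurable (F i)) -> trivIset setT F ->
  nu0 (\big[setU/set0]_(i < N) F i) = \sum_(i < N) nu0 (F i).
Proof.
move=> mF tF; elim: N => [|N ih].
  by rewrite !big_ord0; have [] := nu_set0.
rewrite !big_ord_recr/= nu0U//; first by rewrite ih.
- by apply: bigsetU_measurable => i _; exact: mF.
- rewrite -bigcup_mkord; apply/seteqP; split=> // x [[i /= iN Fi] FN].
  have := tF i N Logic.I Logic.I (ex_intro _ x (conj Fi FN)).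
  by move=> iN'; rewrite iN' ltnn in iN.
Qed.

(** Finite additivity passes to the limit, and uniform integrability makes nu0
    small on the remainders T N of the union, whose measure tends to 0. *)
Let nu_sigma_additive : semi_sigma_additive nu.
Proof.
move=> F mF tF mUF.
pose T N := (\bigcup_i F i `\` \big[setU/set0]_(i < N) F i) `&` K.
have mb N : lmeasurable (\big[setU/set0]_(i < N) F i).
  by apply: bigsetU_measurable => i _; exact: mF.
have mT N : lmeasurable (T N).
  by apply: measurableI => //; apply: measurableD.
have Tcap : \bigcap_N T N = set0.
  apply/seteqP; split=> // x xT; have [[[i _ Fi] _] _] := xT 0%N Logic.I.
  have [[_ +] _] := xT i.+1 Logic.I; apply.
  by rewrite -bigcup_mkord; exists i => /=.
have T0 : mu (T N) @[N --> \oo] --> 0%E.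
  have : mu \o T @ \oo --> mu (\bigcap_N T N).
    apply: nonincreasing_cvg_mu => //.
    - apply: le_lt_trans Koo; apply: le_lebesgue_outer; exact: subIsetr.
    - by rewrite Tcap; exact: measurable0.
    - move=> N M NM; apply/subsetPset => x [[Fx nx] Kx]; split => //; split => // bx.
      apply: nx; move: bx; rewrite -!bigcup_mkord => -[i /= iN Fi].
      by exists i => //=; exact: leq_trans NM.
  by rewrite Tcap measure0.
under eq_fun do rewrite big_mkord sumEFin -nu0_bigsetU//.
apply: cvg_EFin; first by near=> N.
apply/cvgrPdist_le => e e0; have [d d0 dP] := nu0_small e0.
have T0d : \forall N \near \oo, (mu (T N) < d%:E)%E.
  have /fine_cvgP[Tfin /cvgrPdist_lt/(_ d d0) Td] := T0.
  near=> N; have TN : mu (T N) \is a fin_num by near: N.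
  rewrite -(fineK TN) lte_fin; have : `|0 - fine (mu (T N))| < d by near: N.
  by rewrite sub0r normrN; apply: le_lt_trans; exact: ler_norm.
apply: filterS T0d => N TN /=.
rewrite (_ : \bigcup_i F i = \big[setU/set0]_(i < N) F i `|`
    (\bigcup_i F i `\` \big[setU/set0]_(i < N) F i)); last first.
  apply/seteqP; split=> [x Fx|x [|[]//]].
    by have [?|?] := pselect ((\big[setU/set0]_(i < N) F i) x); [left|right].
  by rewrite -bigcup_mkord => -[i _ Fi]; exists i.
rewrite nu0U//.
- by rewrite addrAC subrr add0r; apply: dP => //; exact: measurableD.
- exact: measurableD.
- by rewrite setDE setIC -setIA setICl setI0.
Unshelve. all: by end_near. Qed.

(** A uniformly integrable sequence has a density along an ultrafilter. This is
    the compactness half of the Dunford-Pettis theorem: the ultralimit of the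
    indefinite integrals is a charge, and Radon-Nikodym's theorem applies. *)
Lemma ultralimit_density : exists2 g : 'rV[R]_n -> R,
  mu.-integrable setT (EFin \o g) &
  forall E, lmeasurable E -> E `<=` K ->
    (\int[mu]_(x in E) u k x)%R @[k --> U] --> (\int[mu]_(x in E) g x)%R.
Proof.
have nu_fin E : measurable E -> nu E \is a fin_num by [].
pose c : {charge set (lebesgue_space R n) -> \bar R} :=
  HB.pack nu (isCharge.Build _ _ _ nu nu_set0 nu_fin nu_sigma_additive).
have cmu : c `<< mu.
  apply/null_content_dominatesP => E mE E0; rewrite /c/= /nu; congr EFin.
  apply/eqP; rewrite -normr_le0; apply/ler_addgt0Pr => e e0; rewrite add0r.
  have [d d0] := nu0_small e0; apply => //.
  apply: (@le_lt_trans _ _ (mu E)); last by rewrite E0 lte_fin.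
  by apply: le_lebesgue_outer; exact: subIsetl.
pose h := Radon_Nikodym c mu.
pose g x := fine (h x).
have gE : EFin \o g = h.
  by apply/funext => x; rewrite /g/= fineK//; exact: Radon_Nikodym_fin_num.
exists g; first by rewrite gE; exact: Radon_Nikodym_integrable.
move=> E mE EK.
have -> : (\int[mu]_(x in E) g x)%R = nu0 E.
  have -> : (\int[mu]_(x in E) g x)%R = fine (\int[mu]_(x in E) h x)%E by rewrite -gE.
  by rewrite -(Radon_Nikodym_integral cmu mE).
have aE : a E = (fun k => \int[mu]_(x in E) u k x)%R.
  by rewrite /a (_ : E `&` K = E)//; exact/setIidPl.
by rewrite -aE; exact: cvg_a.
Qed.

End ultralimit_density.

(** * Uniform integrability of the difference quotients *)

Definition difference_quotient (R : realType) (n : nat) (f : 'rV[R]_n -> R)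
    (j : 'I_n) (h : R) : 'rV[R]_n -> R :=
  fun x => h^-1 * (f (x + h *: delta_mx 0 j) - f x).

Section difference_quotient_integrals.
Context {R : realType} {n : nat}.
Local Open Scope ereal_scope.
Variables (Omega : set 'rV[R]_n) (w f : 'rV[R]_n -> R) (v : R).
Hypothesis n2 : (2 <= n)%N.
Hypothesis w0 : forall x, (0 <= w x)%R.
Hypothesis mw : lmeasurable_fun setT w.
Hypothesis wpos : {ae @lebesgue R n, forall x, (0 < w x)%R}.
Hypothesis dw_lty : forall r,
  \int[@lebesgue R n]_(x in ball (0%R : 'rV[R]_n) r) (dual_weight w x)%:E < +oo.
Hypothesis mf : lmeasurable_fun setT f.
Hypothesis fv : riesz_variation Omega w f <= v%:E.
Notation mu := (@lebesgue R n).

Let C : R := ((18 * n%:R ^+ 2) ^+ n * v ^+ n)%R.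

Let C0 : (0 <= C)%R.
Proof.
have v0 : (0 <= v)%R by rewrite -lee_fin (le_trans _ fv)// riesz_variation_ge0.
by rewrite mulr_ge0 ?exprn_ge0// mulr_ge0// exprn_ge0.
Qed.

Let mfs a : lmeasurable_fun setT (fun x => f (x + a)%R).
Proof.
have := @lmeasurable_fun_shift R n setT f a measurableT mf.
by rewrite preimage_setT.
Qed.

Lemma lmeasurable_difference_quotient j h (D : set 'rV[R]_n) :
  lmeasurable_fun D (difference_quotient f j h).
Proof.
have mq : lmeasurable_fun setT (difference_quotient f j h).
  apply: measurable_funM; first exact: measurable_cst.
  by apply: measurable_funB; [exact: mfs|exact: mf].
exact: measurable_funS mq.
Qed.

Section inner_set.
Variables (K : set 'rV[R]_n) (N h1 : R).
Hypothesis mK : lmeasurable K.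
Hypothesis KN : K `<=` ball (0%R : 'rV[R]_n) N.
Hypothesis h10 : (0 < h1)%R.
Hypothesis KO : forall x, K x -> ball x (4 * n%:R * h1)%R `<=` Omega.

Lemma integral_normX_difference_quotient_le j (h : R) (E : set 'rV[R]_n) :
  lmeasurable E -> E `<=` K -> (0 < h <= h1)%R ->
  \int[mu]_(x in E) (`|difference_quotient f j h x| ^+ n * w x)%:E <= C%:E.
Proof.
move=> mE EK /andP[h0 hh1].
apply: (integral_difference_quotient_le n2 w0 mw wpos fv h0) => //.
  by apply: measurable_funB; [exact: measurable_funS (mfs _)|exact: measurable_funS mf].
move=> x /EK Kx; apply: subset_trans (KO Kx); apply: le_ball.
by rewrite ler_wpM2l// mulr_ge0.
Qed.

Let young j (h d : R) (E : set 'rV[R]_n) :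
  lmeasurable E -> E `<=` K -> (0 < h <= h1)%R -> (0 < d)%R ->
  \int[mu]_(x in E) `|difference_quotient f j h x|%:E <=
  (d * C)%:E + (d `^ (1 - n%:R)^-1)%:E * \int[mu]_(x in E) (dual_weight w x)%:E.
Proof.
move=> mE EK hh1 d0.
have mq := @lmeasurable_difference_quotient j h E.
apply: (le_trans (integral_young_le n2 w0 mw wpos d0 mE mq)).
rewrite leeD2r// EFinM; apply: lee_wpmul2l; first by rewrite lee_fin ltW.
exact: integral_normX_difference_quotient_le.
Qed.

Let dwE (E : set 'rV[R]_n) : lmeasurable E -> E `<=` K ->
  \int[mu]_(x in E) (dual_weight w x)%:E <= \int[mu]_(x in ball (0%R : 'rV[R]_n) N) (dual_weight w x)%:E.
Proof.
move=> mE EK; apply: ge0_subset_lebesgue_integral => //.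
- exact: lmeasurable_ball.
- exact: measurable_funS (lmeasurable_dual_weight mw).
- by move=> x _; exact: powR_ge0.
- exact: subset_trans KN.
Qed.

Lemma integral_difference_quotient_bounded : exists B : R, forall j (h : R),
  (0 < h <= h1)%R -> \int[mu]_(x in K) `|difference_quotient f j h x|%:E <= B%:E.
Proof.
pose S := \int[mu]_(x in ball (0%R : 'rV[R]_n) N) (dual_weight w x)%:E.
have Sfin : S \is a fin_num.
  rewrite ge0_fin_numE; first exact: dw_lty.
  by apply: integral_ge0 => x _; rewrite lee_fin powR_ge0.
exists (1 * C + 1 `^ (1 - n%:R)^-1 * fine S)%R => j h hh1.
apply: le_trans (young j mK (@subset_refl _ K) hh1 ltr01) _.
rewrite EFinD leeD2l// EFinM (fineK Sfin).
by apply: lee_wpmul2l; [rewrite lee_fin powR_ge0|exact: dwE].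
Qed.

(** In Young's inequality the choice of d makes the first term small for all
    steps h; then the second one is small by absolute continuity of the integral
    of the dual weight. *)
Lemma integral_difference_quotient_uniform (e : R) : (0 < e)%R ->
  exists2 d : R, (0 < d)%R &
  forall E : set 'rV[R]_n, lmeasurable E -> E `<=` K -> mu E < d%:E ->
  forall j (h : R), (0 < h <= h1)%R ->
    \int[mu]_(x in E) `|difference_quotient f j h x|%:E <= e%:E.
Proof.
move=> e0.
pose d := (e / (2 * (C + 1)))%R.
have C1 : (0 < C + 1)%R by rewrite ltr_wpDl.
have d0 : (0 < d)%R by rewrite divr_gt0// mulr_gt0.
have dC : (d * C <= e / 2)%R.
  rewrite /d mulrAC ler_pdivrMr ?mulr_gt0//.
  rewrite (_ : e / 2 * _ = e * (C + 1))%R; last by field.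
  by rewrite ler_pM2l// lerDl.
pose q := (d `^ (1 - n%:R)^-1)%R.
have q0 : (0 < q)%R by rewrite powR_gt0.
pose B0 := ball (0%R : 'rV[R]_n) N.
have mB0 : lmeasurable B0 by exact: lmeasurable_ball.
have mdw : lmeasurable_fun setT (dual_weight w) by exact: lmeasurable_dual_weight.
pose s := (dual_weight w) \_ B0.
have si : mu.-integrable setT (EFin \o s).
  rewrite /s -restrict_EFin -integrable_mkcond//.
  apply/integrableP; split; first by apply/measurable_EFinP; exact: measurable_funS mdw.
  have -> : \int[mu]_(x in B0) `|(EFin \o dual_weight w) x| =
      \int[mu]_(x in B0) (dual_weight w x)%:E.
    by apply: eq_integral => x _; rewrite /= ger0_norm// powR_ge0.
  exact: dw_lty.
have eq0 : (0 < e / (2 * q))%R by rewrite divr_gt0// mulr_gt0.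
have [d' [d'0 d'P]] := integral_normr_continuous si eq0.
exists d' => // E mE EK Ed j h hh1.
apply: le_trans (young j mE EK hh1 d0) _.
rewrite (_ : e%:E = (e / 2)%:E + (q * (e / (2 * q)))%:E); last first.
  rewrite -EFinD; congr EFin; field; exact: lt0r_neq0.
apply: leeD; first by rewrite lee_fin.
rewrite EFinM; apply: lee_wpmul2l; first by rewrite lee_fin ltW.
have sE : (\int[mu]_(x in E) `|s x|)%R = fine (\int[mu]_(x in E) (dual_weight w x)%:E).
  rewrite /Rintegral; congr fine; apply: eq_integral => x; rewrite inE => xE.
  by rewrite /s patchE ifT ?ger0_norm ?powR_ge0//; rewrite inE; exact/KN/EK.
have := d'P _ mE Ed; rewrite sE => /ltW; rewrite -lee_fin fineK//.
rewrite ge0_fin_numE; first by apply: le_lt_trans (dw_lty N); exact: dwE.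
by apply: integral_ge0 => x _; rewrite lee_fin powR_ge0.
Qed.

Lemma difference_quotient_density (U : set_system nat) (UU : UltraFilter U)
    (Uoo : forall A : set nat, (\forall k \near \oo, A k) -> U A) j :
  exists2 g : 'rV[R]_n -> R, mu.-integrable setT (EFin \o g) &
  forall E : set 'rV[R]_n, lmeasurable E -> E `<=` K ->
    (\int[mu]_(x in E) difference_quotient f j k.+1%:R^-1 x)%R @[k --> U] -->
    (\int[mu]_(x in E) g x)%R.
Proof.
have h1oo : \forall k \near \oo, (0 < k.+1%:R^-1 :> R)%R && (k.+1%:R^-1 <= h1)%R.
  have := near_infty_natSinv_lt (PosNum h10); apply: filterS => k /= kh.
  by rewrite invr_gt0 ltr0n/= ltW.
have [B BP] := integral_difference_quotient_bounded.
apply: (@ultralimit_density R n U UU Uoo K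
  (fun k => difference_quotient f j k.+1%:R^-1) B) => //.
- by apply: le_lt_trans (lebesgue_ball_lty (0%R : 'rV[R]_n) N); exact: le_lebesgue_outer.
- by move=> k; exact: lmeasurable_difference_quotient.
- by apply: filterS h1oo => k kh; exact: BP.
- move=> e e0; have [d d0 dP] := integral_difference_quotient_uniform e0.
  exists d => // E mE EK Ed; apply: filterS h1oo => k kh; exact: dP.
Qed.

End inner_set.
End difference_quotient_integrals.

(** * Increments of the integrals over a moving cube *)

(** A Dini-type mean value inequality, in which the increments to the right of
    each point are controlled for some arbitrarily small steps only. The points
    up to which the estimate holds have a supremum; the Lipschitz bound with the
    arbitrary constant B carries the estimate to this supremum, and one more
    step would go beyond it. *)
Lemma dini_mean_value_le (R : realType) (phi : R -> R) (t c B h1 : R) :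
  0 <= t -> 0 < h1 ->
  (forall a b, 0 <= a -> a <= b -> b <= t -> b - a <= h1 ->
     phi b - phi a <= B * (b - a)) ->
  (forall a, 0 <= a -> a < t -> forall e, 0 < e ->
     exists2 h, 0 < h < e & phi (a + h) - phi a <= c * h) ->
  phi t - phi 0 <= c * t.
Proof.
move=> t0 h10 lip step.
pose S := [set a | 0 <= a <= t /\ phi a - phi 0 <= c * a].
have S0 : S 0 by split; [rewrite lexx|rewrite subrr mulr0].
have hS : has_sup S.
  by split; [exists 0|exists t => a [/andP[]]].
pose s := sup S.
have s0 : 0 <= s by exact: ub_le_sup hS.2 _ S0.
have st : s <= t by apply: ge_sup => [|a [/andP[]]//]; exists 0.
have Ss : S s.
  split; first by rewrite s0.
  apply/ler_addgt0Pr => e e0.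
  pose L := `|B| + `|c| + 1.
  have L0 : 0 < L by rewrite ltr_wpDl// addr_ge0.
  pose d := Num.min h1 (e / L).
  have d0 : 0 < d by rewrite lt_min h10 divr_gt0.
  have [a Sa sa] := sup_adherent d0 hS.
  have as_ : a <= s by exact: ub_le_sup hS.2 _ Sa.
  have [/andP[a0 _] ac] := Sa.
  have sd : s - a <= d by rewrite -/s in sa; lra.
  have := lip _ _ a0 as_ st (le_trans sd _); rewrite ge_min lexx => /(_ isT) l1.
  have sde : (s - a) * L <= e.
    by rewrite -ler_pdivlMr// (le_trans sd)// ge_min lexx orbT.
  have sa0 : 0 <= s - a by rewrite subr_ge0.
  have : B * (s - a) <= `|B| * (s - a) by rewrite ler_wpM2r// ler_norm.
  have : - c * (s - a) <= `|c| * (s - a).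
    by rewrite ler_wpM2r// -normrN ler_norm.
  move: sde; rewrite /L !mulrDr mulr1 ![(s - a) * _]mulrC; lra.
have [ts|ts] := leP t s.
  have -> : t = s by apply/eqP; rewrite eq_le ts st.
  exact: Ss.2.
have ts0 : 0 < t - s by rewrite subr_gt0.
have [h /andP[h0 hts] hc] := step s s0 ts _ ts0.
suff : S (s + h) by move=> /(ub_le_sup hS.2); rewrite -/s; lra.
split; first by apply/andP; split; lra.
have := Ss.2; lra.
Qed.

Lemma dini_mean_value_norm_le (R : realType) (T : R -> R) (t G c B h1 : R) :
  0 <= t -> 0 < h1 ->
  (forall a b, 0 <= a -> a <= b -> b <= t -> b - a <= h1 ->
     `|T b - T a| <= B * (b - a)) ->
  (forall a, 0 <= a -> a < t -> forall e, 0 < e ->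
     exists2 h, 0 < h < e & `|T (a + h) - T a - h * G| <= c * h) ->
  `|T t - T 0 - t * G| <= c * t.
Proof.
move=> t0 h10 Tlip Tstep.
rewrite ler_norml; apply/andP; split.
- pose phi a := a * G - T a.
  suff : phi t - phi 0 <= c * t by rewrite /phi mul0r; lra.
  apply: (@dini_mean_value_le R phi t c (B + `|G|) h1) => // [a b a0 ab bt bah|a a0 at_ e e0].
    have := Tlip a b a0 ab bt bah; rewrite ler_norml => /andP[l1 l2].
    have : (b - a) * G <= (b - a) * `|G| by rewrite ler_wpM2l ?ler_norm// subr_ge0.
    rewrite /phi; lra.
  have [h hh] := Tstep a a0 at_ e e0; rewrite ler_norml => /andP[l1 l2].
  by exists h => //; rewrite /phi; lra.
- pose phi a := T a - a * G.
  suff : phi t - phi 0 <= c * t by rewrite /phi mul0r; lra.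
  apply: (@dini_mean_value_le R phi t c (B + `|G|) h1) => // [a b a0 ab bt bah|a a0 at_ e e0].
    have := Tlip a b a0 ab bt bah; rewrite ler_norml => /andP[l1 l2].
    have : - (b - a) * G <= (b - a) * `|G|.
      by rewrite mulNr -mulrN ler_wpM2l ?subr_ge0// -normrN ler_norm.
    rewrite /phi; lra.
  have [h hh] := Tstep a a0 at_ e e0; rewrite ler_norml => /andP[l1 l2].
  by exists h => //; rewrite /phi; lra.
Qed.

Section lebesgue_integrable.
Context {R : realType} {n : nat}.
Notation mu := (@lebesgue R n).
Implicit Types (D : set 'rV[R]_n) (u : 'rV[R]_n -> R).

Lemma lebesgue_integrable_lty D u : lmeasurable_fun D u ->
  (\int[mu]_(x in D) `|u x|%:E < +oo)%E -> mu.-integrable D (EFin \o u).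
Proof. by move=> mu_ uoo; apply/integrableP; split => //; exact/measurable_EFinP. Qed.

Lemma lebesgue_integrable_lty_of D u : mu.-integrable D (EFin \o u) ->
  (\int[mu]_(x in D) `|u x|%:E < +oo)%E.
Proof. by move=> /integrableP[]. Qed.

Lemma normr_Rintegral_le D u (B : R) : lmeasurable D -> lmeasurable_fun D u ->
  (\int[mu]_(x in D) `|u x|%:E <= B%:E)%E -> `|\int[mu]_(x in D) u x| <= B.
Proof.
move=> mD mu_ uB.
have uoo : (\int[mu]_(x in D) `|u x|%:E < +oo)%E by rewrite (le_lt_trans uB)// ltry.
apply: le_trans (le_normr_Rintegral mD (lebesgue_integrable_lty mu_ uoo)) _.
rewrite -lee_fin /Rintegral fineK// ge0_fin_numE//.
by apply: integral_ge0 => x _; rewrite lee_fin.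
Qed.

End lebesgue_integrable.

Section cube_increments.
Context {R : realType} {n : nat}.
Notation mu := (@lebesgue R n).
Variable f : 'rV[R]_n -> R.
Hypothesis mf : lmeasurable_fun setT f.

Let preimage_ball (q a : 'rV[R]_n) (s : R) :
  (fun x => x + a) @^-1` ball (q + a) s = ball q s.
Proof.
by apply/seteqP; split=> x /=; rewrite -!ball_normE/= opprD addrACA subrr addr0.
Qed.

Let integrable_ball_shift (q a : 'rV[R]_n) (s : R) :
  mu.-integrable (ball (q + a) s) (EFin \o f) ->
  mu.-integrable (ball q s) (EFin \o (fun x => f (x + a))).
Proof.
have mb : lmeasurable (ball (q + a) s) by exact: lmeasurable_ball.
have mfb : lmeasurable_fun (ball (q + a) s) f by exact: measurable_funS mf.
move=> /integrableP[_ fi]; apply/integrableP; split.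
  have := @lmeasurable_fun_shift R n _ f a mb mfb; rewrite preimage_ball => ?.
  exact/measurable_EFinP.
apply: le_lt_trans fi; rewrite -(@ge0_integral_shift _ _ (ball (q + a) s) (fun x => `|(f x)%:E|%E) a)//.
  by rewrite preimage_ball.
apply: (@measurableT_comp _ _ _ _ _ _ abse) => //.
exact/measurable_EFinP.
Qed.

Lemma Rintegral_ball_increment (q : 'rV[R]_n) j (h s : R) : h != 0 ->
  mu.-integrable (ball q s) (EFin \o f) ->
  mu.-integrable (ball (q + h *: delta_mx 0 j) s) (EFin \o f) ->
  \int[mu]_(x in ball (q + h *: delta_mx 0 j) s) f x - \int[mu]_(x in ball q s) f x =
  h * \int[mu]_(x in ball q s) difference_quotient f j h x.
Proof.
move=> h0 fq fqa.
have mb : lmeasurable (ball q s) by exact: lmeasurable_ball.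
have mba : lmeasurable (ball (q + h *: delta_mx 0 j) s) by exact: lmeasurable_ball.
have fa := integrable_ball_shift fqa.
have di : mu.-integrable (ball q s) (EFin \o (fun x => f (x + h *: delta_mx 0 j) - f x)).
  exact: (integrableB mb fa fq).
have -> : \int[mu]_(x in ball q s) difference_quotient f j h x =
    h^-1 * \int[mu]_(x in ball q s) (f (x + h *: delta_mx 0 j) - f x).
  exact: (@RintegralZl _ (lebesgue_space R n) R mu _ _ h^-1 mb di).
rewrite mulVKf// (RintegralB mb fa fq); congr (_ - _).
rewrite /Rintegral -(@integral_shift _ _ (ball (q + h *: delta_mx 0 j) s) (EFin \o f) (h *: delta_mx 0 j))//.
  by rewrite preimage_ball.
by apply/measurable_EFinP; exact: measurable_funS mf.
Qed.

Variables (U : set_system nat) (K : set 'rV[R]_n) (g : 'rV[R]_n -> R).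
Variables (j : 'I_n) (h1 B : R).
Context {UU : UltraFilter U}.
Hypothesis Uoo : forall A : set nat, (\forall k \near \oo, A k) -> U A.
Hypothesis ug : forall E : set 'rV[R]_n, lmeasurable E -> E `<=` K ->
  \int[mu]_(x in E) difference_quotient f j k.+1%:R^-1 x @[k --> U] -->
  \int[mu]_(x in E) g x.
Hypothesis h10 : 0 < h1.
Hypothesis mK : lmeasurable K.
Hypothesis uB : forall h, 0 < h <= h1 ->
  (\int[mu]_(x in K) `|difference_quotient f j h x|%:E <= B%:E)%E.

Let FU : ProperFilter U. Proof. exact: ultra_proper. Qed.

(** Moving the cube by h along an axis changes the integral of f by h times the
    integral of a difference quotient. The latter tends to the integral of g
    along the ultrafilter, hence is close to G for some arbitrarily small h, and
    the mean value inequality applies. *)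
Lemma Rintegral_ball_increment_le (p : 'rV[R]_n) (s t G c : R) : 0 <= t ->
  (forall a, 0 <= a <= t -> ball (p + a *: delta_mx 0 j) s `<=` K /\
     mu.-integrable (ball (p + a *: delta_mx 0 j) s) (EFin \o f)) ->
  (forall a, 0 <= a <= t ->
     `|\int[mu]_(x in ball (p + a *: delta_mx 0 j) s) g x - G| < c) ->
  `|\int[mu]_(x in ball (p + t *: delta_mx 0 j) s) f x - \int[mu]_(x in ball p s) f x - t * G| <= c * t.
Proof.
move=> t0 pK gc.
pose T a := \int[mu]_(x in ball (p + a *: delta_mx 0 j) s) f x.
have T0 : T 0 = \int[mu]_(x in ball p s) f x by rewrite /T scale0r addr0.
rewrite -T0 -/(T t).
have TE a h : 0 <= a -> 0 < h -> a + h <= t -> T (a + h) - T a =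
    h * \int[mu]_(x in ball (p + a *: delta_mx 0 j) s) difference_quotient f j h x.
  move=> a0 h0 aht; rewrite /T scalerDl addrA; apply: Rintegral_ball_increment.
  - by rewrite gt_eqF.
  - by apply: (pK _ _).2; rewrite a0; lra.
  - by rewrite -addrA -scalerDl; apply: (pK _ _).2; rewrite aht; lra.
have Tlip a b : 0 <= a -> a <= b -> b <= t -> b - a <= h1 -> `|T b - T a| <= B * (b - a).
  move=> a0; rewrite le_eqVlt => /predU1P[<- _ _|ab bt bah].
    by rewrite !subrr normr0 mulr0.
  have h0 : 0 < b - a by rewrite subr_gt0.
  have hh : 0 < b - a <= h1 by rewrite h0.
  have abE : a + (b - a) = b by rewrite addrC subrK.
  have := TE a (b - a) a0 h0; rewrite abE => ->; last exact: bt.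
  rewrite normrM (gtr0_norm h0) mulrC (ler_pM2r h0).
  have [aK _] := pK a ltac:(by rewrite a0; lra).
  have mb : lmeasurable (ball (p + a *: delta_mx 0 j) s) by exact: lmeasurable_ball.
  set Qa := ball (p + a *: delta_mx 0 j) s in aK mb *.
  have le1 : (\int[mu]_(x in Qa) `|difference_quotient f j (b - a) x|%:E <= B%:E)%E.
    apply: le_trans (uB hh); apply: (ge0_subset_lebesgue_integral mb mK _ _ aK).
      by apply: lmeasurable_norm; exact: lmeasurable_difference_quotient.
    by move=> x _; exact: normr_ge0.
  apply: (normr_Rintegral_le mb _ le1).
  exact: lmeasurable_difference_quotient.
have tri (x y z : R) : `|x - y| <= c - `|x - z| -> `|y - z| <= c.
  by have := ler_distD x y z; rewrite (distrC y x); lra.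
have Tstep a : 0 <= a -> a < t -> forall e, 0 < e ->
    exists2 h, 0 < h < e & `|T (a + h) - T a - h * G| <= c * h.
  move=> a0 at_ e e0.
  have att : 0 <= a <= t by rewrite a0; lra.
  have mb : lmeasurable (ball (p + a *: delta_mx 0 j) s) by exact: lmeasurable_ball.
  have := ug mb (pK a att).1.
  set I := \int[mu]_(x in _) g x => uI.
  have cI : 0 < c - `|I - G| by rewrite subr_gt0; exact: gc.
  have /cvgrPdist_le/(_ _ cI) Inear := uI.
  have e'0 : 0 < Num.min e (t - a) by rewrite lt_min e0 subr_gt0.
  have Unear : U [set k | k.+1%:R^-1 < Num.min e (t - a)].
    by apply: Uoo; exact: near_infty_natSinv_lt (PosNum e'0).
  have [k [/= kI]] := filter_ex (filterI Inear Unear).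
  set h := k.+1%:R^-1; rewrite lt_min => /andP[he hta].
  have h0 : 0 < h by rewrite invr_gt0 ltr0n.
  exists h; first by rewrite h0.
  rewrite (TE a h a0 h0); last lra.
  rewrite -mulrBr normrM (gtr0_norm h0) mulrC (ler_pM2r h0).
  exact: tri kI.
exact: dini_mean_value_norm_le Tlip Tstep.
Qed.

End cube_increments.

(** * Differentiability at good points *)

Definition lipschitz_points (R : realType) (n : nat) (f : 'rV[R]_n -> R) (M : nat) :=
  [set x : 'rV[R]_n | forall y, `|y - x| < M.+1%:R^-1 ->
    `|f y - f x| <= M.+1%:R * `|y - x|].

(** For x' in the set and close to x, the inequality from x' at the points x and
    y gives the inequality from x up to a small error. *)
Lemma closed_lipschitz_points (R : realType) (n : nat) (f : 'rV[R]_n -> R) (M : nat) :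
  closed (lipschitz_points f M).
Proof.
suff lipx (x : 'rV[R]_n) : closure (lipschitz_points f M) x -> lipschitz_points f M x.
  by move=> x; exact: lipx.
move=> xcl y yx; apply/ler_addgt0Pr => e e0.
set c : R := M.+1%:R in yx *.
have c0 : 0 < c by rewrite ltr0n.
pose d := Num.min (c^-1 - `|y - x|) (e / (2 * c)).
have d0 : 0 < d by rewrite lt_min subr_gt0 yx divr_gt0// mulr_gt0.
have dy : d <= c^-1 - `|y - x| by rewrite ge_min lexx.
have de : 2 * (c * d) <= e.
  have : d <= e / (2 * c) by rewrite ge_min lexx orbT.
  by rewrite ler_pdivlMr ?mulr_gt0//; lra.
have [x' x'M xx'] : exists2 x' : 'rV[R]_n, lipschitz_points f M x' & `|x - x'| < d.
  by have [x' [x'M]] := xcl _ (nbhsx_ballx x d d0); rewrite -ball_normE/=; exists x'.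
have yx' : `|y - x'| < `|y - x| + d by rewrite (le_lt_trans (ler_distD x _ _))// ltrD2l.
have hy : `|y - x'| < M.+1%:R^-1 by rewrite (lt_le_trans yx')// addrC -lerBrDr.
have hx : `|x - x'| < M.+1%:R^-1 by rewrite (lt_le_trans xx')// (le_trans dy)// gerBl.
have := x'M y hy; have := x'M x hx; rewrite -/c.
have := ler_distD (f x') (f y) (f x); rewrite [`|f x' - _|]distrC.
have : c * `|y - x'| <= c * (`|y - x| + d) by rewrite ler_pM2l// ltW.
have : c * `|x - x'| <= c * d by rewrite ler_pM2l// ltW.
rewrite mulrDr; lra.
Qed.

Section averages.
Context {R : realType} {n : nat}.
Notation mu := (@lebesgue R n).
Implicit Types (D : set 'rV[R]_n) (u : 'rV[R]_n -> R).

Lemma lebesgue_ball_shift (q : 'rV[R]_n) (s : R) :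
  mu (ball q s) = mu (ball (0 : 'rV[R]_n) s).
Proof.
rewrite /lebesgue -(lebesgue_outer_shift (ball q s) q); congr lebesgue_outer.
by apply/seteqP; split=> x /=; rewrite -!ball_normE/= opprD addrCA subrr addr0 sub0r.
Qed.

Lemma lebesgue_integrableS D u : lmeasurable D ->
  mu.-integrable setT (EFin \o u) -> mu.-integrable D (EFin \o u).
Proof. by move=> mD; exact: (integrableS measurableT mD (@subsetT _ D)). Qed.

Lemma lmeasurable_normB_cst D u (a : R) :
  lmeasurable_fun setT u -> lmeasurable_fun D (fun x => `|u x - a|).
Proof.
move=> mu_; apply: lmeasurable_norm; apply: measurable_funB; last exact: measurable_cst.
exact: measurable_funS mu_.
Qed.

Lemma bounded_lebesgue_integrable D u (A : R) : lmeasurable D ->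
  (mu D < +oo)%E -> lmeasurable_fun D u -> (forall x, D x -> `|u x| <= A) ->
  mu.-integrable D (EFin \o u).
Proof.
move=> mD Doo mu_ uA; apply: lebesgue_integrable_lty => //.
have [->|/set0P[x Dx]] := eqVneq D set0.
  by rewrite integral_set0 ltry.
have A0 : 0 <= A by exact: le_trans (uA x Dx).
apply: (@le_lt_trans _ _ (\int[mu]_(x in D) A%:E)%E).
  apply: (ge0_le_lebesgue_integral mD _ _ _ uA).
  - exact: lmeasurable_norm.
  - exact: measurable_cst.
  - by move=> y _; exact: normr_ge0.
by rewrite lebesgue_integral_cst// lte_mul_pinfty ?lee_fin.
Qed.

Lemma Rintegral_sub_cst_le D u (a A : R) : lmeasurable D -> (mu D < +oo)%E ->
  mu.-integrable D (EFin \o u) ->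
  (\int[mu]_(x in D) `|u x - a|%:E <= A%:E)%E ->
  `|\int[mu]_(x in D) u x - a * fine (mu D)| <= A.
Proof.
move=> mD Doo ui uA.
have mu_ : lmeasurable_fun D u by move/integrableP : ui => [/measurable_EFinP].
have ai : mu.-integrable D (EFin \o cst a).
  by apply: (@bounded_lebesgue_integrable D (cst a) `|a|) => //; exact: measurable_cst.
have := RintegralB mD ui ai.
rewrite (Rintegral_cst _ mD) => <-; apply: normr_Rintegral_le => //.
by apply: measurable_funB => //; exact: measurable_cst.
Qed.

Lemma Rintegral_approx_le D u (a A : R) : lmeasurable D -> (mu D < +oo)%E ->
  mu.-integrable D (EFin \o u) -> (forall x, D x -> `|u x - a| <= A) ->
  `|\int[mu]_(x in D) u x - a * fine (mu D)| <= A * fine (mu D).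
Proof.
move=> mD Doo ui uA; apply: Rintegral_sub_cst_le => //.
have mu_ : lmeasurable_fun D u by move/integrableP : ui => [/measurable_EFinP].
have mua : lmeasurable_fun D (fun x => u x - a).
  by apply: measurable_funB => //; exact: measurable_cst.
rewrite EFinM fineK ?ge0_fin_numE// -lebesgue_integral_cst//.
apply: (ge0_le_lebesgue_integral mD _ _ _ uA).
- exact: lmeasurable_norm.
- exact: measurable_cst.
- by move=> y _; exact: normr_ge0.
Qed.

End averages.

Lemma differentiable_linear_approx (R : realType) (n : nat) (f : 'rV[R]_n -> R)
    (x : 'rV[R]_n) (a : 'I_n -> R) :
  (forall e : R, 0 < e -> exists2 d : R, 0 < d & forall z, `|z| < d ->
    `|f (x + z) - f x - \sum_j z 0 j * a j| <= e * `|z|) ->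
  differentiable f x.
Proof.
move=> fa.
pose L (z : 'rV[R]_n) : R := \sum_j z 0 j * a j.
have Llin : linear (L : 'rV[R]_n -> R^o).
  move=> c y z; rewrite /L scaler_sumr -big_split/=; apply: eq_bigr => j _.
  by rewrite !mxE mulrDl; congr (_ + _); rewrite -mulrA.
pose df : {linear 'rV[R]_n -> R^o} := HB.pack L (GRing.isLinear.Build R 'rV[R]_n R^o _ L Llin).
have cdf : continuous df.
  move=> z; rewrite /df/= /L.
  have FF : Filter (nbhs z) by exact: nbhs_filter.
  apply: cvg_big => [|j _]; first exact: add_continuous.
  by apply: cvgMl; exact: coord_continuous.
have dE := @diff_unique R 'rV[R]_n R^o f df x cdf.
lazymatch type of dE with ?P -> _ => have fdf : P end.
  apply/eqaddoP => _/posnumP[e].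
  have [d d0 dP] := fa e%:num ltac:(by []).
  apply/nbhs_ballP; exists d => //= z; rewrite -ball_normE/= sub0r normrN => zd.
  change (`|f (z + x) - (f x + L z)| <= e%:num * `|z|).
  by rewrite opprD addrA [z + x]addrC; exact: dP.
by apply/diff_locallyP; rewrite (dE fdf).
Qed.

Section good_points.
Context {R : realType} {n : nat}.
Notation mu := (@lebesgue R n).
Variables (f : 'rV[R]_n -> R) (U : set_system nat) (K : set 'rV[R]_n).
Variables (g : 'I_n -> 'rV[R]_n -> R) (h1 B : R).
Context {UU : UltraFilter U}.
Hypothesis n_gt0 : (0 < n)%N.
Hypothesis mf : lmeasurable_fun setT f.
Hypothesis Uoo : forall A : set nat, (\forall k \near \oo, A k) -> U A.
Hypothesis ug : forall j (E : set 'rV[R]_n), lmeasurable E -> E `<=` K ->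
  \int[mu]_(x in E) difference_quotient f j k.+1%:R^-1 x @[k --> U] -->
  \int[mu]_(x in E) g j x.
Hypothesis gi : forall j, mu.-integrable setT (EFin \o g j).
Hypothesis h10 : 0 < h1.
Hypothesis mK : lmeasurable K.
Hypothesis uB : forall j h, 0 < h <= h1 ->
  (\int[mu]_(x in K) `|difference_quotient f j h x|%:E <= B%:E)%E.

Variables (x0 : 'rV[R]_n) (M : nat).
Hypothesis lipx0 : lipschitz_points f M x0.
Hypothesis K_nbhs : nbhs x0 K.
Hypothesis density : forall e : R, 0 < e -> exists2 d : R, 0 < d &
  forall r : R, 0 < r < d ->
    (\int[mu]_(y in ball x0 r) (\1_(~` lipschitz_points f M) y)%:E <= (e * r ^+ n)%:E)%E.
Hypothesis lebesgue_point : forall j (e : R), 0 < e -> exists2 d : R, 0 < d &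
  forall r : R, 0 < r < d ->
    (\int[mu]_(y in ball x0 r) `|g j y - g j x0|%:E <= (e * r ^+ n)%:E)%E.

Let near_pt (r : R) : set 'rV[R]_n := [set q | forall i, `|q 0 i - x0 0 i| <= r].

Let ball_near (r s : R) q : 0 < s -> s <= r -> near_pt r q ->
  ball q s `<=` ball x0 (2 * r).
Proof.
move=> s0 sr qr y [_ ys]; split; first lra.
move=> i j; rewrite (ord1 i); have := ys 0 j; have := qr j.
rewrite /ball/= !ltr_norml !ler_norml => /andP[? ?] /andP[? ?].
apply/andP; split; lra.
Qed.

Let near_segment (r a t : R) q j : near_pt r q -> near_pt r (q + t *: delta_mx 0 j) ->
  0 <= a <= t -> near_pt r (q + a *: delta_mx 0 j).
Proof.
move=> q1 q2 /andP[a0 at_] i; have := q1 i; have := q2 i; rewrite !mxE/=.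
case: eqP => _ /=; rewrite ?mulr0 ?addr0// !mulr1 !ler_norml => /andP[? ?] /andP[? ?].
apply/andP; split; lra.
Qed.

Let m (s : R) : R := fine (mu (ball (0 : 'rV[R]_n) s)).

Let T (s : R) q : R := \int[mu]_(x in ball q s) f x.

Let f_bounded (r : R) x : 2 * r < M.+1%:R^-1 -> ball x0 (2 * r) x -> `|f x| <= `|f x0| + 1.
Proof.
move=> rM; rewrite -ball_normE/= distrC => xr.
have xM : `|x - x0| < M.+1%:R^-1 by exact: lt_trans rM.
have M0 : 0 < M.+1%:R :> R by rewrite ltr0n.
have : M.+1%:R * `|x - x0| <= 1 by rewrite mulrC -ler_pdivlMr// mul1r ltW.
have := lipx0 xM; have := ler_normD (f x - f x0) (f x0); rewrite subrK; lra.
Qed.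

Let f_integrable (r s : R) q : 0 < s -> s <= r -> 2 * r < M.+1%:R^-1 -> near_pt r q ->
  mu.-integrable (ball q s) (EFin \o f).
Proof.
move=> s0 sr rM qr; apply: (@bounded_lebesgue_integrable _ _ _ _ (`|f x0| + 1)).
- exact: lmeasurable_ball.
- exact: lebesgue_ball_lty.
- exact: measurable_funS mf.
- by move=> x /(ball_near s0 sr qr); exact: f_bounded.
Qed.

Let step_nonneg (r s t c : R) q j : 0 < s -> s <= r -> 2 * r < M.+1%:R^-1 ->
  ball x0 (2 * r) `<=` K -> 0 <= t ->
  near_pt r q -> near_pt r (q + t *: delta_mx 0 j) ->
  (\int[mu]_(y in ball x0 (2 * r)) `|g j y - g j x0|%:E < c%:E)%E ->
  `|T s (q + t *: delta_mx 0 j) - T s q - t * (g j x0 * m s)| <= c * t.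
Proof.
move=> s0 sr rM rK t0 q1 q2 gc.
have near_a a : 0 <= a <= t -> near_pt r (q + a *: delta_mx 0 j) by exact: near_segment.
have H := @Rintegral_ball_increment_le _ _ f mf U K (g j) j h1 B UU Uoo (@ug j) h10 mK (uB j) q s t (g j x0 * m s) c t0.
apply: H.
  move=> a /near_a qa; split; first exact: subset_trans (ball_near s0 sr qa) rK.
  exact: f_integrable qa.
move=> a /near_a qa.
have mg : lmeasurable_fun setT (g j) by move/integrableP : (gi j) => [/measurable_EFinP].
set D := ball _ s.
have mD : lmeasurable D by exact: lmeasurable_ball.
have Doo : (mu D < +oo)%E by exact: lebesgue_ball_lty.
have mE : m s = fine (mu D) by rewrite /m -(lebesgue_ball_shift (q + a *: delta_mx 0 j)).
have giD : mu.-integrable D (EFin \o g j) by exact: lebesgue_integrableS mD (gi j).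
have mgc : lmeasurable_fun (ball x0 (2 * r)) (fun y => `|g j y - g j x0|).
  exact: lmeasurable_normB_cst mg.
have gD : (\int[mu]_(y in D) `|g j y - g j x0|%:E <=
           \int[mu]_(y in ball x0 (2 * r)) `|g j y - g j x0|%:E)%E.
  apply: (ge0_subset_lebesgue_integral mD (lmeasurable_ball _ _) mgc).
    by move=> y _; exact: normr_ge0.
  exact: ball_near.
have gfin : (\int[mu]_(y in ball x0 (2 * r)) `|g j y - g j x0|%:E)%E \is a fin_num.
  rewrite ge0_fin_numE; first by apply: lt_trans gc _; exact: ltry.
  by apply: integral_ge0 => x _; rewrite lee_fin.
rewrite mE; apply: (@le_lt_trans _ _ (fine (\int[mu]_(y in ball x0 (2 * r)) `|g j y - g j x0|%:E)%E)).
  by apply: (Rintegral_sub_cst_le mD Doo giD); rewrite (fineK gfin); exact: gD.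
by rewrite -lte_fin (fineK gfin).
Qed.

Let step (r s t c : R) q j : 0 < s -> s <= r -> 2 * r < M.+1%:R^-1 ->
  ball x0 (2 * r) `<=` K ->
  near_pt r q -> near_pt r (q + t *: delta_mx 0 j) ->
  (\int[mu]_(y in ball x0 (2 * r)) `|g j y - g j x0|%:E < c%:E)%E ->
  `|T s (q + t *: delta_mx 0 j) - T s q - t * (g j x0 * m s)| <= c * `|t|.
Proof.
move=> s0 sr rM rK q1 q2 gc; have [t0|t0] := leP 0 t.
  by rewrite (ger0_norm t0); exact: (step_nonneg s0 sr rM rK t0 q1 q2 gc).
have qE : q + t *: delta_mx 0 j + (- t) *: delta_mx 0 j = q.
  by rewrite -addrA -scalerDl subrr scale0r addr0.
have := @step_nonneg r s (- t) c (q + t *: delta_mx 0 j) j s0 sr rM rK.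
rewrite qE oppr_ge0 => /(_ (ltW t0) q2 q1 gc).
have flip (A A' G : R) : `|A - A' - t * G| = `|A' - A - - t * G|.
  by rewrite -normrN; congr (`|_|); ring.
by rewrite (ltr0_norm t0) flip.
Qed.

Let telescope_step (a b d S y y' l k c : R) :
  `|b - d - S * l| <= k * c -> `|a - b - y * (y' * l)| <= c ->
  `|a - d - (S + y * y') * l| <= (k + 1) * c.
Proof.
have -> : a - d - (S + y * y') * l = (b - d - S * l) + (a - b - y * (y' * l)) by ring.
move=> bS ab; rewrite (le_trans (ler_normD _ _))//; lra.
Qed.

(** The path from x0 to x0 + z follows the axes: p k has the first k coordinates
    of x0 + z and the other ones of x0. *)
Let telescope (r s c : R) (z : 'rV[R]_n) : 0 < s -> s <= r -> 2 * r < M.+1%:R^-1 ->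
  ball x0 (2 * r) `<=` K -> (forall i, `|z 0 i| <= r) ->
  (forall j, (\int[mu]_(y in ball x0 (2 * r)) `|g j y - g j x0|%:E < c%:E)%E) ->
  `|T s (x0 + z) - T s x0 - (\sum_j z 0 j * g j x0) * m s| <= n%:R * (c * r).
Proof.
move=> s0 sr rM rK zr gc.
have r0 : 0 < r by exact: lt_le_trans sr.
pose p k : 'rV[R]_n := \row_i (x0 0 i + if (i < k)%N then z 0 i else 0).
pose F k : R := if insub k is Some j then z 0 j * g j x0 else 0.
have p0 : p 0%N = x0 by apply/rowP => i; rewrite mxE addr0.
have pn : p n = x0 + z by apply/rowP => i; rewrite !mxE ltn_ord.
have Fn : \sum_j z 0 j * g j x0 = \sum_(k < n) F k.
  by apply: eq_bigr => j _; rewrite /F valK.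
have near_p k : near_pt r (p k).
  move=> i; rewrite mxE addrAC subrr add0r; case: ifP => _ //.
  by rewrite normr0 ltW.
rewrite -pn -[in T s x0]p0 Fn.
have c0 : 0 <= c.
  have := gc (Ordinal n_gt0); rewrite -lee_fin => /ltW; apply: le_trans.
  by apply: integral_ge0 => x _; rewrite lee_fin.
suff H k : (k <= n)%N ->
    `|T s (p k) - T s (p 0%N) - (\sum_(i < k) F i) * m s| <= k%:R * (c * r) by exact: H.
elim: k => [_|k ih kn].
  by rewrite big_ord0 mul0r !subrr normr0 mul0r.
pose j := Ordinal kn.
have pS : p k.+1 = p k + z 0 j *: delta_mx 0 j.
  apply/rowP => i; rewrite !mxE ltnS -addrA; congr (_ + _).
  rewrite leq_eqVlt; have [ij|ij] := eqVneq i j.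
    by rewrite ij /= eqxx ltnn mulr1 add0r.
  rewrite andbF mulr0 addr0 (_ : (nat_of_ord i == k) = false)//.
  by apply: contraNF ij => /eqP ik; apply/eqP/val_inj.
have Fk : F k = z 0 j * g j x0.
  by rewrite /F -[k in insub k]/(val j) valK.
have pj : near_pt r (p k + z 0 j *: delta_mx 0 j) by rewrite -pS.
have := step s0 sr rM rK (near_p k) pj (gc j); rewrite -pS => st.
have zc : c * `|z 0 j| <= c * r by rewrite ler_wpM2l.
have := ih (ltnW kn).
rewrite big_ord_recr/= -natr1 Fk.
move=> ih'; exact: telescope_step ih' (le_trans st zc).
Qed.

(** Let r = |z| and let T q be the integral of f over the cube of half-side
    s = de r around q, where de is small but fixed. From x0 to x0 + z, moving
    along the axes, T changes by m s times the sum of the z_j g_j(x0), up to an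
    error that is small compared with r^(n+1), and m s >= de^n r^n. On the cube
    around x0, f differs from f x0 by at most (M + 1) s. The cube around x0 + z
    contains a point that is Lipschitz with the same constant, for otherwise the
    density of these points at x0 would be smaller than 1; hence f is also close
    to f (x0 + z) on that cube. These last two errors are small multiples of r. *)
Lemma differentiable_good_point : differentiable f x0.
Proof.
apply: (@differentiable_linear_approx R n f x0 (fun j => g j x0)) => rho rho0.
have M0 : 0 < M.+1%:R :> R by rewrite ltr0n.
have nn0 : 0 < n%:R :> R by rewrite ltr0n.
(* de makes the Lipschitz errors at most rho r / 2, and e does the same for the
   error along the axes; eta (2 r)^n is half of the lower bound s^n for the
   volume of a cube of half-side s. *)
pose de := Num.min 1 (rho / (8 * M.+1%:R)).
have de0 : 0 < de by rewrite lt_min ltr01/= divr_gt0// mulr_gt0.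
have de1 : de <= 1 by rewrite ge_min lexx.
have deM : 4 * M.+1%:R * de <= rho / 2.
  have : de <= rho / (8 * M.+1%:R) by rewrite ge_min lexx orbT.
  rewrite ler_pdivlMr ?mulr_gt0//; lra.
have den0 : 0 < de ^+ n by rewrite exprn_gt0.
have tn0 : 0 < 2 ^+ n :> R by rewrite exprn_gt0.
pose e := rho * de ^+ n / (4 * n%:R * 2 ^+ n).
have e0 : 0 < e by rewrite divr_gt0 ?mulr_gt0.
pose eta := de ^+ n / (2 * 2 ^+ n).
have eta0 : 0 < eta by rewrite divr_gt0 ?mulr_gt0.
have [d1 d10 d1P] := density eta0.
have [dl dl0 dlP] : exists2 d : R, 0 < d & forall j r, 0 < r < d ->
    (\int[mu]_(y in ball x0 r) `|g j y - g j x0|%:E <= (e * r ^+ n)%:E)%E.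
  pose dj j := sval (cid2 (lebesgue_point j e0)).
  exists (\big[Num.min/1]_j dj j).
    apply: (big_ind (fun t => 0 < t)) => //; first by move=> x y; rewrite lt_min => -> ->.
    by move=> j _; rewrite /dj; case: cid2.
  move=> j r /andP[r0 rd]; have : r < dj j by apply: lt_le_trans rd _; exact: bigmin_le.
  by rewrite /dj; case: cid2 => d /= _ + rd'; apply; rewrite r0.
have /nbhs_ballP[dK /= dK0 dKP] := K_nbhs.
pose d := Num.min (Num.min d1 dl) (Num.min dK M.+1%:R^-1).
have d0 : 0 < d by rewrite !lt_min d10 dl0 dK0 invr_gt0.
exists (d / 2); first by rewrite divr_gt0.
move=> z zd; set r := `|z|.
have [z0|z0] := eqVneq z 0.
  rewrite /r z0 addr0 subrr normr0 mulr0 sub0r normrN big1 ?normr0// => j _.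
  by rewrite mxE mul0r.
have r0 : 0 < r by rewrite normr_gt0.
have rd : 2 * r < d by rewrite /r; move: zd; rewrite ltr_pdivlMr// mulrC.
move: rd; rewrite /d !lt_min => /andP[/andP[rd1 rdl] /andP[rdK rdM]].
have r20 : 0 < 2 * r by rewrite mulr_gt0.
pose s := de * r.
have s0 : 0 < s by rewrite mulr_gt0.
have sr : s <= r by rewrite /s ler_piMl// ltW.
have rK : ball x0 (2 * r) `<=` K by apply: subset_trans dKP; apply: le_ball; exact: ltW.
have zr i : `|z 0 i| <= r by exact: ler_coord_norm.
pose c := 2 * (e * (2 * r) ^+ n).
have r2n : 0 < (2 * r) ^+ n by rewrite exprn_gt0.
have gc j : (\int[mu]_(y in ball x0 (2 * r)) `|g j y - g j x0|%:E < c%:E)%E.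
  apply: le_lt_trans (dlP j (2 * r) _) _; first by rewrite r20.
  by rewrite lte_fin /c ltr_pMl ?ltr1n// mulr_gt0.
have := telescope s0 sr rdM rK zr gc.
have mball q : fine (mu (ball q s)) = m s by rewrite /m (lebesgue_ball_shift q).
have ms : s ^+ n <= m s.
  rewrite -lee_fin /m fineK ?ge0_fin_numE ?lebesgue_ball_lty//.
  exact: lebesgue_ball_ge.
have ms0 : 0 < m s by apply: lt_le_trans ms; rewrite exprn_gt0.
have near_z : near_pt r (x0 + z).
  by move=> i; rewrite mxE addrAC subrr add0r.
have near_0 : near_pt r x0 by move=> i; rewrite subrr normr0 ltW.
have A1 : `|T s x0 - f x0 * m s| <= M.+1%:R * s * m s.
  rewrite /T -(mball x0); apply: Rintegral_approx_le.
  - exact: lmeasurable_ball.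
  - exact: lebesgue_ball_lty.
  - exact: f_integrable near_0.
  - move=> y; rewrite -ball_normE/= distrC => ys.
    have : `|y - x0| < M.+1%:R^-1 by apply: lt_trans rdM; lra.
    move=> /lipx0 /le_trans; apply; rewrite ler_pM2l//; exact: ltW.
have [q qL qs] : exists2 q, lipschitz_points f M q & ball (x0 + z) s q.
  apply: contrapT => nq.
  have zL : ball (x0 + z) s `<=` ~` lipschitz_points f M by move=> y ys yL; apply: nq; exists y.
  have : ((s ^+ n)%:E <= (eta * (2 * r) ^+ n)%:E)%E.
    apply: le_trans (d1P (2 * r) _); last by rewrite r20.
    apply: le_trans (lebesgue_ball_ge (x0 + z) s0) _.
    rewrite integral_indic; last 2 first.
    - exact: lmeasurable_ball.
    - exact/measurableC/closed_lmeasurable/closed_lipschitz_points.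
    apply: le_lebesgue_outer => y ys; split; first exact: zL.
    exact: ball_near near_z _ ys.
  rewrite lee_fin /s !exprMn /eta.
  have -> : de ^+ n / (2 * 2 ^+ n) * (2 ^+ n * r ^+ n) = de ^+ n * r ^+ n / 2.
    by field; exact: lt0r_neq0.
  have : 0 < de ^+ n * r ^+ n by rewrite mulr_gt0// exprn_gt0.
  lra.
(* The Lipschitz point q is at distance less than s from x0 + z, hence less
   than 2 s from all points of the cube. *)
have A2 : `|T s (x0 + z) - f (x0 + z) * m s| <= 3 * M.+1%:R * s * m s.
  rewrite /T -(mball (x0 + z)); apply: Rintegral_approx_le.
  - exact: lmeasurable_ball.
  - exact: lebesgue_ball_lty.
  - exact: f_integrable near_z.
  - move=> y; rewrite -ball_normE/= distrC => ys.
    move: qs; rewrite -ball_normE/= => qs.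
    have yq : `|y - q| < 2 * s.
      by rewrite (le_lt_trans (ler_distD (x0 + z) _ _))//; lra.
    have l1 := qL y (lt_trans yq (le_lt_trans _ rdM)).
    have l2 := qL (x0 + z) (lt_trans qs (le_lt_trans _ rdM)).
    have := ler_distD (f q) (f y) (f (x0 + z)).
    rewrite [`|f q - _|]distrC.
    have : M.+1%:R * `|y - q| <= M.+1%:R * (2 * s) by rewrite ler_pM2l// ltW.
    have : M.+1%:R * `|x0 + z - q| <= M.+1%:R * s by rewrite ler_pM2l// ltW.
    have := l1 ltac:(lra); have := l2 ltac:(lra); lra.
set S := \sum_j _ => tele.
rewrite -(ler_pM2r ms0).
have c_le : n%:R * (c * r) <= rho / 2 * r * m s.
  apply: (@le_trans _ _ (rho / 2 * r * s ^+ n)).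
    rewrite /c /e /s !exprMn le_eqVlt; apply/orP; left; apply/eqP.
    by field; rewrite !lt0r_neq0.
  by rewrite ler_wpM2l// mulr_ge0// ltW// divr_gt0.
have s_le : 4 * M.+1%:R * s * m s <= rho / 2 * r * m s.
  rewrite ler_pM2r// /s mulrA ler_pM2r//.
rewrite -{1}(gtr0_norm ms0) -normrM !mulrBl.
move: A1 A2 tele c_le s_le.
set X := f (x0 + z) * m s; set Y := f x0 * m s; set Z := S * m s.
set P := T s (x0 + z); set Q := T s x0.
have -> : X - Y - Z = (P - Q - Z) - (P - X) + (Q - Y) by ring.
move=> A1 A2 tele c_le s_le.
have n1 := ler_normD (P - Q - Z - (P - X)) (Q - Y).
have n2 := ler_normB (P - Q - Z) (P - X).
have e1 : 3 * M.+1%:R * s * m s + M.+1%:R * s * m s = 4 * M.+1%:R * s * m s by ring.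
have e2 : rho / 2 * r * m s + rho / 2 * r * m s = rho * r * m s by field.
move: (rho / 2 * r * m s) (3 * M.+1%:R * s * m s) (M.+1%:R * s * m s) (4 * M.+1%:R * s * m s)
  (rho * r * m s) (n%:R * (c * r)) A1 A2 tele c_le s_le e1 e2 n1 n2.
by move=> *; lra.
Qed.

End good_points.

(** * Differentiability almost everywhere *)

Section almost_everywhere_conjunction.
Context {R : realType} {n : nat}.
Notation mu := (@lebesgue R n).

Lemma ae_and (P Q : 'rV[R]_n -> Prop) : {ae mu, forall x, P x} ->
  {ae mu, forall x, Q x} -> {ae mu, forall x, P x /\ Q x}.
Proof.
move=> aeP aeQ; apply: (@ae_notin_negligible _ _ (~` P `|` ~` Q)).
  exact: negligibleU.
by move=> x nPQ; have [Px|nPx] := pselect (P x); [right => Qx; exact: nPQ|left].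
Qed.

Lemma ae_forall_countable (I : countType) (P : I -> 'rV[R]_n -> Prop) :
  (forall i, {ae mu, forall x, P i x}) -> {ae mu, forall x, forall i, P i x}.
Proof.
move=> aeP; pose Q k x := if unpickle k is Some i then P i x else True.
have aeQ : {ae mu, forall x, forall k, Q k x}.
  apply: ae_foralln => k; rewrite /Q; case: (unpickle k) => [i|]; first exact: aeP.
  exact: aeW.
by apply: ae_imply aeQ => x Qx i; have := Qx (pickle i); rewrite /Q pickleK.
Qed.

End almost_everywhere_conjunction.

Section almost_everywhere_differentiability.
Context {R : realType} {n : nat}.
Variables (Omega : set 'rV[R]_n) (w f : 'rV[R]_n -> R) (v : R).
Notation mu := (@lebesgue R n).
Hypothesis n2 : (2 <= n)%N.
Hypothesis oO : open Omega.
Hypothesis w0 : forall x, 0 <= w x.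
Hypothesis mw : lmeasurable_fun setT w.
Hypothesis wpos : {ae mu, forall x, 0 < w x}.
Hypothesis dw_lty : forall r,
  (\int[mu]_(x in ball (0%R : 'rV[R]_n) r) (dual_weight w x)%:E < +oo)%E.
Hypothesis mf : lmeasurable_fun setT f.
Hypothesis fv : (riesz_variation Omega w f <= v%:E)%E.

Let n_gt0 : (0 < n)%N. Proof. exact: ltnW. Qed.

(** An exhaustion of Omega by bounded open sets that keep a positive distance
    from the complement, as difference quotients need room around a point. *)
Definition inner_part (m : nat) : set 'rV[R]_n :=
  interior ([set x | ball x m.+1%:R^-1 `<=` Omega] `&` ball (0 : 'rV[R]_n) m.+1%:R).

Let step m : R := m.+1%:R^-1 / (4 * n%:R).

Lemma inner_part_nbhs x : Omega x -> exists m, nbhs x (inner_part m).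
Proof.
move=> Ox; have /nbhs_ballP[d /= d0 dO] : nbhs x Omega by exact: open_nbhs_nbhs.
pose m := Num.bound (Num.max (`|x| + 1) (2 / d)).
have b0 : 0 <= Num.max (`|x| + 1) (2 / d) by rewrite le_max addr_ge0.
have mb : Num.max (`|x| + 1) (2 / d) < m.+1%:R.
  by apply: lt_trans (archi_boundP b0) _; rewrite ltr_nat.
have m0 : 0 < m.+1%:R :> R by rewrite ltr0n.
move: mb; rewrite gt_max => /andP[xm dm].
have md : m.+1%:R^-1 <= d / 2.
  rewrite -[leRHS]invrK lef_pV2 ?posrE ?invr_gt0 ?divr_gt0//.
  by rewrite invf_div ltW.
exists m; apply: nbhs_interior.
have e0 : 0 < Num.min 1 (d / 2) by rewrite lt_min ltr01 divr_gt0.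
apply/nbhs_ballP; exists (Num.min 1 (d / 2)) => //= y.
rewrite -ball_normE/= lt_min => /andP[xy1 xyd]; split.
  move=> z /= yz; apply: dO; rewrite -ball_normE/=.
  rewrite (le_lt_trans (ler_distD y _ _))// (splitr d) ltrD//.
  exact: lt_le_trans md.
rewrite sub0r normrN; apply: lt_trans xm.
have := ler_normB x (x - y); rewrite opprB addrC subrK; lra.
Qed.

Lemma inner_part_lmeasurable m : lmeasurable (inner_part m).
Proof. exact/open_lmeasurable/open_interior. Qed.

Lemma inner_part_ball m : inner_part m `<=` ball (0 : 'rV[R]_n) m.+1%:R.
Proof. by move=> x /interior_subset[]. Qed.

Let step_gt0 m : 0 < step m.
Proof. by rewrite divr_gt0 ?invr_gt0 ?mulr_gt0 ?ltr0n. Qed.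

Let inner_part_sub m x : inner_part m x -> ball x (4 * n%:R * step m) `<=` Omega.
Proof.
move=> /interior_subset[xO _]; rewrite /step mulrC divfK//.
by rewrite mulf_neq0// pnatr_eq0 -lt0n.
Qed.

Let lipschitz_density M : {ae mu, forall x, lipschitz_points f M x ->
  forall e : R, 0 < e -> exists2 d : R, 0 < d &
  forall r : R, 0 < r < d ->
    (\int[mu]_(y in ball x r) (\1_(~` lipschitz_points f M) y)%:E <= (e * r ^+ n)%:E)%E}.
Proof.
set L := lipschitz_points f M.
have mL : lmeasurable L by exact/closed_lmeasurable/closed_lipschitz_points.
have mI : lmeasurable_fun setT (\1_(~` L) : 'rV[R]_n -> R).
  exact/measurable_indic/measurableC.
apply: (ae_vanishing_average mL mI).
- by move=> x; rewrite indicE; case: (_ \in _).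
- move=> r; rewrite integral_indic; last 2 first.
  + exact: lmeasurable_ball.
  + exact: measurableC.
  by apply: le_lt_trans (lebesgue_ball_lty (0 : 'rV[R]_n) r); apply: le_lebesgue_outer.
- by move=> x Lx; rewrite indicE memNset.
Qed.

(** Almost every point of Omega belongs to some set lipschitz_points f M, is a
    density point of this set, and is a Lebesgue point of the countably many
    weak limits of difference quotients found on the sets inner_part m. *)
Lemma ae_differentiable : {ae mu, forall x, Omega x -> differentiable f x}.
Proof.
have [U [UU ooU]] := ultraFilterLemma (eventually_filter : ProperFilter \oo).
have Uoo (A : set nat) : (\forall k \near \oo, A k) -> U A by exact: ooU.
have dens m j := difference_quotient_density n2 w0 mw wpos dw_lty mf fv
  (inner_part_lmeasurable m) (@inner_part_ball m) (step_gt0 m) (@inner_part_sub m) UU Uoo j.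
pose g m j := s2val (cid2 (dens m j)).
have gi m j : mu.-integrable setT (EFin \o g m j) by rewrite /g; case: cid2.
have ug m j (E : set 'rV[R]_n) : lmeasurable E -> E `<=` inner_part m ->
    \int[mu]_(x in E) difference_quotient f j k.+1%:R^-1 x @[k --> U] -->
    \int[mu]_(x in E) g m j x.
  by rewrite /g; case: cid2 => h /= _; exact.
have leb : {ae mu, forall x, forall mj : nat * 'I_n, forall e : R, 0 < e ->
    exists2 d : R, 0 < d & forall r : R, 0 < r < d ->
    (\int[mu]_(y in ball x r) `|g mj.1 mj.2 y - g mj.1 mj.2 x|%:E <= (e * r ^+ n)%:E)%E}.
  apply: ae_forall_countable => -[m j] /=; apply: ae_lebesgue_point.
    by move/integrableP : (gi m j) => [/measurable_EFinP].
  move=> r; apply: lebesgue_integrable_lty_of; apply: lebesgue_integrableS (gi m j).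
  exact: lmeasurable_ball.
have lipd := ae_forall_countable lipschitz_density.
have lip := ae_pointwise_lipschitz n2 w0 mw wpos dw_lty fv oO.
apply: ae_imply (ae_and lip (ae_and lipd leb)) => x [lipx [lipdx lebx]] Ox.
have [M xM] := lipx Ox.
have [m xm] := inner_part_nbhs Ox.
have [B uB] := integral_difference_quotient_bounded n2 w0 mw wpos dw_lty mf fv
  (inner_part_lmeasurable m) (@inner_part_ball m) (@inner_part_sub m).
apply: (@differentiable_good_point R n f U (inner_part m) (g m) (step m) B UU n_gt0 mf Uoo (ug m)
  (gi m) (step_gt0 m) (inner_part_lmeasurable m) uB x M xM xm (lipdx M xM)).
by move=> j; exact: (lebx (m, j)).
Qed.

End almost_everywhere_differentiability.

(** * Limits under the integral sign *)

Section lebesgue_limits.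
Context {R : realType} {n : nat}.
Notation mu := (@lebesgue R n).
Implicit Types (D : set 'rV[R]_n) (u : 'rV[R]_n -> R) (us : nat -> 'rV[R]_n -> R).

Lemma cvg_EFin_fun (a : nat -> R) (l : R) : a k @[k --> \oo] --> l ->
  (a k)%:E @[k --> \oo] --> l%:E.
Proof. by move=> al; apply: cvg_EFin => //; exact: nearW. Qed.

Lemma fatou_le D us u (c : \bar R) : lmeasurable D ->
  (forall k, lmeasurable_fun D (us k)) -> lmeasurable_fun D u ->
  (forall k x, 0 <= us k x) -> (forall x, 0 <= u x) ->
  {ae mu, forall x, D x -> us k x @[k --> \oo] --> u x} ->
  (forall k, (\int[mu]_(x in D) (us k x)%:E <= c)%E) ->
  (\int[mu]_(x in D) (u x)%:E <= c)%E.
Proof.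
move=> mD mus mu0 u_0 u0 [N [mN N0 uN]] uc.
have mDN : lmeasurable (D `\` N) by exact: measurableD.
rewrite (ge0_negligible_integral mN mD _ _ N0)//; last 2 first.
- by apply/measurable_EFinP.
- by move=> x _; rewrite lee_fin.
have -> : (\int[mu]_(x in D `\` N) (u x)%:E =
    \int[mu]_(x in D `\` N) limn_einf (fun k => (us k x)%:E))%E.
  apply: eq_integral => x; rewrite inE => -[Dx nNx].
  have ux : us k x @[k --> \oo] --> u x by apply: contrapT => ux; apply: nNx; apply: uN => /= h; exact/ux/h.
  by have [-> _] := cvg_limn_einf_sup (cvg_EFin_fun ux).
apply: le_trans (fatou _ _ _ _) _ => //.
- by move=> k; apply/measurable_EFinP; exact: measurable_funS (mus k).
- by move=> k x _; rewrite lee_fin.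
rewrite limn_einf_lim; apply: lime_le; first exact: is_cvg_einfs.
apply: nearW => k; apply: (@le_trans _ _ (\int[mu]_(x in D `\` N) (us k x)%:E)%E).
  by apply: ereal_inf_lbound; exists k => /=.
apply: le_trans (uc k); apply: ge0_subset_lebesgue_integral => //.
Qed.

Lemma dominated_L1_small D us u (G : 'rV[R]_n -> R) (e : R) : lmeasurable D ->
  (forall k, lmeasurable_fun D (us k)) -> lmeasurable_fun D u ->
  mu.-integrable D (EFin \o G) ->
  {ae mu, forall x, D x -> us k x @[k --> \oo] --> u x} ->
  {ae mu, forall x, forall k, D x -> `|us k x| <= G x} -> 0 < e ->
  \forall k \near \oo, (\int[mu]_(x in D) `|us k x - u x|%:E <= e%:E)%E.
Proof.
move=> mD mus mu0 iG ul uG e0.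
have h1 k : measurable_fun (D : set (lebesgue_space R n)) (EFin \o us k).
  by apply/measurable_EFinP; exact: mus.
have h2 : measurable_fun (D : set (lebesgue_space R n)) (EFin \o u).
  exact/measurable_EFinP.
have h3 : {ae mu, forall x, D x -> (EFin \o us k) x @[k --> \oo] --> (EFin \o u) x}.
  by apply: ae_imply ul => x h Dx; exact: cvg_EFin_fun (h Dx).
have h4 : {ae mu, forall x k, D x -> (`|(EFin \o us k) x| <= (EFin \o G) x)%E}.
  by apply: ae_imply uG => x h k Dx; rewrite /= lee_fin; exact: h.
have [_ + _] := dominated_convergence mD h1 h2 h3 iG h4.
move=> /fine_cvgP[fin /cvgrPdist_le/(_ _ e0) small].
near=> k.
have fk : (\int[mu]_(x in D) `|us k x - u x|%:E)%E \is a fin_num by near: k.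
rewrite -(fineK fk) lee_fin (le_trans (ler_norm _))// -normrN -[X in `|X|]add0r.
by near: k.
Unshelve. all: by end_near. Qed.

End lebesgue_limits.

(** * Convergence of the difference quotients *)

(** An upper limit along a sequence of steps, rather than a derivative, so that
    the function is defined everywhere and measurable. *)
Definition partial_limit (R : realType) (n : nat) (f : 'rV[R]_n -> R) (j : 'I_n) :
    'rV[R]_n -> R :=
  fun x => fine (limn_esup (fun k => (difference_quotient f j k.+1%:R^-1 x)%:E)).

Lemma closed_ball_sub_set (R : realType) (n : nat) (Omega : set 'rV[R]_n) (c : R) :
  closed [set x : 'rV[R]_n | ball x c `<=` Omega].
Proof.
rewrite -[X in closed X]setCK; apply: open_closedC.
rewrite openE => x /existsNP[y /not_implyP[xy nOy]].
move: xy; rewrite -ball_normE/= => xy.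
have d0 : 0 < c - `|x - y| by rewrite subr_gt0.
apply/nbhs_ballP; exists (c - `|x - y|) => //= x'; rewrite -ball_normE/= => xx' Ix'.
apply: nOy; apply: Ix' => /=.
have := ler_distD x x' y; rewrite (distrC x' x); lra.
Qed.

Lemma cvg_dnbhs0_natSinv (R : realType) : (k.+1%:R^-1 : R) @[k --> \oo] --> (0 : R)^'.
Proof.
move=> A /nbhs_ballP[d /= d0 dA].
have := near_infty_natSinv_lt (PosNum d0); apply: filterS => k /= kd.
have k0 : 0 < k.+1%:R^-1 :> R by rewrite invr_gt0 ltr0n.
apply: dA; last by rewrite gt_eqF.
by rewrite -ball_normE/= sub0r normrN gtr0_norm.
Qed.

Lemma cvg_dnbhs0_natSinvN (R : realType) : (- k.+1%:R^-1 : R) @[k --> \oo] --> (0 : R)^'.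
Proof.
move=> A /nbhs_ballP[d /= d0 dA].
have := near_infty_natSinv_lt (PosNum d0); apply: filterS => k /= kd.
have k0 : 0 < k.+1%:R^-1 :> R by rewrite invr_gt0 ltr0n.
apply: dA; last by rewrite oppr_eq0 gt_eqF.
by rewrite -ball_normE/= sub0r opprK gtr0_norm.
Qed.

Lemma derivable_difference_quotient_cvg (R : realType) (n : nat) (f : 'rV[R]_n -> R)
    (j : 'I_n) x (a : nat -> R) :
  derivable f x (delta_mx 0 j) -> a k @[k --> \oo] --> (0 : R)^' ->
  difference_quotient f j (a k) x @[k --> \oo] --> partial j f x.
Proof.
move=> df a0; have := cvg_comp _ _ a0 df; apply: cvg_trans.
apply: near_eq_cvg; apply: nearW => k /=.
by rewrite /difference_quotient [x + _]addrC.
Qed.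

Section partial_limits.
Context {R : realType} {n : nat}.
Variables (Omega : set 'rV[R]_n) (w f : 'rV[R]_n -> R) (v : R).
Notation mu := (@lebesgue R n).
Hypothesis n2 : (2 <= n)%N.
Hypothesis oO : open Omega.
Hypothesis w0 : forall x, 0 <= w x.
Hypothesis mw : lmeasurable_fun setT w.
Hypothesis wpos : {ae mu, forall x, 0 < w x}.
Hypothesis dw_lty : forall r,
  (\int[mu]_(x in ball (0%R : 'rV[R]_n) r) (dual_weight w x)%:E < +oo)%E.
Hypothesis mf : lmeasurable_fun setT f.
Hypothesis fv : (riesz_variation Omega w f <= v%:E)%E.

Let n_gt0 : (0 < n)%N. Proof. exact: ltnW. Qed.

Let C : R := (18 * n%:R ^+ 2) ^+ n * v ^+ n.

Lemma lmeasurable_partial_limit j (D : set 'rV[R]_n) :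
  lmeasurable_fun D (partial_limit f j).
Proof.
have ml : measurable_fun (setT : set (lebesgue_space R n))
    (fun x => limn_esup (fun k => (difference_quotient f j k.+1%:R^-1 x)%:E)).
  apply: measurable_fun_limn_esup => k; apply/measurable_EFinP.
  exact: lmeasurable_difference_quotient.
have mp : lmeasurable_fun setT (partial_limit f j).
  exact: (measurableT_comp (fine_measurable measurableT) ml).
exact: measurable_funS mp.
Qed.

Lemma differentiable_partial_limit j x : differentiable f x ->
  difference_quotient f j k.+1%:R^-1 x @[k --> \oo] --> partial_limit f j x.
Proof.
move=> /(@diff_derivable _ _ _ _ _ (delta_mx 0 j)) df.
have dl := derivable_difference_quotient_cvg df (@cvg_dnbhs0_natSinv R).
rewrite /partial_limit.
by have [_ ->] := cvg_limn_einf_sup (cvg_EFin_fun dl).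
Qed.

Let ae_partial_limit j : {ae mu, forall x, Omega x ->
  difference_quotient f j k.+1%:R^-1 x @[k --> \oo] --> partial_limit f j x}.
Proof.
apply: ae_imply (ae_differentiable n2 oO w0 mw wpos dw_lty mf fv) => x dx Ox.
exact: differentiable_partial_limit (dx Ox).
Qed.

(** Fatou's lemma, applied to the difference quotients of step 1 / (k + 1) cut
    off outside the set I k of the points where they can be estimated. These
    sets increase to Omega. *)
Lemma integral_normX_partial_limit_le j :
  (\int[mu]_(x in Omega) (`|partial_limit f j x| ^+ n * w x)%:E <= C%:E)%E.
Proof.
have mO : lmeasurable Omega by exact: open_lmeasurable.
pose I k : set 'rV[R]_n := [set x | ball x (4 * n%:R * k.+1%:R^-1) `<=` Omega].
have mI k : lmeasurable (I k) by apply: closed_lmeasurable; exact: closed_ball_sub_set.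
have k0 k : 0 < k.+1%:R^-1 :> R by rewrite invr_gt0 ltr0n.
have IO k : I k `<=` Omega.
  by move=> x; apply; apply: ballxx; rewrite !mulr_gt0// ltr0n.
have mI1 k : lmeasurable_fun Omega (\1_(I k) : 'rV[R]_n -> R).
  by apply/measurable_indic; exact: mI.
have mwO : lmeasurable_fun Omega w by exact: measurable_funS mw.
pose F k x := `|difference_quotient f j k.+1%:R^-1 x| ^+ n * w x.
have F0 k x : 0 <= F k x by rewrite mulr_ge0 ?exprn_ge0.
have mF k (D : set 'rV[R]_n) : lmeasurable_fun D (F k).
  apply: measurable_funM; last exact: measurable_funS mw.
  by apply: lmeasurable_normX; exact: lmeasurable_difference_quotient.
apply: (@fatou_le R n Omega (fun k x => F k x * \1_(I k) x)) => //.
- by move=> k; apply: measurable_funM; [exact: mF|exact: mI1].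
- apply: measurable_funM; last exact: mwO.
  by apply: lmeasurable_normX; exact: lmeasurable_partial_limit.
- by move=> k x; rewrite mulr_ge0// indicE.
- by move=> x; rewrite mulr_ge0 ?exprn_ge0.
- apply: ae_imply (ae_partial_limit j) => x gx Ox.
  have Fx : F k x @[k --> \oo] --> `|partial_limit f j x| ^+ n * w x.
    apply: cvgMl; apply: (@continuous_cvg _ _ _ _ _ _ (fun t : R => `|t| ^+ n)); last exact: gx.
    apply: (@continuous_comp _ _ _ (fun t : R => `|t|) (fun t : R => t ^+ n)).
      exact: norm_continuous.
    exact: exprn_continuous.
  apply: cvg_trans Fx; apply: near_eq_cvg.
  have /nbhs_ballP[d /= d0 dO] : nbhs x Omega by exact: open_nbhs_nbhs.
  have e0 : 0 < d / (4 * n%:R) by rewrite divr_gt0// mulr_gt0// ltr0n.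
  have := near_infty_natSinv_lt (PosNum e0); apply: filterS => k /= kd.
  rewrite indicE mem_set ?mulr1//; apply: subset_trans dO; apply: le_ball.
  by rewrite mulrC -ler_pdivlMr ?mulr_gt0 ?ltr0n// ltW.
- move=> k; have -> : (\int[mu]_(x in Omega) (F k x * \1_(I k) x)%:E =
      \int[mu]_(x in I k) (F k x)%:E)%E.
    rewrite -[in RHS](_ : Omega `&` I k = I k); last exact/setIidPr.
    rewrite integral_mkcondr; apply: eq_integral => x _; rewrite patchE indicE.
    by case: (x \in I k); rewrite ?mulr1 ?mulr0.
  apply: (integral_difference_quotient_le n2 w0 mw wpos fv (k0 k)) => //.
  have := @lmeasurable_difference_quotient R n f mf j k.+1%:R^-1 (I k).
  move=> /(@measurable_funM _ _ _ _ (cst (k.+1%:R^-1 : R)) _ (measurable_cst _)).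
  rewrite /= (_ : _ \* _ = (fun x => f (x + k.+1%:R^-1 *: delta_mx 0 j) - f x))//.
  apply/funext => x /=; rewrite /difference_quotient mulVKf ?invr_eq0//.
Qed.

Let normX_sub_le (a b : R) : `|a - b| ^+ n <= 2 ^+ n * (`|a| ^+ n + `|b| ^+ n).
Proof.
have t2 : 0 < 2 ^+ n :> R by rewrite exprn_gt0.
have [ab|ba] := leP `|a| `|b|.
- apply: (@le_trans _ _ (2 ^+ n * `|b| ^+ n)).
    rewrite -exprMn lerXn2r ?nnegrE ?mulr_ge0//.
    by have := ler_normB a b; lra.
  by rewrite ler_pM2l// lerDr exprn_ge0.
- apply: (@le_trans _ _ (2 ^+ n * `|a| ^+ n)).
    rewrite -exprMn lerXn2r ?nnegrE ?mulr_ge0//.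
    by have := ler_normB a b; lra.
  by rewrite ler_pM2l// lerDl exprn_ge0.
Qed.

(** The difference quotients converge a.e.; the part of |u_k - g| exceeding
    d |u_k - g|^n w is dominated by a multiple of the dual weight, and the
    integral of d |u_k - g|^n w is at most a constant times d. *)
Lemma difference_quotient_L1_cvg (K : set 'rV[R]_n) (N h1 : R) j (e : R) :
  lmeasurable K -> K `<=` ball (0 : 'rV[R]_n) N -> 0 < h1 ->
  (forall x, K x -> ball x (4 * n%:R * h1) `<=` Omega) -> 0 < e ->
  \forall k \near \oo, (\int[mu]_(x in K)
    `|difference_quotient f j k.+1%:R^-1 x - partial_limit f j x|%:E <= e%:E)%E.
Proof.
move=> mK KN h10 KO e0.
have nn : 0 < n%:R :> R by rewrite ltr0n.
have KOm : K `<=` Omega by move=> x /KO; apply; apply: ballxx; rewrite !mulr_gt0.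
have v0 : 0 <= v by rewrite -lee_fin (le_trans _ fv)// riesz_variation_ge0.
have C0 : 0 <= C by rewrite mulr_ge0 ?exprn_ge0// mulr_ge0// exprn_ge0.
have t2 : 0 < 2 ^+ n :> R by rewrite exprn_gt0.
pose A : R := 2 ^+ n * (C + C).
have A0 : 0 <= A by rewrite mulr_ge0 ?addr_ge0// ltW.
pose d := e / (2 * (A + 1)).
have d0 : 0 < d by rewrite divr_gt0// mulr_gt0// ltr_wpDl.
have dA : d * A <= e / 2.
  have A1 : 0 < A + 1 by rewrite ltr_wpDl.
  rewrite /d mulrAC ler_pdivrMr ?mulr_gt0//.
  rewrite (_ : e / 2 * _ = e * (A + 1)); last by field.
  by rewrite ler_pM2l// lerDl.
have mwK : lmeasurable_fun K w by exact: measurable_funS mw.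
pose V k x := `|difference_quotient f j k.+1%:R^-1 x - partial_limit f j x|.
have V0 k x : 0 <= V k x by exact: normr_ge0.
have mD k : lmeasurable_fun K (fun x => difference_quotient f j k.+1%:R^-1 x - partial_limit f j x).
  apply: measurable_funB; first exact: lmeasurable_difference_quotient.
  exact: lmeasurable_partial_limit.
have mV k : lmeasurable_fun K (V k) by exact: lmeasurable_norm (mD k).
pose W k x := d * (V k x ^+ n * w x).
have mW k : lmeasurable_fun K (W k).
  apply: measurable_funM; first exact: measurable_cst.
  by apply: measurable_funM; [exact: lmeasurable_normX (mD k)|exact: mwK].
have W0 k x : 0 <= W k x by rewrite /W mulr_ge0 ?(ltW d0)// mulr_ge0// exprn_ge0.
pose phi k x := Num.max 0 (V k x - W k x).
have mphi k : lmeasurable_fun K (phi k).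
  apply: measurable_maxr; first exact: measurable_cst.
  by apply: measurable_funB; [exact: mV|exact: mW].
have phi0 k x : 0 <= phi k x by rewrite le_max lexx.
have phiV k x : phi k x <= V k x by rewrite ge_max V0/= gerBl.
have Vphi k x : V k x <= phi k x + W k x by rewrite -lerBlDr le_max lexx orbT.
pose q := d `^ (1 - n%:R)^-1.
have q0 : 0 <= q by exact: powR_ge0.
have mdw : lmeasurable_fun setT (dual_weight w) by exact: lmeasurable_dual_weight.
have iG : mu.-integrable K (EFin \o (fun x => q * dual_weight w x)).
  apply: lebesgue_integrable_lty.
    apply: measurable_funM; [exact: measurable_cst|exact: measurable_funS mdw].
  have -> : (\int[mu]_(x in K) `|q * dual_weight w x|%:E =
      \int[mu]_(x in K) (q * dual_weight w x)%:E)%E.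
    by apply: eq_integral => x _; rewrite ger0_norm// mulr_ge0// powR_ge0.
  rewrite ge0_lebesgue_integralZl//; last 2 first.
  - exact: measurable_funS mdw.
  - by move=> x _; exact: powR_ge0.
  rewrite lte_mul_pinfty ?lee_fin//; apply: le_lt_trans (dw_lty N).
  apply: ge0_subset_lebesgue_integral => //.
  - exact: lmeasurable_ball.
  - exact: measurable_funS mdw.
  - by move=> x _; exact: powR_ge0.
have phicvg : {ae mu, forall x, K x -> phi k x @[k --> \oo] --> (0 : R)}.
  apply: ae_imply (ae_partial_limit j) => x gx Kx.
  have Vx : V k x @[k --> \oo] --> (0 : R).
    rewrite -[X in _ --> X](normr0 R) -(subrr (partial_limit f j x)).
    apply: cvg_norm; apply: cvgB; last exact: cvg_cst.
    exact: gx (KOm _ Kx).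
  have sq : \forall k \near \oo, 0 <= phi k x <= V k x.
    by apply: nearW => k; rewrite phi0 phiV.
  exact: (@squeeze_cvgr nat _ _ R (cst 0) (V ^~ x) (phi ^~ x) sq 0 (cvg_cst _) Vx).
have phidom : {ae mu, forall x, forall k, K x -> `|phi k x| <= q * dual_weight w x}.
  apply: ae_imply wpos => x wx k _; rewrite ger0_norm// ge_max mulr_ge0 ?powR_ge0//=.
  have := young_dual_weight (difference_quotient f j k.+1%:R^-1 x - partial_limit f j x) n2 wx d0.
  by rewrite -/(V k x) lerBlDl.
have e20 : 0 < e / 2 by rewrite divr_gt0.
have := dominated_L1_small mK mphi (measurable_cst _ : lmeasurable_fun K (cst 0)) iG phicvg phidom e20.
have h1oo : \forall k \near \oo, (0 < k.+1%:R^-1 :> R) && (k.+1%:R^-1 <= h1).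
  have := near_infty_natSinv_lt (PosNum h10); apply: filterS => k /= kh.
  by rewrite invr_gt0 ltr0n/= ltW.
apply: filterS2 h1oo => k kh phik.
have mPW : lmeasurable_fun K (fun x => phi k x + W k x).
  by apply: measurable_funD; [exact: mphi|exact: mW].
apply: (le_trans (ge0_le_lebesgue_integral mK (mV k) mPW (fun x _ => V0 k x) (fun x _ => Vphi k x))).
rewrite (ge0_lebesgue_integralD mK (mphi k) (mW k) (fun x _ => phi0 k x) (fun x _ => W0 k x)).
rewrite (splitr e) EFinD; apply: leeD.
  apply: le_trans phik; rewrite le_eqVlt; apply/orP; left; apply/eqP.
  by apply: eq_integral => x _; rewrite /cst subr0 (ger0_norm (phi0 k x)).
have mVn : lmeasurable_fun K (fun x => V k x ^+ n * w x).
  by apply: measurable_funM; [exact: lmeasurable_normX (mD k)|exact: mwK].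
have Vn0 x : K x -> 0 <= V k x ^+ n * w x by move=> _; rewrite mulr_ge0 ?exprn_ge0.
rewrite (ge0_lebesgue_integralZl mK mVn Vn0 (ltW d0)).
apply: (@le_trans _ _ (d * A)%:E); last by rewrite lee_fin.
rewrite (EFinM d A); apply: lee_wpmul2l; first by rewrite lee_fin ltW.
pose F x := `|difference_quotient f j k.+1%:R^-1 x| ^+ n * w x.
pose G x := `|partial_limit f j x| ^+ n * w x.
have mF : lmeasurable_fun K F.
  apply: measurable_funM; last exact: mwK.
  by apply: lmeasurable_normX; exact: lmeasurable_difference_quotient.
have mG (D : set 'rV[R]_n) : lmeasurable_fun D G.
  apply: measurable_funM; last exact: measurable_funS mw.
  by apply: lmeasurable_normX; exact: lmeasurable_partial_limit.
have F0 x : K x -> 0 <= F x by move=> _; rewrite mulr_ge0 ?exprn_ge0.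
have G0 (D : set 'rV[R]_n) x : D x -> 0 <= G x by move=> _; rewrite mulr_ge0 ?exprn_ge0.
have mFG : lmeasurable_fun K (fun x => F x + G x).
  by apply: measurable_funD; [exact: mF|exact: mG].
have mFG2 : lmeasurable_fun K (fun x => 2 ^+ n * (F x + G x)).
  by apply: measurable_funM; [exact: measurable_cst|exact: mFG].
have FG0 x : K x -> 0 <= F x + G x by move=> Kx; rewrite addr_ge0 ?F0 ?(G0 K).
have VFG x : K x -> V k x ^+ n * w x <= 2 ^+ n * (F x + G x).
  by move=> _; rewrite /F /G -mulrDl mulrA ler_wpM2r// normX_sub_le.
apply: (le_trans (ge0_le_lebesgue_integral mK mVn mFG2 Vn0 VFG)).
rewrite (ge0_lebesgue_integralZl mK mFG FG0 (ltW t2)).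
rewrite /A (EFinM (2 ^+ n)); apply: lee_wpmul2l; first by rewrite lee_fin ltW.
rewrite (ge0_lebesgue_integralD mK mF (mG K) F0 (G0 K)) EFinD; apply: leeD.
  exact: (integral_normX_difference_quotient_le n2 w0 mw wpos mf fv KO).
apply: le_trans (integral_normX_partial_limit_le j).
exact: (ge0_subset_lebesgue_integral mK (open_lmeasurable oO) (mG Omega) (G0 Omega) KOm).
Qed.

End partial_limits.

(** * Discrete integration by parts *)

Section compactly_supported_functions.
Context {R : realType} {n : nat}.
Implicit Types (psi : 'rV[R]_n -> R) (S : set 'rV[R]_n).

Lemma compact_subset_ball S : compact S -> exists N : R, S `<=` ball (0 : 'rV[R]_n) N.
Proof.
move=> /compact_bounded[M [Mreal SM]].
exists (M + 2) => x Sx.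
have := SM (M + 1); rewrite ltrDl ltr01 => /(_ isT x Sx) /= xM.
by rewrite -ball_normE/= sub0r normrN; lra.
Qed.

Lemma compact_support_bounded psi S : continuous psi -> compact S ->
  (forall x, ~ S x -> psi x = 0) -> exists2 A : R, 0 <= A & forall x, `|psi x| <= A.
Proof.
move=> cpsi cS psi0.
have cw : {within S, continuous psi} by exact: continuous_subspaceT.
have [M [Mreal SM]] := compact_bounded (continuous_compact cw cS).
exists (`|M| + 1); first by rewrite addr_ge0.
move=> x; have [Sx|/psi0 ->] := pselect (S x); last by rewrite normr0 addr_ge0.
apply: SM; last by exists x.
by rewrite ltr_pwDr// ler_norm.
Qed.

Lemma compact_support_derive_eq0 psi S (e : 'rV[R]_n) x : closed S ->
  (forall x, ~ S x -> psi x = 0) -> ~ S x -> 'D_e psi x = 0.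
Proof.
move=> cS psi0 nSx; rewrite /derive; apply: cvg_lim => //.
have oS : open (~` S) by exact: closed_openC.
have /nbhs_ballP[d /= d0 dS] : nbhs x (~` S) by exact: open_nbhs_nbhs.
have h0 : \forall h \near (0 : R)^', h^-1 *: ((psi \o shift x) (h *: e) - psi x) = 0.
  have d'0 : 0 < d / (`|e| + 1) by rewrite divr_gt0// ltr_wpDl.
  have /nbhs_ballP : exists2 c : R, 0 < c & ball (0 : R) c `<=` [set h : R | `|h| * (`|e| + 1) < d].
    exists (d / (`|e| + 1)) => // h; rewrite -ball_normE/= sub0r normrN.
    by rewrite ltr_pdivlMr// ltr_wpDl.
  move=> hd; apply: nbhs_dnbhs; apply: filterS hd => h /= hd.
  rewrite (psi0 x nSx) (psi0 (h *: e + x)) ?subrr ?scaler0//.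
  apply: dS; rewrite -ball_normE/= opprD addrCA subrr addr0 normrN normrZ.
  by apply: le_lt_trans hd; rewrite ler_wpM2l// lerDl.
have c0 : (fun=> 0 : R) h @[h --> (0 : R)^'] --> (0 : R) by exact: cvg_cst.
by apply: cvg_trans c0; apply: near_eq_cvg; apply: filterS h0 => h ->.
Qed.

End compactly_supported_functions.

Section directional_mean_value.
Context {R : realType} {n : nat}.
Variables (psi : 'rV[R]_n -> R) (e : 'rV[R]_n).
Hypothesis dpsi : forall x, derivable psi x e.

Lemma line_quotient (x : 'rV[R]_n) (t : R) :
  (fun h : R => h^-1 *: (((fun t : R => psi (x + t *: e)) \o shift t) (h *: (1 : R)) - psi (x + t *: e)))
  = (fun h => h^-1 *: ((psi \o shift (x + t *: e)) (h *: e) - psi (x + t *: e))).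
Proof.
apply/funext => h /=; congr (_ *: (psi _ - _)).
change (x + (h * 1 + t) *: e = h *: e + (x + t *: e)).
by rewrite mulr1 scalerDl addrCA.
Qed.

Lemma normr_directional_increment_le (A : R) (x : 'rV[R]_n) (h : R) :
  (forall y, `|'D_e psi y| <= A) -> `|psi (x + h *: e) - psi x| <= A * `|h|.
Proof.
move=> psiA; pose l t : R := psi (x + t *: e).
have dl (t : R) : is_derive t 1 l ('D_e psi (x + t *: e)).
  by apply: DeriveDef; rewrite /derivable/derive line_quotient//; exact: dpsi.
have cl : continuous l.
  by move=> t; apply/differentiable_continuous/derivable1_diffP; have [] := dl t.
have mvt (a b : R) : a <= b -> `|l b - l a| <= A * (b - a).
  move=> ab; have [c _ ->] := MVT_segment ab (fun t _ => dl t) (continuous_subspaceT cl).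
  by rewrite normrM (@ger0_norm _ (b - a)) ?subr_ge0// ler_wpM2r ?subr_ge0.
have l0 : l 0 = psi x by rewrite /l scale0r addr0.
rewrite -l0 -/(l h); have [h0|h0] := leP 0 h.
  by rewrite (ger0_norm h0); have := mvt 0 h h0; rewrite (subr0 h).
by rewrite (ltr0_norm h0) distrC; have := mvt h 0 (ltW h0); rewrite (sub0r h).
Qed.

End directional_mean_value.

Section integration_by_parts.
Context {R : realType} {n : nat}.
Notation mu := (@lebesgue R n).
Implicit Types (D : set 'rV[R]_n) (F : 'rV[R]_n -> R).

Lemma integral_lebesgue_restrict D E (F : 'rV[R]_n -> \bar R) : D `<=` E ->
  (forall x, ~ D x -> F x = 0%E) ->
  (\int[mu]_(x in E) F x = \int[mu]_(x in D) F x)%E.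
Proof.
move=> DE F0; rewrite integral_mkcond [RHS]integral_mkcond.
apply: eq_integral => x _; rewrite !patchE.
have [Dx|/F0 ->] := pselect (D x); last by case: ifP; case: ifP.
by rewrite !mem_set//; exact: DE.
Qed.

Lemma Rintegral_shift F a : mu.-integrable setT (EFin \o F) ->
  mu.-integrable setT (EFin \o (fun x => F (x + a))) /\
  \int[mu]_x F (x + a) = \int[mu]_x F x.
Proof.
move=> /integrableP[mF Foo].
have mFT : lmeasurable_fun setT F by exact/measurable_EFinP.
split; last first.
  by rewrite /Rintegral -(integral_shift a measurableT mF) preimage_setT.
apply: lebesgue_integrable_lty.
  by have := @lmeasurable_fun_shift R n setT F a measurableT mFT; rewrite preimage_setT.
have mFn : measurable_fun (setT : set (lebesgue_space R n)) (fun x => `|F x|%:E).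
  by apply/measurable_EFinP; exact: lmeasurable_norm.
have := integral_shift a measurableT mFn; rewrite preimage_setT => ->.
exact: Foo.
Qed.

Lemma integrableM_bounded_support D (f psi : 'rV[R]_n -> R) (A : R) :
  lmeasurable D -> lmeasurable_fun setT f -> lmeasurable_fun setT psi ->
  (\int[mu]_(x in D) `|f x|%:E < +oo)%E ->
  (forall x, ~ D x -> psi x = 0) -> (forall x, `|psi x| <= A) ->
  mu.-integrable setT (EFin \o (fun x => f x * psi x)).
Proof.
move=> mD mf mpsi foo psi0 psiA.
have A0 : 0 <= A by exact: le_trans (psiA 0).
have mfp : lmeasurable_fun setT (fun x => f x * psi x) by exact: measurable_funM.
apply: (lebesgue_integrable_lty mfp).
rewrite (@integral_lebesgue_restrict D) //; last first.
  by move=> x /psi0 ->; rewrite mulr0 normr0.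
have mfD : lmeasurable_fun D (fun x => `|f x|).
  by apply: lmeasurable_norm; exact: measurable_funS mf.
have mfpD : lmeasurable_fun D (fun x => `|f x * psi x|).
  by apply: lmeasurable_norm; exact: measurable_funS mfp.
have mAf : lmeasurable_fun D (fun x => A * `|f x|).
  by apply: measurable_funM; [exact: measurable_cst|exact: mfD].
have le1 x : D x -> `|f x * psi x| <= A * `|f x|.
  by move=> _; rewrite normrM mulrC ler_wpM2r.
apply: (le_lt_trans (ge0_le_lebesgue_integral mD mfpD mAf (fun x _ => normr_ge0 _) le1)).
rewrite (ge0_lebesgue_integralZl mD mfD (fun x _ => normr_ge0 _) A0).
by rewrite lte_mul_pinfty ?lee_fin.
Qed.

(** Discrete integration by parts: translation invariance moves a difference
    quotient from f to the test function. *)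
Lemma Rintegral_difference_quotient_by_parts (f phi : 'rV[R]_n -> R) j (h : R) :
  h != 0 -> mu.-integrable setT (EFin \o (fun x => f x * phi x)) ->
  mu.-integrable setT (EFin \o (fun x => f x * phi (x - h *: delta_mx 0 j))) ->
  \int[mu]_x (difference_quotient f j h x * phi x) =
  - \int[mu]_x (f x * difference_quotient phi j (- h) x).
Proof.
move=> h0 ia iF; set e := h *: delta_mx 0 j in iF *.
pose F x := f x * phi (x - e).
have [iFs FsE] := Rintegral_shift e iF.
have iFs' : mu.-integrable setT (EFin \o (fun x => f (x + e) * phi x)).
  by move: iFs; rewrite (_ : (fun x => _) = (fun x => f (x + e) * phi x))//; apply/funext => x; rewrite addrK.
have FsE' : \int[mu]_x (f (x + e) * phi x) = \int[mu]_x F x.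
  by rewrite -FsE; apply: eq_Rintegral => x _; rewrite addrK.
have -> : \int[mu]_x (difference_quotient f j h x * phi x) =
    h^-1 * (\int[mu]_x (f (x + e) * phi x) - \int[mu]_x (f x * phi x)).
  have i1 : mu.-integrable setT (EFin \o (fun x => f (x + e) * phi x - f x * phi x)).
    exact: (integrableB measurableT iFs' ia).
  rewrite -(RintegralB measurableT iFs' ia) -(RintegralZl h^-1 measurableT i1).
  by apply: eq_Rintegral => x _; rewrite /difference_quotient -/e -mulrA mulrBl.
have -> : \int[mu]_x (f x * difference_quotient phi j (- h) x) =
    (- h)^-1 * (\int[mu]_x F x - \int[mu]_x (f x * phi x)).
  have i2 : mu.-integrable setT (EFin \o (fun x => F x - f x * phi x)).
    exact: (integrableB measurableT iF ia).
  rewrite -(RintegralB measurableT iF ia) -(RintegralZl (- h)^-1 measurableT i2).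
  by apply: eq_Rintegral => x _; rewrite /difference_quotient scaleNr -/e mulrCA mulrBr.
by rewrite FsE' invrN mulNr opprK.
Qed.

End integration_by_parts.

(** * Existence of the weak derivatives *)

Section weak_derivatives.
Context {R : realType} {n : nat}.
Variables (Omega : set 'rV[R]_n) (w f : 'rV[R]_n -> R) (v : R).
Notation mu := (@lebesgue R n).
Hypothesis n2 : (2 <= n)%N.
Hypothesis oO : open Omega.
Hypothesis w0 : forall x, 0 <= w x.
Hypothesis mw : lmeasurable_fun setT w.
Hypothesis wpos : {ae mu, forall x, 0 < w x}.
Hypothesis dw_lty : forall r,
  (\int[mu]_(x in ball (0%R : 'rV[R]_n) r) (dual_weight w x)%:E < +oo)%E.

Let n_gt0 : (0 < n)%N. Proof. exact: ltnW. Qed.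

Lemma integral_lty_of_normX (E : set 'rV[R]_n) (N : R) (u : 'rV[R]_n -> R) :
  lmeasurable E -> E `<=` ball (0 : 'rV[R]_n) N -> lmeasurable_fun E u ->
  (\int[mu]_(x in E) (`|u x| ^+ n * w x)%:E < +oo)%E ->
  (\int[mu]_(x in E) `|u x|%:E < +oo)%E.
Proof.
move=> mE EN mu_ uoo.
apply: (le_lt_trans (integral_young_le n2 w0 mw wpos ltr01 mE mu_)).
have mdw : lmeasurable_fun setT (dual_weight w) by exact: lmeasurable_dual_weight.
rewrite lte_add_pinfty ?mul1e//.
rewrite lte_mul_pinfty ?lee_fin ?powR_ge0//; apply: le_lt_trans (dw_lty N).
apply: (ge0_subset_lebesgue_integral mE (lmeasurable_ball _ _) _ _ EN).
  exact: measurable_funS mdw.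
by move=> x _; exact: powR_ge0.
Qed.

Lemma locally_integrable_of_normX (u : 'rV[R]_n -> R) : lmeasurable_fun Omega u ->
  (\int[mu]_(x in Omega) (`|u x| ^+ n * w x)%:E < +oo)%E ->
  locally_integrable_on Omega u.
Proof.
move=> mu_ uoo; split => // K KO cK.
have mO : lmeasurable Omega by exact: open_lmeasurable.
have mK : lmeasurable K.
  by apply: closed_lmeasurable; apply: compact_closed cK; exact: norm_hausdorff.
have [N KN] := compact_subset_ball cK.
have muK : lmeasurable_fun K u by exact: measurable_funS mu_.
apply: (integral_lty_of_normX mK KN muK); apply: le_lt_trans uoo.
have muw : lmeasurable_fun Omega (fun x => `|u x| ^+ n * w x).
  by apply: measurable_funM; [exact: lmeasurable_normX|exact: measurable_funS mw].
apply: (ge0_subset_lebesgue_integral mK mO muw _ KO) => x _.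
by rewrite mulr_ge0 ?exprn_ge0.
Qed.

Hypothesis mf : lmeasurable_fun setT f.
Hypothesis fv : (riesz_variation Omega w f <= v%:E)%E.
Hypothesis foo : (\int[mu]_(x in Omega) (`|f x| ^+ n * w x)%:E < +oo)%E.

Let g := partial_limit f.

Let goo j : (\int[mu]_(x in Omega) (`|g j x| ^+ n * w x)%:E < +oo)%E.
Proof.
apply: le_lt_trans (integral_normX_partial_limit_le n2 oO w0 mw wpos dw_lty mf fv j) _.
exact: ltry.
Qed.

Let inner_neighbourhood (S : set 'rV[R]_n) : compact S -> S `<=` Omega ->
  exists m : nat, forall x, S x ->
    ball x m.+1%:R^-1 `<=` Omega /\ ball (0 : 'rV[R]_n) m.+1%:R x.
Proof.
move=> /compact_near_coveringP/(_ nat \oo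
  (fun m x => ball x m.+1%:R^-1 `<=` Omega /\ ball (0 : 'rV[R]_n) m.+1%:R x)).
move=> cover SO.
have [] : \forall m \near \oo, S `<=` [set x | ball x m.+1%:R^-1 `<=` Omega /\
    ball (0 : 'rV[R]_n) m.+1%:R x].
  apply: cover => x /SO Ox; have /nbhs_ballP[d /= d0 dO] : nbhs x Omega by exact: open_nbhs_nbhs.
  have d20 : 0 < d / 2 by rewrite divr_gt0.
  exists (ball x (Num.min 1 (d / 2)), [set m | m.+1%:R^-1 < d / 2 /\ `|x| + 1 < m.+1%:R]) => /=.
    split; first by apply: nbhsx_ballx; rewrite lt_min ltr01.
    apply: filterI; first exact: near_infty_natSinv_lt (PosNum d20).
    exists (Num.bound (`|x| + 1)) => // k /= bk.
    rewrite (lt_le_trans (archi_boundP _)) ?addr_ge0//.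
    by rewrite ler_nat (leq_trans bk).
  move=> [y m] /= [+ [md mx]]; rewrite -ball_normE/= lt_min => /andP[xy1 xyd]; split.
    move=> z /= yz; apply: dO; rewrite -ball_normE/=.
    by rewrite (le_lt_trans (ler_distD y _ _))// (splitr d) ltrD// (lt_trans yz).
  rewrite sub0r normrN; apply: lt_trans mx.
  have := ler_normB x (x - y); rewrite opprB addrC subrK; lra.
by move=> m _ /(_ m (leqnn m)) Sm; exists m => x /Sm.
Qed.

(** In the discrete integration by parts, the difference quotients of phi are
    bounded by the mean value theorem and converge everywhere, while those of f
    converge in L^1 on the support of phi; let the step tend to 0. *)
Lemma weak_derivative_partial_limit j : weak_derivative Omega j f (g j).
Proof.
have mg : lmeasurable_fun setT (g j) by exact: lmeasurable_partial_limit.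
have mfO : lmeasurable_fun Omega f by exact: measurable_funS mf.
have mgO : lmeasurable_fun Omega (g j) by exact: measurable_funS mg.
split; [exact: locally_integrable_of_normX|exact: locally_integrable_of_normX|].
move=> phi [sphi cS SO]; set S := supp phi in cS SO.
have cphi : continuous phi := (sphi [::]).1.
have dphi x : derivable phi x (delta_mx 0 j) := (sphi [::]).2 j x.
have cdphi : continuous (partial j phi) := (sphi [:: j]).1.
have closedS : closed S by exact: closed_closure.
have phi0 x : ~ S x -> phi x = 0.
  move=> nSx; apply/eqP; apply: contrapT => /negP phix; apply: nSx.
  exact: subset_closure.
have dphi0 x : ~ S x -> partial j phi x = 0.
  exact: compact_support_derive_eq0 closedS phi0.
have [A A0 phiA] := compact_support_bounded cphi cS phi0.
have [A' A'0 dphiA] := compact_support_bounded cdphi cS dphi0.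
have [m mP] := inner_neighbourhood cS SO.
have m0 : 0 < m.+1%:R^-1 :> R by rewrite invr_gt0 ltr0n.
pose c : R := m.+1%:R^-1.
have c1 : c <= 1 by rewrite invf_le1 ?ler1n// ltr0n.
(* K contains the support of phi and its translates by less than c / 2. *)
pose K := [set x | ball x (c / 2) `<=` Omega] `&` ball (0 : 'rV[R]_n) (m.+1%:R + 1).
have c20 : 0 < c / 2 by rewrite divr_gt0.
have mK : lmeasurable K.
  apply: measurableI; last exact: lmeasurable_ball.
  by apply: closed_lmeasurable; exact: closed_ball_sub_set.
have KO : K `<=` Omega by move=> x [xO _]; apply: xO; exact: ballxx.
have KN : K `<=` ball (0 : 'rV[R]_n) (m.+1%:R + 1) by move=> x [].
have mS : lmeasurable S by exact: closed_lmeasurable.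
have SN : S `<=` ball (0 : 'rV[R]_n) m.+1%:R by move=> x /mP[].
have SK (x e : 'rV[R]_n) : `|e| < c / 2 -> S (x + e) -> K x.
  move=> ec /mP[xO xN]; split.
    move=> y; rewrite -ball_normE/= => xy; apply: xO; rewrite -ball_normE/=.
    rewrite addrAC; change (`|x - y + e| < c).
    by rewrite (le_lt_trans (ler_normD _ _))// (splitr c) ltrD.
  move: xN; rewrite -!ball_normE/= !sub0r !normrN => xN.
  have := ler_normB (x + e) e; rewrite addrK; lra.
have foK : (\int[mu]_(x in K) `|f x|%:E < +oo)%E.
  have mfK : lmeasurable_fun K f by exact: measurable_funS mf.
  apply: (integral_lty_of_normX mK KN mfK); apply: le_lt_trans foo.
  have mfw : lmeasurable_fun Omega (fun x => `|f x| ^+ n * w x).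
    by apply: measurable_funM; [exact: lmeasurable_normX|exact: measurable_funS mw].
  apply: (ge0_subset_lebesgue_integral mK (open_lmeasurable oO) mfw _ KO) => x _.
  by rewrite mulr_ge0 ?exprn_ge0.
have goS : (\int[mu]_(x in S) `|g j x|%:E < +oo)%E.
  by have [_] := locally_integrable_of_normX mgO (goo j); exact.
have mphi : lmeasurable_fun setT phi by exact: continuous_lmeasurable_fun.
have mdphi : lmeasurable_fun setT (partial j phi) by exact: continuous_lmeasurable_fun.
have normr_delta (h : R) : `|h *: (delta_mx 0 j : 'rV[R]_n)| <= `|h|.
  rewrite normrZ ler_piMr//; apply/ler_addgt0Pr => e e0; apply: ltW.
  rewrite ltr_norm_rV ?addr_gt0//; apply/forallP => i; rewrite mxE/=.
  by rewrite normr_nat (@le_lt_trans _ _ 1) ?ltrDl//; case: (_ == _).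
have SK0 x : S x -> K x.
  by move=> Sx; apply: (SK x 0); rewrite ?normr0 ?addr0.
have K0 x : ~ K x -> phi x = 0 by move=> nKx; apply: phi0 => /SK0.
have dK0 x : ~ K x -> partial j phi x = 0 by move=> nKx; apply: dphi0 => /SK0.
have ifphi : mu.-integrable setT (EFin \o (fun x => f x * phi x)).
  exact: (integrableM_bounded_support mK mf mphi foK K0 phiA).
have ifdphi : mu.-integrable setT (EFin \o (fun x => f x * partial j phi x)).
  exact: (integrableM_bounded_support mK mf mdphi foK dK0 dphiA).
have igphi : mu.-integrable setT (EFin \o (fun x => g j x * phi x)).
  exact: (integrableM_bounded_support mS mg mphi goS phi0 phiA).
have fineE (F : 'rV[R]_n -> R) : mu.-integrable setT (EFin \o F) ->
    (forall x, ~ Omega x -> F x = 0) ->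
    (\int[mu]_(x in Omega) (F x)%:E = (\int[mu]_x F x)%R%:E)%E.
  move=> iF F0; rewrite /Rintegral fineK; last exact: (integrable_fin_num measurableT iF).
  by apply/esym/integral_lebesgue_restrict => // x /F0 ->.
rewrite (fineE _ ifdphi); last by move=> x nOx; rewrite dK0 ?mulr0// => /KO.
rewrite (fineE _ igphi); last by move=> x nOx; rewrite K0 ?mulr0// => /KO.
rewrite -EFinN; congr EFin.
pose h k : R := k.+1%:R^-1.
have h0 k : 0 < h k by rewrite invr_gt0 ltr0n.
have hc : \forall k \near \oo, h k < c / 2 by exact: near_infty_natSinv_lt (PosNum c20).
have dphi_bound k x : `|difference_quotient phi j (- h k) x| <= A'.
  have hk : 0 < `|- h k| by rewrite normrN normr_gt0 gt_eqF.
  rewrite /difference_quotient normrM normfV mulrC ler_pdivrMr//.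
  exact: (normr_directional_increment_le dphi x (- h k) dphiA).
have mdq k (D : set 'rV[R]_n) : lmeasurable_fun D (difference_quotient phi j (- h k)).
  exact: lmeasurable_difference_quotient.
have near_support k x : h k < c / 2 -> ~ K x -> phi (x - h k *: delta_mx 0 j) = 0.
  move=> hkc nKx; apply: phi0 => Sx; apply: nKx; apply: SK Sx.
  by rewrite normrN (le_lt_trans (normr_delta _))// gtr0_norm.
have dq0 k x : h k < c / 2 -> ~ K x -> difference_quotient phi j (- h k) x = 0.
  by move=> hkc nKx; rewrite /difference_quotient scaleNr near_support// K0// subrr mulr0.
have ifdq k : h k < c / 2 ->
    mu.-integrable setT (EFin \o (fun x => f x * difference_quotient phi j (- h k) x)).
  move=> hkc; apply: (integrableM_bounded_support mK mf (mdq k setT) foK _ (dphi_bound k)).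
  by move=> x; exact: dq0.
have parts k : h k < c / 2 ->
    \int[mu]_x (difference_quotient f j (h k) x * phi x) =
    - \int[mu]_x (f x * difference_quotient phi j (- h k) x).
  move=> hkc; apply: Rintegral_difference_quotient_by_parts => //; first by rewrite gt_eqF.
  have mphis : lmeasurable_fun setT (fun x => phi (x - h k *: delta_mx 0 j)).
    have := @lmeasurable_fun_shift R n setT phi (- (h k *: delta_mx 0 j)) measurableT mphi.
    by rewrite preimage_setT.
  apply: (integrableM_bounded_support mK mf mphis foK _ (fun x => phiA _)).
  by move=> x; exact: near_support.
have lim_dphi (e : R) : 0 < e -> \forall k \near \oo,
    `|\int[mu]_x (f x * difference_quotient phi j (- h k) x) -
      \int[mu]_x (f x * partial j phi x)| <= e.
  move=> e0.
  have mus k : lmeasurable_fun K (fun x => f x * difference_quotient phi j (- h k) x).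
    by apply: measurable_funM; [exact: measurable_funS mf|exact: mdq].
  have mu0 : lmeasurable_fun K (fun x => f x * partial j phi x).
    by apply: measurable_funM; [exact: measurable_funS mf|exact: measurable_funS mdphi].
  have iG : mu.-integrable K (EFin \o (fun x => `|f x| * A')).
    have mfK : lmeasurable_fun K f by exact: measurable_funS mf.
    have i1 : mu.-integrable K (EFin \o (fun x => `|f x|)).
      apply: lebesgue_integrable_lty; first exact: lmeasurable_norm.
      by under eq_integral do rewrite normr_id.
    exact: (integrableZr mK A' i1).
  have cv : {ae mu, forall x, K x -> f x * difference_quotient phi j (- h k) x @[k --> \oo] -->
      f x * partial j phi x}.
    apply: aeW => x _; apply: cvgMr.
    exact: derivable_difference_quotient_cvg (dphi x) (@cvg_dnbhs0_natSinvN R).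
  have dom : {ae mu, forall x, forall k, K x ->
      `|f x * difference_quotient phi j (- h k) x| <= `|f x| * A'}.
    by apply: aeW => x k _; rewrite normrM ler_wpM2l.
  apply: filterS2 hc (dominated_L1_small mK mus mu0 iG cv dom e0) => k hkc small.
  rewrite -(RintegralB measurableT (ifdq k hkc) ifdphi).
  apply: normr_Rintegral_le => //.
    apply: measurable_funB; apply: measurable_funM => //; exact: mdq.
  rewrite (@integral_lebesgue_restrict _ _ K)// => x nKx.
  by rewrite dq0// dK0// !mulr0 subrr normr0.
have lim_df (e : R) : 0 < e -> \forall k \near \oo,
    `|\int[mu]_x (difference_quotient f j (h k) x * phi x) -
      \int[mu]_x (g j x * phi x)| <= e.
  move=> e0; have eA : 0 < e / (A + 1) by rewrite divr_gt0// ltr_wpDl.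
  have nn0 : 0 < n%:R :> R by rewrite ltr0n.
  have h1 : 0 < c / (4 * n%:R) by rewrite divr_gt0// mulr_gt0.
  have SO' x : S x -> ball x (4 * n%:R * (c / (4 * n%:R))) `<=` Omega.
    move=> /mP[+ _]; rewrite mulrC divfK// gt_eqF// mulr_gt0//.
  have small := difference_quotient_L1_cvg n2 oO w0 mw wpos dw_lty mf fv j mS SN h1 SO' eA.
  apply: filterS small => k; rewrite -/(h k) => small.
  pose u x := difference_quotient f j (h k) x - g j x.
  have mu_ (D : set 'rV[R]_n) : lmeasurable_fun D u.
    by apply: measurable_funB; [exact: lmeasurable_difference_quotient|exact: measurable_funS mg].
  have iu : mu.-integrable setT (EFin \o (fun x => u x * phi x)).
    apply: (integrableM_bounded_support mS (mu_ setT) mphi _ phi0 phiA).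
    by apply: le_lt_trans small _; exact: ltry.
  have -> : \int[mu]_x (difference_quotient f j (h k) x * phi x) =
      \int[mu]_x (u x * phi x) + \int[mu]_x (g j x * phi x).
    rewrite -(RintegralD measurableT iu igphi); apply: eq_Rintegral => x _.
    by rewrite /u mulrBl subrK.
  rewrite addrK; apply: (normr_Rintegral_le measurableT).
    by apply: measurable_funM; [exact: mu_|exact: mphi].
  rewrite (@integral_lebesgue_restrict _ _ S)//; last first.
    by move=> x nSx; rewrite phi0// mulr0 normr0.
  have mnu : lmeasurable_fun S (fun x => `|u x|) by exact: lmeasurable_norm (mu_ S).
  have mup : lmeasurable_fun S (fun x => `|u x * phi x|).
    by apply: lmeasurable_norm; apply: measurable_funM; [exact: mu_|exact: measurable_funS mphi].
  have mAu : lmeasurable_fun S (fun x => (A + 1) * `|u x|).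
    by apply: measurable_funM; [exact: measurable_cst|exact: mnu].
  have le1 x : S x -> `|u x * phi x| <= (A + 1) * `|u x|.
    move=> _; rewrite normrM mulrC ler_wpM2r// (le_trans (phiA x))// lerDl//.
  apply: (le_trans (ge0_le_lebesgue_integral mS mup mAu (fun x _ => normr_ge0 _) le1)).
  have A10 : 0 <= A + 1 by rewrite addr_ge0.
  rewrite (ge0_lebesgue_integralZl mS mnu (fun x _ => normr_ge0 _) A10).
  have -> : e%:E = ((A + 1)%:E * (e / (A + 1))%:E)%E.
    by rewrite -EFinM mulrC divfK// gt_eqF// ltr_wpDl.
  by apply: lee_wpmul2l.
apply/eqP; rewrite -subr_eq0 opprK -normr_le0; apply/ler_addgt0Pr => e e0; rewrite add0r.
have e20 : 0 < e / 2 by rewrite divr_gt0.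
have [k [[hkc]]] := filter_ex (filterI (filterI hc (lim_dphi _ e20)) (lim_df _ e20)).
rewrite /= (parts k hkc).
move: (\int[mu]_x (f x * difference_quotient phi j (- h k) x)) (\int[mu]_x (f x * partial j phi x))
  (\int[mu]_x (g j x * phi x)) => a b d.
rewrite !ler_norml => /andP[? ?] /andP[? ?]; apply/andP; split; lra.
Qed.

End weak_derivatives.

(** * Smooth bumps *)

Section flat_exponential.
Context {R : realType}.

(** The functions t^-k exp(-1/t), extended by 0; their span is stable under
    differentiation, and they vanish to infinite order at 0. *)
Definition flat_exp (k : nat) (t : R) : R :=
  if 0 < t then t^-1 ^+ k * expR (- t^-1) else 0.

Lemma flat_exp_ge0 k t : 0 <= flat_exp k t.
Proof.
rewrite /flat_exp; case: ifP => // t0.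
by rewrite mulr_ge0 ?expR_ge0// exprn_ge0// invr_ge0 ltW.
Qed.

(** One term of the exponential series at 1 / t; it makes the difference
    quotients at 0 tend to 0. *)
Lemma flat_exp_le_sqr k t : flat_exp k t <= k.+2`!%:R * t ^+ 2.
Proof.
rewrite /flat_exp; case: ifP => t0; last by rewrite mulr_ge0// sqr_ge0.
have s0 : 0 < t^-1 by rewrite invr_gt0.
rewrite expRN ler_pdivrMr ?expR_gt0//.
have t2 : 0 < t ^+ 2 by rewrite exprn_gt0.
rewrite mulrAC -ler_pdivrMr// -exprVn -exprD addn2.
have f0 : 0 < k.+2`!%:R :> R by rewrite ltr0n fact_gt0.
rewrite mulrC -ler_pdivrMr//; apply: le_trans (expR_ge1Dxn k.+1 (ltW s0)).
by rewrite lerDr.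
Qed.

Lemma is_derive_flat_exp k (t : R) :
  is_derive t (1 : R) (flat_exp k) (flat_exp k.+2 t - k%:R * flat_exp k.+1 t).
Proof.
have [t0|t0|->] := ltgtP t 0.
- have -> : flat_exp k.+2 t - k%:R * flat_exp k.+1 t = 0.
    by rewrite /flat_exp !ltNge (ltW t0)/= mulr0 subr0.
  apply: (@near_eq_is_derive _ _ _ (cst 0)).
    near=> s; rewrite /flat_exp ltNge (_ : s <= 0)//= ltW//; near: s; exact: lt_nbhsl.
- have tn0 : t != 0 by rewrite gt_eqF.
  apply: (@near_eq_is_derive R R R (fun s : R => s^-1 ^+ k * expR (- s^-1))).
    near=> s; rewrite /flat_exp (_ : 0 < s)//; near: s; exact: lt_nbhsr.
  have dV : is_derive t 1 (fun s : R => s^-1) (- t^-1 ^+ 2).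
    apply: is_derive_eq (is_deriveV tn0 (is_derive_id t (1 : R))) _.
    by rewrite /GRing.scale/= mulr1 exprVn.
  have dE : is_derive t 1 (fun s : R => expR (- s^-1)) (t^-1 ^+ 2 * expR (- t^-1)).
    have dN : is_derive t 1 (fun s : R => - s^-1) (t^-1 ^+ 2).
      by apply: is_derive_eq (is_deriveN dV) _; rewrite opprK.
    rewrite mulrC.
    exact: (@is_derive1_comp R expR (fun s : R => - s^-1) t _ _ (is_derive_expR (- t^-1)) dN).
  have dX := is_deriveX k dV.
  have -> : (fun s : R => s^-1 ^+ k * expR (- s^-1)) =
      (fun s : R => s^-1) ^+ k * (fun s : R => expR (- s^-1)).
    by apply/funext => s; rewrite mulrfctE exprfctE.
  apply: is_derive_eq (is_deriveM dX dE) _; rewrite exprfctE.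
  rewrite /flat_exp t0 /GRing.scale/=; case: k {dX} => [|k].
    by rewrite mul0r !mul0r subr0 mulr0 addr0 !expr0 !mul1r.
  rewrite -[k.+1.-1]/k !exprS; set y := t^-1; set E := expR _.
  by ring.
rewrite /flat_exp ltxx mulr0 subr0.
have d0 : h^-1 *: ((flat_exp k \o shift (0 : R)) (h *: (1 : R)) - flat_exp k 0) @[h --> (0 : R)^'] --> (0 : R).
  apply/cvgrPdist_le => e e0.
  have f0 : 0 < k.+2`!%:R :> R by rewrite ltr0n fact_gt0.
  have ef : 0 < e / k.+2`!%:R by rewrite divr_gt0.
  near=> h; rewrite sub0r normrN /= addr0 /GRing.scale/= mulr1.
  rewrite {2}/flat_exp ltxx subr0 normrM normfV (ger0_norm (flat_exp_ge0 _ _)).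
  have hn0 : h != 0 by near: h; exact: nbhs_dnbhs_neq.
  rewrite mulrC ler_pdivrMr ?normr_gt0//.
  apply: le_trans (flat_exp_le_sqr k h) _.
  rewrite -real_normK ?num_real// expr2 mulrA ler_wpM2r// mulrC -ler_pdivlMr//.
  near: h; apply: nbhs_dnbhs; apply/nbhs_ballP; exists (e / k.+2`!%:R) => //= h.
  by rewrite -ball_normE/= sub0r normrN => /ltW.
apply: DeriveDef; first by apply/cvg_ex; exists 0.
exact: cvg_lim d0.
Unshelve. all: by end_near. Qed.

End flat_exponential.

Section smooth_class.
Context {R : realType} {n : nat}.

Lemma is_derive_comp_real (F : R -> R) (q : 'rV[R]_n -> R) (x e : 'rV[R]_n) (a b : R) :
  is_derive (q x) 1 F a -> is_derive x e q b -> is_derive x e (F \o q) (a * b).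
Proof.
move=> dF [dq qb].
have xE : x + (0 : R) *: e = x by rewrite scale0r addr0.
have lq (p : 'rV[R]_n -> R) := line_quotient p e x 0.
have dl : is_derive (0 : R) 1 (fun t : R => q (x + t *: e)) b.
  by apply: DeriveDef; rewrite /derivable/derive lq xE.
have dF' : is_derive ((fun t : R => q (x + t *: e)) 0) 1 F a by rewrite xE.
have [dFq Fq] := is_derive1_comp dF' dl.
move: dFq Fq; rewrite /derivable/derive (lq (F \o q)) xE => dFq Fq.
exact: DeriveDef.
Qed.

(** The test functions needed below are built from polynomials and
    flat exponentials; this class is stable under partial derivatives. *)
Inductive elementary : ('rV[R]_n -> R) -> Prop :=
| elementary_cst c : elementary (cst c)
| elementary_coord i : elementary (fun x => x 0 i)
| elementary_add p q : elementary p -> elementary q -> elementary (fun x => p x + q x)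
| elementary_mul p q : elementary p -> elementary q -> elementary (fun x => p x * q x)
| elementary_flat_exp k q : elementary q -> elementary (fun x => flat_exp k (q x)).

Lemma elementary_continuous p : elementary p -> continuous p.
Proof.
elim=> [c|i|{}p q _ cp _ cq|{}p q _ cp _ cq|k q _ cq] x.
- exact: cst_continuous.
- exact: coord_continuous.
- exact: (cvgD (cp x) (cq x)).
- exact: (cvgM (cp x) (cq x)).
- apply: (continuous_comp (cq x)).
  apply/differentiable_continuous/derivable1_diffP.
  by have [] := is_derive_flat_exp k (q x).
Qed.

Lemma elementary_partial p j : elementary p -> exists2 p', elementary p' &
  forall x, is_derive x (delta_mx 0 j) p (p' x).
Proof.
elim=> [c|i|{}p q _ [p' ep dp] _ [q' eq dq]|{}p q ep0 [p' ep dp] eq0 [q' eq dq]|k q eq0 [q' eq dq]].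
- by exists (cst 0); [exact: elementary_cst|move=> x; exact: is_derive_cst].
- exists (cst (i == j)%:R); first exact: elementary_cst.
  move=> x; have dc : h^-1 *: (((fun y : 'rV[R]_n => y 0 i) \o shift x) (h *: delta_mx 0 j) - x 0 i)
      @[h --> (0 : R)^'] --> ((i == j)%:R : R).
    have c1 : (fun=> (i == j)%:R : R) h @[h --> (0 : R)^'] --> ((i == j)%:R : R) by exact: cvg_cst.
    apply: cvg_trans c1; apply: near_eq_cvg; near=> h.
    have hn0 : h != 0 by near: h; exact: nbhs_dnbhs_neq.
    by rewrite /= !mxE/= addrK /GRing.scale/= mulrA mulVf// mul1r.
  apply: DeriveDef; first by apply/cvg_ex; exists (i == j)%:R.
  exact: cvg_lim dc.
- exists (fun x => p' x + q' x); first exact: elementary_add.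
  by move=> x; exact: (is_deriveD (dp x) (dq x)).
- exists (fun x => p x * q' x + q x * p' x).
    by apply: elementary_add; exact: elementary_mul.
  by move=> x; exact: (is_deriveM (dp x) (dq x)).
- exists (fun x => (flat_exp k.+2 (q x) + (- k%:R) * flat_exp k.+1 (q x)) * q' x).
    apply: elementary_mul => //; apply: elementary_add; first exact: elementary_flat_exp.
    by apply: elementary_mul; [exact: elementary_cst|exact: elementary_flat_exp].
  move=> x; have := is_derive_comp_real (is_derive_flat_exp k (q x)) (dq x).
  by rewrite mulNr.
Unshelve. all: by end_near. Qed.

Lemma elementary_smooth p : elementary p -> smooth p.
Proof.
move=> ep s; suff es : elementary (iter_partial s p).
  split; first exact: elementary_continuous.
  by move=> j x; have [p' _ /(_ x)[]] := elementary_partial j es.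
elim: s => [//|j s ih] /=; have [p' ep' dp'] := elementary_partial j ih.
rewrite (_ : partial j _ = p')//; apply/funext => x.
by rewrite /partial; have [_ ->] := dp' x.
Qed.

Lemma elementary_sum (I : Type) (s : seq I) (p : I -> 'rV[R]_n -> R) :
  (forall i, elementary (p i)) -> elementary (fun x => \sum_(i <- s) p i x).
Proof.
move=> ep; elim: s => [|i s ih].
  by under eq_fun do rewrite big_nil; exact: elementary_cst.
by under eq_fun do rewrite big_cons; exact: elementary_add.
Qed.

End smooth_class.

Section bump.
Context {R : realType} {n : nat}.
Hypothesis n_gt0 : (0 < n)%N.
Implicit Types (c x : 'rV[R]_n) (r : R).

(** The square of the Euclidean norm keeps the argument of the flat exponential
    polynomial. *)
Definition smooth_bump c r x : R :=
  flat_exp 0 (1 - r^-1 ^+ 2 * \sum_(i < n) (x 0 i - c 0 i) ^+ 2).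

Let bumpE c r x : smooth_bump c r x = flat_exp 0 (1 - (enorm (x - c) / r) ^+ 2).
Proof.
have S0 : 0 <= \sum_(i < n) (x - c) 0 i ^+ 2 by apply: sumr_ge0 => i _; exact: sqr_ge0.
rewrite /smooth_bump /enorm exprMn sqr_sqrtr// mulrC; congr (flat_exp 0 (1 - _ * _)).
by apply: eq_bigr => i _; rewrite !mxE.
Qed.

Lemma smooth_bump_ge0 c r x : 0 <= smooth_bump c r x.
Proof. exact: flat_exp_ge0. Qed.

Lemma smooth_bump_le1 c r x : smooth_bump c r x <= 1.
Proof.
rewrite /smooth_bump /flat_exp; case: ifP => // t0; rewrite expr0 mul1r.
by rewrite expR_le1 oppr_le0 invr_ge0 ltW.
Qed.

Lemma smooth_bump_eq0 c r x : 0 < r -> r <= `|x - c| -> smooth_bump c r x = 0.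
Proof.
move=> r0 xr; rewrite bumpE /flat_exp ifF//; apply/negbTE; rewrite -leNgt subr_le0.
by rewrite exprn_ege1// ler_pdivlMr// mul1r (le_trans xr)// ler_enorm_norm.
Qed.

(** There the squared quotient of enorm (x - c) by r is at most 1 / 4, so the
    flat exponential is taken at a point t >= 3 / 4. *)
Lemma smooth_bump_ge c r x : 0 < r -> `|x - c| < r / (2 * n%:R) ->
  expR (- (4 / 3)) <= smooth_bump c r x.
Proof.
move=> r0 xr; have nn : 0 < n%:R :> R by rewrite ltr0n.
have e0 : 0 <= enorm (x - c) / r by rewrite divr_ge0 ?sqrtr_ge0// ltW.
have eh : enorm (x - c) / r <= 1 / 2.
  rewrite ler_pdivrMr// (le_trans (ler_norm_enorm _))//.
  move: xr; rewrite ltr_pdivlMr ?mulr_gt0// => /ltW; lra.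
have e4 : (enorm (x - c) / r) ^+ 2 <= 1 / 4.
  rewrite (_ : 1 / 4 = (1 / 2) ^+ 2); last by field.
  by rewrite lerXn2r// nnegrE divr_ge0.
rewrite bumpE /flat_exp; set t := 1 - _.
have t34 : 3 / 4 <= t by rewrite /t; lra.
have t0 : 0 < t by rewrite (lt_le_trans _ t34)// divr_gt0.
rewrite t0 expr0 mul1r ler_expR lerN2.
rewrite (_ : 4 / 3 = (3 / 4)^-1); last by field.
by rewrite lef_pV2 ?posrE// divr_gt0.
Qed.

Lemma smooth_bump_is_smooth c r : smooth (smooth_bump c r).
Proof.
apply: elementary_smooth; apply: elementary_flat_exp.
pose S (x : 'rV[R]_n) := \sum_(i < n) (x 0 i + (- c 0 i)) * (x 0 i + (- c 0 i)).
have eS : elementary S.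
  apply: elementary_sum => i.
  have ei : elementary (fun x : 'rV[R]_n => x 0 i + (- c 0 i)).
    by apply: elementary_add; [exact: elementary_coord|exact: elementary_cst].
  exact: elementary_mul.
rewrite (_ : (fun x => _) = (fun x => 1 + (- r^-1 ^+ 2) * S x)).
  apply: elementary_add; first exact: elementary_cst.
  by apply: elementary_mul; first exact: elementary_cst.
by apply/funext => x; rewrite mulNr; congr (1 - _ * _).
Qed.

Lemma smooth_bump_test_function (Omega : set 'rV[R]_n) c r : 0 < r ->
  ball c (2 * r) `<=` Omega -> test_function Omega (smooth_bump c r).
Proof.
move=> r0 cO.
have sub : supp (smooth_bump c r) `<=` [set x | `|x - c| <= r].
  move=> x sx; rewrite /= leNgt; apply/negP => rx.
  have d0 : 0 < `|x - c| - r by rewrite subr_gt0.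
  have [y [/= /negP by0]] := sx _ (nbhsx_ballx x _ d0).
  rewrite -ball_normE/= => xy; apply: by0; apply/eqP/smooth_bump_eq0 => //.
  have := ler_distD y x c; lra.
split; first exact: smooth_bump_is_smooth.
- apply: bounded_closed_compact; last exact: closed_closure.
  exists (r + `|c|); split; first by rewrite num_real.
  move=> M Mr x /sub /= xr; apply: le_trans (ltW Mr).
  by have := ler_normD (x - c) c; rewrite subrK; lra.
- move=> x /sub /= xr; apply: cO; rewrite -ball_normE/= distrC; lra.
Qed.

End bump.

(** * Uniqueness of the weak derivatives *)

Section uniqueness_of_weak_derivatives.
Context {R : realType} {n : nat}.
Notation mu := (@lebesgue R n).
Hypothesis n_gt0 : (0 < n)%N.
Variable Omega : set 'rV[R]_n.
Hypothesis oO : open Omega.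

(** A bump of radius r is at least exp(-4/3) on the cube of half-side r / (2 n),
    whose volume is at least (r / (2 n))^n. *)
Let kappa : R := expR (- (4 / 3)) / (2 * n%:R) ^+ n.

Let kappa_gt0 : 0 < kappa.
Proof. by rewrite divr_gt0 ?expR_gt0// exprn_gt0// mulr_gt0// ltr0n. Qed.

Let bump_continuous c r : continuous (@smooth_bump R n c r).
Proof. exact: (smooth_bump_is_smooth c r [::]).1. Qed.

Let bump_abs_le1 c r (x : 'rV[R]_n) : `|smooth_bump c r x| <= 1.
Proof. by rewrite ger0_norm ?smooth_bump_ge0// smooth_bump_le1. Qed.

Let bump_integrable c r s : mu.-integrable (ball c s) (EFin \o @smooth_bump R n c r).
Proof.
apply: (@bounded_lebesgue_integrable _ _ _ _ 1) => [||| x _]; last exact: bump_abs_le1.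
- exact: lmeasurable_ball.
- exact: lebesgue_ball_lty.
- have mb : lmeasurable_fun setT (smooth_bump c r) by exact: continuous_lmeasurable_fun.
  exact: measurable_funS mb.
Qed.

Let Rintegral_bump_ge c (r : R) : 0 < r ->
  kappa * r ^+ n <= \int[mu]_(x in ball c (2 * r)) smooth_bump c r x.
Proof.
move=> r0; have nn : 1 <= n%:R :> R by rewrite ler1n.
have nn0 : 0 < n%:R :> R by exact: lt_le_trans nn.
pose s := r / (2 * n%:R).
have s0 : 0 < s by rewrite divr_gt0// mulr_gt0.
have sr : s <= 2 * r by rewrite /s ler_pdivrMr ?mulr_gt0//; nra.
have mb : lmeasurable_fun setT (smooth_bump c r) by exact: continuous_lmeasurable_fun.
have mB t : lmeasurable (ball c t) by exact: lmeasurable_ball.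
rewrite -lee_fin /Rintegral fineK; last first.
  exact: (integrable_fin_num (mB _) (bump_integrable c r _)).
have -> : kappa * r ^+ n = expR (- (4 / 3)) * s ^+ n.
  by rewrite /kappa /s expr_div_n; field; rewrite expf_neq0// mulf_neq0// gt_eqF.
apply: (@le_trans _ _ (\int[mu]_(x in ball c s) (smooth_bump c r x)%:E)%E); last first.
  apply: (ge0_subset_lebesgue_integral (mB _) (mB _)).
  - exact: measurable_funS mb.
  - by move=> x _; exact: smooth_bump_ge0.
  - exact: le_ball.
apply: (@le_trans _ _ (\int[mu]_(x in ball c s) (expR (- (4 / 3)))%:E)%E).
  rewrite (lebesgue_integral_cst _ (mB s)) EFinM; apply: lee_wpmul2l.
    by rewrite lee_fin expR_ge0.
  exact: lebesgue_ball_ge.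
apply: (ge0_le_lebesgue_integral (mB s)).
- exact: measurable_cst.
- exact: measurable_funS mb.
- by move=> x _; exact: expR_ge0.
- move=> x; rewrite -ball_normE/= distrC => xs; exact: smooth_bump_ge.
Qed.

Let mul_bump_integrable (g : 'rV[R]_n -> R) c r s : lmeasurable_fun (ball c s) g ->
  (\int[mu]_(x in ball c s) `|g x|%:E < +oo)%E ->
  mu.-integrable (ball c s) (EFin \o (fun x => g x * smooth_bump c r x)).
Proof.
move=> mg goo; have mB : lmeasurable (ball c s) by exact: lmeasurable_ball.
have mb : lmeasurable_fun setT (smooth_bump c r) by exact: continuous_lmeasurable_fun.
have mgb : lmeasurable_fun (ball c s) (fun x => g x * smooth_bump c r x).
  by apply: measurable_funM => //; exact: measurable_funS mb.
apply: (lebesgue_integrable_lty mgb); apply: le_lt_trans goo.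
apply: (ge0_le_lebesgue_integral mB (lmeasurable_norm mgb) (lmeasurable_norm mg)).
  by move=> x _; exact: normr_ge0.
by move=> x _; rewrite normrM ler_piMr.
Qed.

(** Testing h = g1 - g2 with a bump of small radius r at x gives h x times the
    integral of the bump, which is at least kappa r^n, up to an error which is
    small compared with r^n because x is a Lebesgue point of h. *)
Let orthogonal_eq0 (g1 g2 : 'rV[R]_n -> R) x (K : set 'rV[R]_n) :
  nbhs x K -> K `<=` Omega -> lmeasurable K ->
  lmeasurable_fun Omega g1 -> lmeasurable_fun Omega g2 ->
  (\int[mu]_(y in K) `|g1 y|%:E < +oo)%E ->
  (\int[mu]_(y in K) `|g2 y|%:E < +oo)%E ->
  (forall phi, test_function Omega phi ->
    \int[mu]_(y in Omega) (g1 y * phi y)%:E = \int[mu]_(y in Omega) (g2 y * phi y)%:E)%E ->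
  (forall e : R, 0 < e -> exists2 d : R, 0 < d & forall r : R, 0 < r < d ->
    (\int[mu]_(y in ball x r) `|(g1 y - g2 y) - (g1 x - g2 x)|%:E <= (e * r ^+ n)%:E)%E) ->
  g1 x = g2 x.
Proof.
move=> xK KO mK mg1 mg2 g1oo g2oo ortho leb; apply/eqP; rewrite -subr_eq0; apply/negPn/negP => hx0.
pose a : R := `|g1 x - g2 x|; have a0 : 0 < a by rewrite normr_gt0.
have t2 : 0 < 2 ^+ n :> R by rewrite exprn_gt0.
pose e := a * kappa / (2 * 2 ^+ n).
have e0 : 0 < e by apply: divr_gt0; apply: mulr_gt0.
have [d d0 dP] := leb e e0.
have /nbhs_ballP[d' /= d'0 d'K] := xK.
pose r := Num.min d d' / 4.
have m0 : 0 < Num.min d d' by rewrite lt_min d0.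
have r0 : 0 < r by rewrite divr_gt0.
have rd : 2 * r < d.
  by have : Num.min d d' <= d by [rewrite ge_min lexx]; rewrite /r; lra.
have rd' : 2 * r < d'.
  by have : Num.min d d' <= d' by [rewrite ge_min lexx orbT]; rewrite /r; lra.
have r20 : 0 < 2 * r by rewrite mulr_gt0.
set B := ball x (2 * r).
have BK : B `<=` K by apply: subset_trans d'K; apply: le_ball; exact: ltW.
have BO : B `<=` Omega by exact: subset_trans KO.
have mB : lmeasurable B by exact: lmeasurable_ball.
have tb : test_function Omega (smooth_bump x r) by exact: smooth_bump_test_function.
have b0 y : ~ B y -> smooth_bump x r y = 0.
  move=> nBy; apply: smooth_bump_eq0 => //; rewrite leNgt; apply/negP => yr; apply: nBy.
  by rewrite /B -ball_normE/= distrC; apply: (lt_trans yr); lra.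
have mgB (g : 'rV[R]_n -> R) : lmeasurable_fun Omega g -> lmeasurable_fun B g.
  by move=> mg; apply: measurable_funS mg => //; exact: open_lmeasurable.
have gB (g : 'rV[R]_n -> R) : lmeasurable_fun Omega g ->
    (\int[mu]_(y in K) `|g y|%:E < +oo)%E -> (\int[mu]_(y in B) `|g y|%:E < +oo)%E.
  move=> mg; apply: le_lt_trans; apply: (ge0_subset_lebesgue_integral mB mK _ _ BK).
    by apply: lmeasurable_norm; apply: measurable_funS mg => //; exact: open_lmeasurable.
  by move=> y _; exact: normr_ge0.
have i1 := mul_bump_integrable r (mgB _ mg1) (gB _ mg1 g1oo).
have i2 := mul_bump_integrable r (mgB _ mg2) (gB _ mg2 g2oo).
pose h y := g1 y - g2 y.
have mb : lmeasurable_fun setT (smooth_bump x r) by exact: continuous_lmeasurable_fun.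
have mbB : lmeasurable_fun B (smooth_bump x r) by exact: measurable_funS mb.
have mh : lmeasurable_fun B h by apply: measurable_funB; exact: mgB.
have eqB (g : 'rV[R]_n -> R) : (\int[mu]_(y in Omega) (g y * smooth_bump x r y)%:E =
    \int[mu]_(y in B) (g y * smooth_bump x r y)%:E)%E.
  by apply: integral_lebesgue_restrict => // y /b0 ->; rewrite mulr0.
have hb0 : \int[mu]_(y in B) (h y * smooth_bump x r y) = 0.
  have -> : \int[mu]_(y in B) (h y * smooth_bump x r y) =
      \int[mu]_(y in B) (g1 y * smooth_bump x r y) - \int[mu]_(y in B) (g2 y * smooth_bump x r y).
    by rewrite -(RintegralB mB i1 i2); apply: eq_Rintegral => y _; rewrite /h mulrBl.
  rewrite (_ : \int[mu]_(y in B) (g1 y * smooth_bump x r y) = \int[mu]_(y in B) (g2 y * smooth_bump x r y)).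
    by rewrite subrr.
  by rewrite /Rintegral -!eqB (ortho _ tb).
have ih : mu.-integrable B (EFin \o (fun y => h y * smooth_bump x r y)).
  have := integrableB mB i1 i2; apply: eq_integrable => // y _.
  by rewrite /h /= mulrBl.
have ib := bump_integrable x r (2 * r).
have ihx : mu.-integrable B (EFin \o (fun y => h x * smooth_bump x r y)).
  exact: (integrableZl mB (h x) ib).
have key : `|\int[mu]_(y in B) ((h y - h x) * smooth_bump x r y)| <= e * (2 * r) ^+ n.
  have mhx : lmeasurable_fun B (fun y => h y - h x).
    by apply: measurable_funB; [exact: mh|exact: measurable_cst].
  have mhb : lmeasurable_fun B (fun y => (h y - h x) * smooth_bump x r y).
    by apply: measurable_funM; [exact: mhx|exact: mbB].
  apply: (normr_Rintegral_le mB mhb).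
  apply: le_trans (dP (2 * r) _); last by rewrite r20.
  apply: (ge0_le_lebesgue_integral mB (lmeasurable_norm mhb) (lmeasurable_norm mhx)).
    by move=> y _; exact: normr_ge0.
  by move=> y _; rewrite normrM ler_piMr.
have E : \int[mu]_(y in B) ((h y - h x) * smooth_bump x r y) =
    - (h x * \int[mu]_(y in B) smooth_bump x r y).
  rewrite -(RintegralZl (h x) mB ib) -[RHS]add0r -[in RHS]hb0 -(RintegralB mB ih ihx).
  by apply: eq_Rintegral => y _; rewrite mulrBl.
have := Rintegral_bump_ge x r0; rewrite -/B => bge.
have bI0 : 0 <= \int[mu]_(y in B) smooth_bump x r y.
  by apply: Rintegral_ge0 => y _; exact: smooth_bump_ge0.
move: key; rewrite E normrN normrM (ger0_norm bI0) -/a => key.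
have : a * (kappa * r ^+ n) <= e * (2 * r) ^+ n.
  by apply: le_trans key; rewrite ler_pM2l.
have -> : (2 * r) ^+ n = 2 ^+ n * r ^+ n by rewrite exprMn.
rewrite /e.
have -> : a * kappa / (2 * 2 ^+ n) * (2 ^+ n * r ^+ n) = a * (kappa * r ^+ n) / 2.
  by field; exact: lt0r_neq0.
have : 0 < a * (kappa * r ^+ n).
  by apply: mulr_gt0 => //; apply: mulr_gt0 => //; exact: exprn_gt0.
lra.
Qed.

Let compact_part (m : nat) : set 'rV[R]_n :=
  [set x | ball x m.+1%:R^-1 `<=` Omega] `&` [set x | `|x| <= m.+1%:R].

Let compact_part_closed m : closed (compact_part m).
Proof.
apply: closedI; first exact: closed_ball_sub_set.
apply: (@closed_comp _ _ (fun x : 'rV[R]_n => `|x|) [set t | t <= m.+1%:R]); last exact: closed_le.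
by move=> x _; exact: norm_continuous.
Qed.

Let compact_part_compact m : compact (compact_part m).
Proof.
apply: bounded_closed_compact; last exact: compact_part_closed.
exists m.+1%:R; split; first by rewrite num_real.
by move=> M mM x [_ /= xm]; exact: le_trans (ltW mM).
Qed.

Let compact_part_sub m : compact_part m `<=` Omega.
Proof. by move=> x [xO _]; apply: xO; apply: ballxx; rewrite invr_gt0 ltr0n. Qed.

Let compact_part_nbhs x : Omega x -> exists m, nbhs x (compact_part m).
Proof.
move=> /(inner_part_nbhs oO)[m xm]; exists m; apply: filterS xm => y.
by move=> /interior_subset[yO]; rewrite -ball_normE/= sub0r normrN => /ltW.
Qed.

(** Weak derivatives are only locally integrable on Omega, so they are cut off
    outside a compact part of Omega to have Lebesgue points. *)
Lemma weak_derivative_unique j (f g1 g2 : 'rV[R]_n -> R) :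
  weak_derivative Omega j f g1 -> weak_derivative Omega j f g2 ->
  {ae mu, forall x, Omega x -> g1 x = g2 x}.
Proof.
move=> [_ [mg1 lg1] d1] [_ [mg2 lg2] d2].
have ortho phi : test_function Omega phi ->
    (\int[mu]_(y in Omega) (g1 y * phi y)%:E = \int[mu]_(y in Omega) (g2 y * phi y)%:E)%E.
  by move=> tphi; apply: oppe_inj; rewrite -(d1 _ tphi) -(d2 _ tphi).
have mK m : lmeasurable (compact_part m) by exact: closed_lmeasurable.
have mh : lmeasurable_fun Omega (fun y => g1 y - g2 y) by exact: measurable_funB.
have mO : lmeasurable Omega by exact: open_lmeasurable.
pose h m : 'rV[R]_n -> R := (fun y => g1 y - g2 y) \_ (compact_part m).
have mhm m : lmeasurable_fun setT (h m).
  have mhK : lmeasurable_fun (compact_part m) (fun y => g1 y - g2 y).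
    exact: (measurable_funS mO (@compact_part_sub m) mh).
  by apply/(measurable_restrictT _ (mK m)).
have leb : {ae mu, forall x, forall m, forall e : R, 0 < e -> exists2 d : R, 0 < d &
    forall r : R, 0 < r < d ->
    (\int[mu]_(y in ball x r) `|h m y - h m x|%:E <= (e * r ^+ n)%:E)%E}.
  apply: ae_forall_countable => m; apply: (ae_lebesgue_point (mhm m)) => r.
  have i1 : mu.-integrable (compact_part m) (EFin \o g1).
    apply: lebesgue_integrable_lty; last exact: lg1 (@compact_part_sub m) (@compact_part_compact m).
    exact: (measurable_funS mO (@compact_part_sub m) mg1).
  have i2 : mu.-integrable (compact_part m) (EFin \o g2).
    apply: lebesgue_integrable_lty; last exact: lg2 (@compact_part_sub m) (@compact_part_compact m).
    exact: (measurable_funS mO (@compact_part_sub m) mg2).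
  have ih : mu.-integrable setT (EFin \o h m).
    rewrite /h -restrict_EFin -integrable_mkcond//.
    exact: (integrableB (mK m) i1 i2).
  apply: lebesgue_integrable_lty_of; apply: lebesgue_integrableS ih.
  exact: lmeasurable_ball.
apply: ae_imply leb => x lebx Ox.
have [m xm] := compact_part_nbhs Ox.
have Kx : compact_part m x by exact: nbhs_singleton.
apply: (orthogonal_eq0 xm (@compact_part_sub m) (mK m) mg1 mg2 _ _ ortho).
- exact: lg1 (@compact_part_sub m) (@compact_part_compact m).
- exact: lg2 (@compact_part_sub m) (@compact_part_compact m).
- move=> e e0; have [d d0 dP] := lebx m e e0.
  have /nbhs_ballP[d' /= d'0 d'K] := xm.
  exists (Num.min d d'); first by rewrite lt_min d0.
  move=> r /andP[r0]; rewrite lt_min => /andP[rd rd'].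
  have := dP r; rewrite r0 rd => /(_ isT); apply: le_trans.
  rewrite le_eqVlt; apply/orP; left; apply/eqP; apply: eq_integral => y; rewrite inE => yr.
  rewrite /h !patchE !mem_set//; apply: d'K; apply: le_ball yr; exact: ltW.
Qed.

End uniqueness_of_weak_derivatives.

(** * Dependence on the values in the open set *)

Section values_on_open_set.
Context {R : realType} {n : nat}.
Notation mu := (@lebesgue R n).
Variables (Omega : set 'rV[R]_n) (f f' : 'rV[R]_n -> R).
Hypothesis ff' : forall x, Omega x -> f x = f' x.

Lemma eq_riesz_variation w : riesz_variation Omega w f = riesz_variation Omega w f'.
Proof.
have oscE (E : set 'rV[R]_n) : E `<=` Omega -> osc E f = osc E f'.
  move=> EO; rewrite /osc; congr ereal_sup; apply/seteqP; split=> _ [x Ex [y Ey <-]].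
    by exists x => //; exists y => //; rewrite !ff'//; exact: EO.
  by exists x => //; exists y => //; rewrite !ff'//; exact: EO.
pose F u B := poweR (\esum_(b in B) ((osc (eball b.1 b.2) u * b.2^-1%:E) ^+ n *
  wmeasure w (eball b.1 b.2)))%E n%:R^-1.
have FE B : ball_family Omega B -> F f B = F f' B.
  move=> [_ _ fB]; rewrite /F; congr poweR; apply: eq_esum => b Bb.
  by rewrite oscE//; have [] := fB b Bb.
rewrite /riesz_variation; congr ereal_sup; apply/seteqP; split=> _ [B fB <-]; exists B.
- exact: fB.
- exact/esym/FE.
- exact: fB.
- exact: FE.
Qed.

Lemma weak_derivative_congr j g : open Omega ->
  weak_derivative Omega j f g -> weak_derivative Omega j f' g.
Proof.
move=> oO [[mf lf] lg parts]; split=> // [|phi tphi].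
  split; first by apply: eq_measurable_fun mf => x; rewrite inE; exact: ff'.
  move=> K KO cK; have -> : (\int[mu]_(x in K) `|f' x|%:E = \int[mu]_(x in K) `|f x|%:E)%E.
    by apply: eq_integral => x; rewrite inE => /KO Ox; rewrite ff'.
  exact: lf.
rewrite -(parts _ tphi); apply: eq_integral => x; rewrite inE => Ox.
by rewrite ff'.
Qed.

Lemma differentiable_congr x : open Omega -> Omega x ->
  differentiable f x -> differentiable f' x.
Proof.
move=> oO Ox df; have [cdf /eqaddoP fE] := (diff_locallyP x f).1 df.
have := @diff_unique R 'rV[R]_n R f' ('d f x) x cdf.
move=> dE; lazymatch type of dE with ?P -> _ => have fdf : P end.
  apply/eqaddoP => e e0.
  have /nbhs_ballP[d /= d0 dO] : nbhs x Omega by exact: open_nbhs_nbhs.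
  have near0 : \forall z \near (0 : 'rV[R]_n), Omega (z + x).
    apply/nbhs_ballP; exists d => //= z; rewrite -ball_normE/= sub0r normrN => zd.
    by apply: dO; rewrite -ball_normE/= opprD addrCA subrr addr0 normrN.
  apply: filterS2 near0 (fE e e0) => z Oz.
  by rewrite !fctE /= -(ff' Oz) -(ff' Ox).
by apply/diff_locallyP; rewrite (dE fdf).
Qed.

End values_on_open_set.

(** * The norm of the weak gradient *)

Lemma exprn_enorm_le (R : realType) (n : nat) (v : 'rV[R]_n) : (0 < n)%N ->
  enorm v ^+ n <= n%:R ^+ n * \sum_(j < n) `|v 0 j| ^+ n.
Proof.
move=> n0; apply: (@le_trans _ _ ((n%:R * `|v|) ^+ n)).
  by rewrite lerXn2r ?nnegrE ?sqrtr_ge0 ?mulr_ge0// ler_norm_enorm.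
rewrite exprMn ler_wpM2l ?exprn_ge0//.
have [v0|v0] := eqVneq `|v| 0.
  by rewrite v0 expr0n gtn_eqF//= sumr_ge0// => j _; exact: exprn_ge0.
have [[i j] /= vE] := mx_norm_neq0 v0.
rewrite -[`|v|]/(mx_norm v) vE (ord1 i) (bigD1 j)//= lerDl.
by apply: sumr_ge0 => k _; exact: exprn_ge0.
Qed.

Section gradient_bound.
Context {R : realType} {n : nat}.
Variables (Omega : set 'rV[R]_n) (w f : 'rV[R]_n -> R) (v : R).
Notation mu := (@lebesgue R n).
Hypothesis n2 : (2 <= n)%N.
Hypothesis oO : open Omega.
Hypothesis w0 : forall x, 0 <= w x.
Hypothesis mw : lmeasurable_fun setT w.
Hypothesis wpos : {ae mu, forall x, 0 < w x}.
Hypothesis dw_lty : forall r,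
  (\int[mu]_(x in ball (0%R : 'rV[R]_n) r) (dual_weight w x)%:E < +oo)%E.
Hypothesis mf : lmeasurable_fun setT f.
Hypothesis fv : (riesz_variation Omega w f <= v%:E)%E.
Hypothesis foo : (\int[mu]_(x in Omega) (`|f x| ^+ n * w x)%:E < +oo)%E.

Let n_gt0 : (0 < n)%N. Proof. exact: ltnW. Qed.

Let v0 : 0 <= v.
Proof. by rewrite -lee_fin (le_trans _ fv)// riesz_variation_ge0. Qed.

Let C : R := (18 * n%:R ^+ 2) ^+ n * v ^+ n.

Let lmeasurable_enorm (Df : 'rV[R]_n -> 'rV[R]_n) :
  (forall j, lmeasurable_fun Omega (fun x => Df x 0 j)) ->
  lmeasurable_fun Omega (fun x => enorm (Df x)).
Proof.
move=> mD; apply: (measurableT_comp (continuous_measurable_fun (@sqrt_continuous R))).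
apply: measurable_sum => j.
by apply: measurable_funX; exact: mD.
Qed.

Lemma integral_normX_weak_gradient_le Df : weak_gradient Omega f Df ->
  (\int[mu]_(x in Omega) (`|enorm (Df x)| ^+ n * w x)%:E <=
    (n%:R ^+ n * (n%:R * C))%:E)%E.
Proof.
move=> wD; have mO : lmeasurable Omega by exact: open_lmeasurable.
have mD j : lmeasurable_fun Omega (fun x => Df x 0 j) by have [_ []] := wD j.
have mwO : lmeasurable_fun Omega w by exact: measurable_funS mw.
pose g := partial_limit f.
have gD : {ae mu, forall x, forall j, Omega x -> Df x 0 j = g j x}.
  apply: ae_forall_countable => j; apply: (weak_derivative_unique n_gt0 oO (wD j)).
  exact: (weak_derivative_partial_limit n2 oO w0 mw wpos dw_lty mf fv foo j).
pose G j x := `|g j x| ^+ n * w x.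
have mG j : lmeasurable_fun Omega (G j).
  apply: measurable_funM; last exact: mwO.
  by apply: lmeasurable_normX; exact: lmeasurable_partial_limit.
have G0 j x : 0 <= G j x by rewrite mulr_ge0 ?exprn_ge0.
have mS : lmeasurable_fun Omega (fun x => \sum_(j < n) G j x).
  by apply: measurable_sum => j; exact: mG.
have S0 x : 0 <= \sum_(j < n) G j x by apply: sumr_ge0 => j _; exact: G0.
have nn0 : 0 <= n%:R ^+ n :> R by rewrite exprn_ge0.
apply: (@le_trans _ _ (\int[mu]_(x in Omega) (n%:R ^+ n * \sum_(j < n) G j x)%:E)%E).
  apply: ae_ge0_le_integral => //.
  - by move=> x _; rewrite lee_fin mulr_ge0 ?exprn_ge0.
  - apply/measurable_EFinP; apply: measurable_funM; last exact: mwO.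
    by apply: lmeasurable_normX; exact: lmeasurable_enorm.
  - by move=> x _; rewrite lee_fin mulr_ge0.
  - by apply/measurable_EFinP; apply: measurable_funM; [exact: measurable_cst|exact: mS].
  - apply: ae_imply gD => x gx Ox; rewrite lee_fin /G -mulr_suml mulrA ler_wpM2r//.
    rewrite ger0_norm ?sqrtr_ge0// (le_trans (exprn_enorm_le _ n_gt0))// ler_wpM2l//.
    by apply: ler_sum => j _; rewrite gx.
rewrite (ge0_lebesgue_integralZl mO mS (fun x _ => S0 x) nn0) EFinM.
apply: lee_wpmul2l; first by rewrite lee_fin.
under eq_integral do rewrite -sumEFin.
rewrite ge0_integral_sum//; last 2 first.
- by move=> j; apply/measurable_EFinP; exact: mG.
- by move=> j x _; rewrite lee_fin.
apply: (@le_trans _ _ (\sum_(j < n) C%:E)%E).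
  apply: lee_sum => j _.
  exact: (integral_normX_partial_limit_le n2 oO w0 mw wpos dw_lty mf fv j).
by rewrite sumEFin sumr_const card_ord mulr_natl.
Qed.

(** Each partial derivative contributes (18 n^2)^n v^n. The sum over the partial
    derivatives costs a factor n <= n^n, and the comparison of the norms on R^n
    a factor n^n. *)
Lemma Ln_norm_weak_gradient_le Df : weak_gradient Omega f Df ->
  (Ln_norm Omega w (fun x => enorm (Df x)) <= (18 * n%:R ^+ 4 * v)%:E)%E.
Proof.
move=> wD; have nn : 1 <= n%:R :> R by rewrite ler1n.
have b0 : 0 <= 18 * n%:R ^+ 4 * v by rewrite !mulr_ge0 ?exprn_ge0.
have -> : 18 * n%:R ^+ 4 * v = ((18 * n%:R ^+ 4 * v) ^+ n) `^ n%:R^-1.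
  by rewrite -(powR_mulrn n b0) -powRrM divff ?powRr1// pnatr_eq0 -lt0n.
rewrite -poweR_EFin; apply: gt0_ler_poweR; first by rewrite invr_ge0.
- rewrite in_itv/= leey andbT; apply: integral_ge0 => x _.
  by rewrite lee_fin mulr_ge0 ?exprn_ge0.
- by rewrite in_itv/= leey andbT lee_fin exprn_ge0.
apply: le_trans (integral_normX_weak_gradient_le wD) _; rewrite lee_fin /C.
rewrite (_ : (18 * n%:R ^+ 4 * v) ^+ n = n%:R ^+ n * (n%:R ^+ n * ((18 * n%:R ^+ 2) ^+ n * v ^+ n))).
  rewrite ler_wpM2l ?exprn_ge0// ler_wpM2r ?mulr_ge0 ?exprn_ge0 ?mulr_ge0 ?exprn_ge0//.
  by rewrite ler_eXnr.
by rewrite -!exprMn; congr (_ ^+ n); ring.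
Qed.

End gradient_bound.

Theorem theorem1p9 (R : realType) (n : nat) (n_ge2 : (2 <= n)%N)
    (Omega : set 'rV[R]_n) (open_Omega : open Omega)
    (w : 'rV[R]_n -> R) (w_An : Ap n%:R w) :
  exists2 C : R, 0 < C & forall f : 'rV[R]_n -> R,
    RBVn Omega w f -> Ln Omega w f ->
    [/\ W1n Omega w f,
        forall Df : 'rV[R]_n -> 'rV[R]_n, weak_gradient Omega f Df ->
          (Ln_norm Omega w (fun x => enorm (Df x)) <=
             C%:E * riesz_variation Omega w f)%E
      & {ae @lebesgue R n, forall x, Omega x -> differentiable f x}].
Proof.
have [[w0 [mw _]] _ _] := w_An.
have [wpos dw_lty] := Ap_dual_weight n_ge2 w_An.
have n_gt0 : (0 < n)%N by exact: ltnW.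
have nn0 : 0 < n%:R :> R by rewrite ltr0n.
exists (18 * n%:R ^+ 4); first by rewrite mulr_gt0// exprn_gt0.
move=> f [mf RVf] [_ Lf].
have mO : lmeasurable Omega by exact: open_lmeasurable.
have foo : (\int[@lebesgue R n]_(x in Omega) (`|f x| ^+ n * w x)%:E < +oo)%E.
  by apply: lty_poweRy Lf; rewrite invr_eq0 gt_eqF.
(* f is only known on Omega; its extension by 0 is measurable on R^n. *)
pose f' := f \_ Omega.
have ff' x : Omega x -> f x = f' x by move=> Ox; rewrite /f' patchE mem_set.
have f'f x : Omega x -> f' x = f x by move=> Ox; rewrite ff'.
have mf' : lmeasurable_fun setT f' by apply/(measurable_restrictT _ mO).
have RVE := eq_riesz_variation ff' w.
pose v := fine (riesz_variation Omega w f).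
have vE : riesz_variation Omega w f = v%:E.
  apply/esym/fineK; rewrite ge0_fin_numE; first exact: RVf.
  exact: riesz_variation_ge0.
have fv : (riesz_variation Omega w f' <= v%:E)%E by rewrite -RVE vE.
have foo' : (\int[@lebesgue R n]_(x in Omega) (`|f' x| ^+ n * w x)%:E < +oo)%E.
  suff -> : (\int[@lebesgue R n]_(x in Omega) (`|f' x| ^+ n * w x)%:E =
    \int[@lebesgue R n]_(x in Omega) (`|f x| ^+ n * w x)%:E)%E by exact: foo.
  by apply: eq_integral => x; rewrite inE => Ox; rewrite -ff'.
split.
- split; first by split.
  move=> j; exists (partial_limit f' j).
    apply: (weak_derivative_congr f'f open_Omega).
    exact: (weak_derivative_partial_limit n_ge2 open_Omega w0 mw wpos dw_lty mf' fv foo' j).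
  split; first exact: lmeasurable_partial_limit.
  apply: poweR_lty; apply: le_lt_trans (ltry _).
  exact: (integral_normX_partial_limit_le n_ge2 open_Omega w0 mw wpos dw_lty mf' fv j).
- move=> Df wD; rewrite vE -EFinM.
  apply: (Ln_norm_weak_gradient_le n_ge2 open_Omega w0 mw wpos dw_lty mf' fv foo').
  by move=> j; exact: (weak_derivative_congr ff' open_Omega (wD j)).
- apply: ae_imply (ae_differentiable n_ge2 open_Omega w0 mw wpos dw_lty mf' fv) => x dx Ox.
  exact: (differentiable_congr f'f open_Omega Ox (dx Ox)).
Qed.
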